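(* For real-valued parameters $c$ such that $K_c(\tau)$ is unitarisable, there is the following joint $(\mathcal R,\mathfrak u(2|1))$-decomposition: $$K_c(\tau)=\bigoplus_{l=0}^{n}\ \bigoplus_{k\in\mathbb Z_{\ge0}}\ \bigoplus_{\nu\in\mathscr S_c(\tau)_k^l}\mathcal M_c(\tau)_{k,\nu}^l\otimes L_{\mathfrak u(2|1)}\big(k+n-N_c(\tau),\nu,l-\tfrac n2\big),$$ where $L_{\mathfrak u(2|1)}(\lambda,\nu,\gamma)$ denotes the irreducible lowest weight representation of $\mathfrak u(2|1)$ of $(H,Z_1,Z_2)$-lowest weight $(\lambda,\nu,\gamma)$.
   Context: $E$ is a real vector space of dimension $2n$ with a positive definite symmetric bilinear form $B$ ($\|\alpha\|^2=B(\alpha,\alpha)$); $\langle\cdot,\cdot\rangle$ is the ($\mathbb C$-bilinearly extended) pairing between $E^*$ and $E$. $G$ is a finite reflection group acting on $E$ by orthogonal transformations, $\mathcal S$ its set of reflections. For $s\in\mathcal S$, $\alpha_s\in E$, $a_s\in E^*$ are fixed $(-1)$-eigenvectors of $s$ and $\alpha_s^\vee=2a_s/\langle a_s,\alpha_s\rangle$. $c$ is a conjugation-invariant function on $\mathcal S$. $H_c(G,E)$ is the quotient of $T(E_{\mathbb C}\oplus E_{\mathbb C}^* )\rtimes G$ (where $gX=(g\cdot X)g$) by $[\xi,\eta]=0$ ($\xi,\eta\in E$), $[x,y]=0$ ($x,y\in E^*$), $[\xi,x]=\langle x,\xi\rangle-\sum_{s}\langle x,\alpha_s\rangle\langle\alpha_s^\vee,\xi\rangle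 c(s)s$. A complex structure $J\in\mathrm{SO}(E,B)$, $J^T=-J$, is fixed, with orthonormal basis $\xi_1,\dots,\xi_n,\eta_1,\dots,\eta_n$ such that $J\xi_j=-\eta_j$, $J\eta_j=\xi_j$, and dual basis $x_j,y_j$. Set $z_j=x_j+iy_j$, $\bar z_j=x_j-iy_j$, $\zeta_j=\frac12(\xi_j-i\eta_j)$, $\bar\zeta_j=\frac12(\xi_j+i\eta_j)$; $E_+=\frac12\sum_jz_j\bar z_j$, $E_-=-2\sum_j\zeta_j\bar\zeta_j$, $H=\sum_j(z_j\zeta_j+\bar z_j\bar\zeta_j)+n-\sum_sc(s)s$, $Z_0=\sum_j(\bar z_j\bar\zeta_j-z_j\zeta_j)$. $\mathcal C$ is the complex Clifford algebra of $E_{\mathbb C}$ with generators $e_1,\dots,e_{2n}$, $\{e_j,e_k\}=2\delta_{jk}$; $f_j=\frac12(e_j-ie_{n+j})$, $f_j^\dagger=\frac12(e_j+ie_{n+j})$. The spinor space $\mathbb S$ is the exterior algebra on $f_1^\dagger,\dots,f_n^\dagger$, with $f_j^\dagger$ acting by exterior multiplication and $f_j$ by the corresponding Grassmann derivative; $\mathbb S^l$ is its degree-$l$ part; $(\cdot,\cdot)_{\mathbb S}$ is the positive definite Hermitian form on $\mathbb S$ induced from the Hermitian extension of $B$ to $E_{\mathbb C}$, with $(f_j^\dagger u,w)_{\mathbb S}=(u,f_jw)_{\mathbb S}$. For $s\in\mathcal S$, $\tau_s=1-\frac{2}{\|\alpha_s\|^2}\big(\sum_j\langle\bar z_j,\alpha_s\rangle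 f_j^\dagger\big)\big(\sum_k\langle z_k,\alpha_s\rangle f_k\big)$ and $\Omega_c=\sum_sc(s)s\otimes\tau_s$. The Lie superalgebra $\mathfrak u(2|1)\subset H_c(G,E)\otimes\mathcal C$ has odd part spanned by $F_+=\sum_j\bar z_jf_j^\dagger$, $\bar F_+=\sum_jz_jf_j$, $F_-=2\sum_j\zeta_jf_j^\dagger$, $\bar F_-=2\sum_j\bar\zeta_jf_j$, and even part spanned by $E_\pm$, $H$, $Z_1=Z_0-\Omega_c$, $Z_2=\sum_jf_j^\dagger f_j-\frac n2$. $\mathcal R$ is its centraliser algebra in $H_c(G,E)\otimes\mathcal C$. For an irreducible $\mathbb C[G]$-module $\tau$ on $V(\tau)$, $M_c(\tau)\cong\mathbb C[E]\otimes V(\tau)$ is the standard module of $H_c(G,E)$ (induced from $V(\tau)$ with $E$ acting on $V(\tau)$ by zero), $M_c(\tau)_k$ its degree-$k$ part, and $N_c(\tau)$ the scalar by which $\sum_sc(s)s$ acts on $V(\tau)$. For real $c$, $M_c(\tau)$ carries a Hermitian form $\beta_{c,\tau}$ restricting to a $G$-invariant inner product on $V(\tau)$ with $\beta_{c,\tau}(hp,q)=\beta_{c,\tau}(p,h^*q)$, where $\ast$ is the conjugate-linear anti-involution with $\xi_j^*=x_j$, $x_j^*=\xi_j$, $\eta_j^*=y_j$, $y_j^*=\eta_j$, $s^*=s$. $K_c(\tau)=M_c(\tau)\otimes\mathbb S$ has the product Hermitian form $(\cdot|\cdot)$ and is unitarisable if this form is positive definite. $\mathcal H_c(\tau)_k^l=(M_c(\tau)_k\cap\ker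 E_-)\otimes\mathbb S^l$; $\mathscr S_c(\tau)_k^l$ is the set of eigenvalues of $Z_1$ on $\mathcal H_c(\tau)_k^l$; $\mathcal H_c(\tau)_{k,\nu}^l$ is the $\nu$-eigenspace of $Z_1$ in $\mathcal H_c(\tau)_k^l$; $\mathcal M_c(\tau)_{k,\nu}^l=\mathcal H_c(\tau)_{k,\nu}^l\cap\ker F_-\cap\ker\bar F_-$. A lowest weight vector is one annihilated by $E_-,F_-,\bar F_-$ and is an eigenvector of $H,Z_1,Z_2$. *)

(* Defs.v *)
From HB Require Import structures.
From mathcomp Require Import all_boot all_order all_algebra all_fingroup.
From mathcomp Require Import generic_quotient complex boolp reals ring.

Set Implicit Arguments.
Unset Strict Implicit.
Unset Printing Implicit Defensive.

Import Order.TTheory GRing.Theory Num.Theory.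
Local Open Scope quotient_scope.
Local Open Scope ring_scope.

(* [pmod rel] is the vector space with generating set [X] and relations [rel]:
   formal linear combinations modulo the least congruence that contains [rel]
   and the axioms of a vector space. *)

Section PresentedModule.
Variables (K : fieldType) (X : Type).

Inductive lterm :=
| LGen of X
| LZero
| LOpp of lterm
| LAdd of lterm & lterm
| LScale of K & lterm.

HB.instance Definition _ := gen_eqMixin lterm.
HB.instance Definition _ := gen_choiceMixin lterm.

Variable rel : lterm -> lterm -> Prop.

Inductive leqv : lterm -> lterm -> Prop :=
| leqv_rel s t of rel s t : leqv s t
| leqv_refl s : leqv s s
| leqv_sym s t of leqv s t : leqv t s
| leqv_trans t s u of leqv s t & leqv t u : leqv s u
| leqv_opp s s' of leqv s s' : leqv (LOpp s) (LOpp s')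
| leqv_add s s' t t' of leqv s s' & leqv t t' : leqv (LAdd s t) (LAdd s' t')
| leqv_scale k s s' of leqv s s' : leqv (LScale k s) (LScale k s')
| leqv_addA s t u : leqv (LAdd s (LAdd t u)) (LAdd (LAdd s t) u)
| leqv_addC s t : leqv (LAdd s t) (LAdd t s)
| leqv_add0 s : leqv (LAdd LZero s) s
| leqv_addN s : leqv (LAdd (LOpp s) s) LZero
| leqv_scaleA a b s : leqv (LScale a (LScale b s)) (LScale (a * b) s)
| leqv_scale1 s : leqv (LScale 1 s) s
| leqv_scaleDr a s t :
    leqv (LScale a (LAdd s t)) (LAdd (LScale a s) (LScale a t))
| leqv_scaleDl a b s :
    leqv (LScale (a + b) s) (LAdd (LScale a s) (LScale b s)).

Definition leqvb (s t : lterm) : bool := `[< leqv s t >].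

Lemma leqvb_equiv : equiv_class_of leqvb.
Proof.
split=> [s | s t | t s u]; first exact/asboolP/leqv_refl.
- by apply/asboolP/asboolP => /leqv_sym.
- by move=> /asboolP st /asboolP tu; apply/asboolP/(leqv_trans st tu).
Qed.

Canonical leqv_equiv := EquivRelPack leqvb_equiv.

Definition pmod := {eq_quot leqv_equiv}.

HB.instance Definition _ := Choice.on pmod.

Definition lclass (s : lterm) : pmod := \pi_({eq_quot leqv_equiv}) s.

Lemma lclassP s t : lclass s = lclass t <-> leqv s t.
Proof.
split=> [st | /asboolP st]; first by apply/asboolP; move/eqmodP: st.
by apply/eqmodP.
Qed.

Lemma lclass_repr (q : pmod) : lclass (repr q) = q.
Proof. exact: reprK. Qed.

Lemma leqv_repr s : leqv (repr (lclass s)) s.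
Proof. by apply/lclassP; rewrite lclass_repr. Qed.

Definition pm_opp (q : pmod) := lclass (LOpp (repr q)).
Definition pm_add (q r : pmod) := lclass (LAdd (repr q) (repr r)).
Definition pm_scale k (q : pmod) := lclass (LScale k (repr q)).

Lemma pm_oppE s : pm_opp (lclass s) = lclass (LOpp s).
Proof. exact/lclassP/leqv_opp/leqv_repr. Qed.
Lemma pm_addE s t : pm_add (lclass s) (lclass t) = lclass (LAdd s t).
Proof. by apply/lclassP/leqv_add; apply: leqv_repr. Qed.
Lemma pm_scaleE k s : pm_scale k (lclass s) = lclass (LScale k s).
Proof. exact/lclassP/leqv_scale/leqv_repr. Qed.

Let pm_ind (P : pmod -> Prop) : (forall s, P (lclass s)) -> forall q, P q.
Proof. by move=> Ps q; rewrite -(lclass_repr q). Qed.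

Lemma pm_addA : associative pm_add.
Proof.
elim/pm_ind=> s; elim/pm_ind=> t; elim/pm_ind=> u.
by rewrite !pm_addE; apply/lclassP/leqv_addA.
Qed.
Lemma pm_addC : commutative pm_add.
Proof.
by elim/pm_ind=> s; elim/pm_ind=> t; rewrite !pm_addE; apply/lclassP/leqv_addC.
Qed.
Lemma pm_add0 : left_id (lclass LZero) pm_add.
Proof. by elim/pm_ind=> s; rewrite pm_addE; apply/lclassP/leqv_add0. Qed.
Lemma pm_addN : left_inverse (lclass LZero) pm_opp pm_add.
Proof. by elim/pm_ind=> s; rewrite pm_oppE pm_addE; apply/lclassP/leqv_addN. Qed.

HB.instance Definition _ :=
  GRing.isZmodule.Build pmod pm_addA pm_addC pm_add0 pm_addN.

Lemma pm_scaleA a b q : pm_scale a (pm_scale b q) = pm_scale (a * b) q.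
Proof. by elim/pm_ind: q => s; rewrite !pm_scaleE; apply/lclassP/leqv_scaleA. Qed.
Lemma pm_scale1 : left_id 1 pm_scale.
Proof. by elim/pm_ind=> s; rewrite pm_scaleE; apply/lclassP/leqv_scale1. Qed.
Lemma pm_scaleDr : right_distributive pm_scale +%R.
Proof.
move=> a; elim/pm_ind=> s; elim/pm_ind=> t.
by rewrite /GRing.add /= pm_addE !pm_scaleE pm_addE; apply/lclassP/leqv_scaleDr.
Qed.
Lemma pm_scaleDl q : {morph pm_scale^~ q : a b / a + b}.
Proof.
elim/pm_ind: q => s a b /=.
by rewrite !pm_scaleE [RHS]pm_addE; apply/lclassP/leqv_scaleDl.
Qed.

HB.instance Definition _ := GRing.Zmodule_isLmodule.Build K pmod
  pm_scaleA pm_scale1 pm_scaleDr pm_scaleDl.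

Definition pgen (x : X) : pmod := lclass (LGen x).

Lemma lclass0 : lclass LZero = 0. Proof. by []. Qed.
Lemma lclassN s : lclass (LOpp s) = - lclass s.
Proof. by rewrite -pm_oppE. Qed.
Lemma lclassD s t : lclass (LAdd s t) = lclass s + lclass t.
Proof. by rewrite -pm_addE. Qed.
Lemma lclassZ k s : lclass (LScale k s) = k *: lclass s.
Proof. by rewrite -pm_scaleE. Qed.

Lemma lclass_rel s t : rel s t -> lclass s = lclass t.
Proof. by move=> st; apply/lclassP/leqv_rel. Qed.

Section Lift.
Variables (W : lmodType K) (f : X -> W).

Fixpoint leval (t : lterm) : W :=
  match t with
  | LGen x => f x
  | LZero => 0
  | LOpp s => - leval s
  | LAdd s u => leval s + leval u
  | LScale k s => k *: leval s
  end.

Definition plift (q : pmod) : W := leval (repr q).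

Hypothesis frel : forall s t, rel s t -> leval s = leval t.

Lemma leval_eqv s t : leqv s t -> leval s = leval t.
Proof.
elim=> //= {s t}.
- by move=> s t u _ -> _ ->.
- by move=> s t _ ->.
- by move=> s s' t t' _ -> _ ->.
- by move=> k s s' _ ->.
- by move=> *; rewrite addrA.
- by move=> *; rewrite addrC.
- by move=> *; rewrite add0r.
- by move=> *; rewrite addNr.
- by move=> *; rewrite scalerA.
- by move=> *; rewrite scale1r.
- by move=> *; rewrite scalerDr.
- by move=> *; rewrite scalerDl.
Qed.

Lemma plift_class s : plift (lclass s) = leval s.
Proof. exact/leval_eqv/leqv_repr. Qed.

Lemma plift_gen x : plift (pgen x) = f x.
Proof. exact: plift_class. Qed.

Lemma plift_linear k u v : plift (k *: u + v) = k *: plift u + plift v.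
Proof.
elim/pm_ind: u => s; elim/pm_ind: v => t.
by rewrite -lclassZ -lclassD !plift_class.
Qed.

End Lift.

Lemma pmod_ind (P : pmod -> Prop) :
  P 0 -> (forall x, P (pgen x)) ->
  (forall k u v, P u -> P v -> P (k *: u + v)) -> forall q, P q.
Proof.
move=> P0 Pg Pl; elim/pm_ind; elim=> //.
- by move=> s Ps; rewrite lclassN -scaleN1r -[_ *: _]addr0; apply: Pl.
- by move=> s Ps t Pt; rewrite lclassD -[lclass s]scale1r; apply: Pl.
- by move=> k s Ps; rewrite lclassZ -[_ *: _]addr0; apply: Pl.
Qed.

End PresentedModule.

Arguments LGen {K X} _.
Arguments LZero {K X}.

Section Tensor.
Variables (K : fieldType) (U V : lmodType K).

Inductive tens_rel : lterm K (U * V) -> lterm K (U * V) -> Prop :=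
| tens_linl k u u' v :
    tens_rel (LGen (k *: u + u', v))
             (LAdd (LScale k (LGen (u, v))) (LGen (u', v)))
| tens_linr k u v v' :
    tens_rel (LGen (u, k *: v + v'))
             (LAdd (LScale k (LGen (u, v))) (LGen (u, v'))).

Definition tens : lmodType K := pmod tens_rel.
Definition tensor (u : U) (v : V) : tens := pgen tens_rel (u, v).

End Tensor.

Section DirectSum.
Variables (K : fieldType) (I : Type) (W : I -> lmodType K).

Inductive dsum_rel : lterm K {i & W i} -> lterm K {i & W i} -> Prop :=
| dsum_lin i k (u v : W i) :
    dsum_rel (LGen (existT _ i (k *: u + v)))
             (LAdd (LScale k (LGen (existT _ i u))) (LGen (existT _ i v))).

Definition dsum : lmodType K := pmod dsum_rel.
Definition dsum_in i (w : W i) : dsum := pgen dsum_rel (existT _ i w).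

End DirectSum.

Section Subspace.
Variables (K : fieldType) (V : lmodType K).

Record subspace := Subspace {
  in_subspace :> V -> Prop;
  subspace0 : in_subspace 0;
  subspaceZD : forall k u v,
    in_subspace u -> in_subspace v -> in_subspace (k *: u + v) }.

Definition subspace_pred (U : subspace) : {pred V} := [pred v | `[< U v >]].

Lemma subspace_pred_closed U : submod_closed (subspace_pred U).
Proof.
split=> [|k u v]; first exact/asboolP/subspace0.
by move=> /asboolP Uu /asboolP Uv; apply/asboolP/subspaceZD.
Qed.

HB.instance Definition _ U :=
  GRing.isSubmodClosed.Build K V (subspace_pred U) (subspace_pred_closed U).

Definition subspace_type (U : subspace) := {v : V | v \in subspace_pred U}.

HB.instance Definition _ U := Choice.on (subspace_type U).
HB.instance Definition _ U := SubChoice.on (subspace_type U).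
HB.instance Definition _ U :=
  [SubChoice_isSubLmodule of subspace_type U by <:].

Inductive span (P : V -> Prop) : V -> Prop :=
| span0 : span P 0
| spanZD k u v of P u & span P v : span P (k *: u + v).

End Subspace.

(* [palg rel] is the unital associative algebra with generating set [X] and
   relations [rel], i.e. the quotient of the free algebra on [X] by the
   two-sided ideal generated by the differences of related terms.  It carries
   a [pzRingType] and an [lmodType] structure; [algType] would in addition
   require [1 != 0]. *)

Section PresentedAlgebra.
Variables (K : fieldType) (X : Type).

Inductive aterm :=
| AGen of X
| AZero
| AOne
| AOpp of aterm
| AAdd of aterm & aterm
| AMul of aterm & aterm
| AScale of K & aterm.

HB.instance Definition _ := gen_eqMixin aterm.
HB.instance Definition _ := gen_choiceMixin aterm.

Variable rel : aterm -> aterm -> Prop.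

Inductive aeqv : aterm -> aterm -> Prop :=
| aeqv_rel s t of rel s t : aeqv s t
| aeqv_refl s : aeqv s s
| aeqv_sym s t of aeqv s t : aeqv t s
| aeqv_trans t s u of aeqv s t & aeqv t u : aeqv s u
| aeqv_opp s s' of aeqv s s' : aeqv (AOpp s) (AOpp s')
| aeqv_add s s' t t' of aeqv s s' & aeqv t t' : aeqv (AAdd s t) (AAdd s' t')
| aeqv_mul s s' t t' of aeqv s s' & aeqv t t' : aeqv (AMul s t) (AMul s' t')
| aeqv_scale k s s' of aeqv s s' : aeqv (AScale k s) (AScale k s')
| aeqv_addA s t u : aeqv (AAdd s (AAdd t u)) (AAdd (AAdd s t) u)
| aeqv_addC s t : aeqv (AAdd s t) (AAdd t s)
| aeqv_add0 s : aeqv (AAdd AZero s) s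
| aeqv_addN s : aeqv (AAdd (AOpp s) s) AZero
| aeqv_mulA s t u : aeqv (AMul s (AMul t u)) (AMul (AMul s t) u)
| aeqv_mul1l s : aeqv (AMul AOne s) s
| aeqv_mul1r s : aeqv (AMul s AOne) s
| aeqv_mulDl s t u : aeqv (AMul (AAdd s t) u) (AAdd (AMul s u) (AMul t u))
| aeqv_mulDr s t u : aeqv (AMul s (AAdd t u)) (AAdd (AMul s t) (AMul s u))
| aeqv_scaleA a b s : aeqv (AScale a (AScale b s)) (AScale (a * b) s)
| aeqv_scale1 s : aeqv (AScale 1 s) s
| aeqv_scaleDr a s t :
    aeqv (AScale a (AAdd s t)) (AAdd (AScale a s) (AScale a t))
| aeqv_scaleDl a b s :
    aeqv (AScale (a + b) s) (AAdd (AScale a s) (AScale b s))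
| aeqv_scaleAl a s t : aeqv (AScale a (AMul s t)) (AMul (AScale a s) t)
| aeqv_scaleAr a s t : aeqv (AScale a (AMul s t)) (AMul s (AScale a t)).

Definition aeqvb (s t : aterm) : bool := `[< aeqv s t >].

Lemma aeqvb_equiv : equiv_class_of aeqvb.
Proof.
split=> [s | s t | t s u]; first exact/asboolP/aeqv_refl.
- by apply/asboolP/asboolP => /aeqv_sym.
- by move=> /asboolP st /asboolP tu; apply/asboolP/(aeqv_trans st tu).
Qed.

Canonical aeqv_equiv := EquivRelPack aeqvb_equiv.

Definition palg := {eq_quot aeqv_equiv}.

HB.instance Definition _ := Choice.on palg.

Definition aclass (s : aterm) : palg := \pi_({eq_quot aeqv_equiv}) s.

Lemma aclassP s t : aclass s = aclass t <-> aeqv s t.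
Proof.
split=> [st | /asboolP st]; first by apply/asboolP; move/eqmodP: st.
by apply/eqmodP.
Qed.

Lemma aclass_repr (q : palg) : aclass (repr q) = q.
Proof. exact: reprK. Qed.

Lemma aeqv_repr s : aeqv (repr (aclass s)) s.
Proof. by apply/aclassP; rewrite aclass_repr. Qed.

Definition pa_opp (q : palg) := aclass (AOpp (repr q)).
Definition pa_add (q r : palg) := aclass (AAdd (repr q) (repr r)).
Definition pa_mul (q r : palg) := aclass (AMul (repr q) (repr r)).
Definition pa_scale k (q : palg) := aclass (AScale k (repr q)).

Lemma pa_oppE s : pa_opp (aclass s) = aclass (AOpp s).
Proof. exact/aclassP/aeqv_opp/aeqv_repr. Qed.
Lemma pa_addE s t : pa_add (aclass s) (aclass t) = aclass (AAdd s t).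
Proof. by apply/aclassP/aeqv_add; apply: aeqv_repr. Qed.
Lemma pa_mulE s t : pa_mul (aclass s) (aclass t) = aclass (AMul s t).
Proof. by apply/aclassP/aeqv_mul; apply: aeqv_repr. Qed.
Lemma pa_scaleE k s : pa_scale k (aclass s) = aclass (AScale k s).
Proof. exact/aclassP/aeqv_scale/aeqv_repr. Qed.

Let pa_ind (P : palg -> Prop) : (forall s, P (aclass s)) -> forall q, P q.
Proof. by move=> Ps q; rewrite -(aclass_repr q). Qed.

Lemma pa_addA : associative pa_add.
Proof.
elim/pa_ind=> s; elim/pa_ind=> t; elim/pa_ind=> u.
by rewrite !pa_addE; apply/aclassP/aeqv_addA.
Qed.
Lemma pa_addC : commutative pa_add.
Proof.
by elim/pa_ind=> s; elim/pa_ind=> t; rewrite !pa_addE; apply/aclassP/aeqv_addC.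
Qed.
Lemma pa_add0 : left_id (aclass AZero) pa_add.
Proof. by elim/pa_ind=> s; rewrite pa_addE; apply/aclassP/aeqv_add0. Qed.
Lemma pa_addN : left_inverse (aclass AZero) pa_opp pa_add.
Proof. by elim/pa_ind=> s; rewrite pa_oppE pa_addE; apply/aclassP/aeqv_addN. Qed.

HB.instance Definition _ :=
  GRing.isZmodule.Build palg pa_addA pa_addC pa_add0 pa_addN.

Lemma pa_mulA : associative pa_mul.
Proof.
elim/pa_ind=> s; elim/pa_ind=> t; elim/pa_ind=> u.
by rewrite !pa_mulE; apply/aclassP/aeqv_mulA.
Qed.
Lemma pa_mul1l : left_id (aclass AOne) pa_mul.
Proof. by elim/pa_ind=> s; rewrite pa_mulE; apply/aclassP/aeqv_mul1l. Qed.
Lemma pa_mul1r : right_id (aclass AOne) pa_mul.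
Proof. by elim/pa_ind=> s; rewrite pa_mulE; apply/aclassP/aeqv_mul1r. Qed.
Lemma pa_mulDl : left_distributive pa_mul +%R.
Proof.
elim/pa_ind=> s; elim/pa_ind=> t; elim/pa_ind=> u.
by rewrite /GRing.add /= pa_addE !pa_mulE pa_addE; apply/aclassP/aeqv_mulDl.
Qed.
Lemma pa_mulDr : right_distributive pa_mul +%R.
Proof.
elim/pa_ind=> s; elim/pa_ind=> t; elim/pa_ind=> u.
by rewrite /GRing.add /= pa_addE !pa_mulE pa_addE; apply/aclassP/aeqv_mulDr.
Qed.

HB.instance Definition _ := GRing.Zmodule_isPzRing.Build palg
  pa_mulA pa_mul1l pa_mul1r pa_mulDl pa_mulDr.

Lemma pa_scaleA a b q : pa_scale a (pa_scale b q) = pa_scale (a * b) q.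
Proof. by elim/pa_ind: q => s; rewrite !pa_scaleE; apply/aclassP/aeqv_scaleA. Qed.
Lemma pa_scale1 : left_id 1 pa_scale.
Proof. by elim/pa_ind=> s; rewrite pa_scaleE; apply/aclassP/aeqv_scale1. Qed.
Lemma pa_scaleDr : right_distributive pa_scale +%R.
Proof.
move=> a; elim/pa_ind=> s; elim/pa_ind=> t.
by rewrite /GRing.add /= pa_addE !pa_scaleE pa_addE; apply/aclassP/aeqv_scaleDr.
Qed.
Lemma pa_scaleDl q : {morph pa_scale^~ q : a b / a + b}.
Proof.
elim/pa_ind: q => s a b /=.
by rewrite !pa_scaleE [RHS]pa_addE; apply/aclassP/aeqv_scaleDl.
Qed.

HB.instance Definition _ := GRing.Zmodule_isLmodule.Build K palg
  pa_scaleA pa_scale1 pa_scaleDr pa_scaleDl.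

Definition agen (x : X) : palg := aclass (AGen x).

Lemma aclass0 : aclass AZero = 0. Proof. by []. Qed.
Lemma aclass1 : aclass AOne = 1. Proof. by []. Qed.
Lemma aclassN s : aclass (AOpp s) = - aclass s.
Proof. by rewrite -pa_oppE. Qed.
Lemma aclassD s t : aclass (AAdd s t) = aclass s + aclass t.
Proof. by rewrite -pa_addE. Qed.
Lemma aclassM s t : aclass (AMul s t) = aclass s * aclass t.
Proof. by rewrite -pa_mulE. Qed.
Lemma aclassZ k s : aclass (AScale k s) = k *: aclass s.
Proof. by rewrite -pa_scaleE. Qed.

Lemma aclass_rel s t : rel s t -> aclass s = aclass t.
Proof. by move=> st; apply/aclassP/aeqv_rel. Qed.

Lemma palg_scaleAl k (a b : palg) : k *: (a * b) = (k *: a) * b.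
Proof.
elim/pa_ind: a => s; elim/pa_ind: b => t.
by rewrite -aclassM -!aclassZ -aclassM; apply/aclassP/aeqv_scaleAl.
Qed.

Lemma palg_scaleAr k (a b : palg) : k *: (a * b) = a * (k *: b).
Proof.
elim/pa_ind: a => s; elim/pa_ind: b => t.
by rewrite -aclassM -!aclassZ -aclassM; apply/aclassP/aeqv_scaleAr.
Qed.

Section Action.
Variables (W : lmodType K) (f : X -> W -> W).

Fixpoint aeval (t : aterm) (w : W) : W :=
  match t with
  | AGen x => f x w
  | AZero => 0
  | AOne => w
  | AOpp s => - aeval s w
  | AAdd s u => aeval s w + aeval u w
  | AMul s u => aeval s (aeval u w)
  | AScale k s => k *: aeval s w
  end.

Definition palg_act (q : palg) (w : W) : W := aeval (repr q) w.

Hypothesis flin : forall x k u v, f x (k *: u + v) = k *: f x u + f x v.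
Hypothesis frel : forall s t, rel s t -> forall w, aeval s w = aeval t w.

Lemma aeval_linear s k u v : aeval s (k *: u + v) = k *: aeval s u + aeval s v.
Proof.
elim: s u v => //=.
- by move=> u v; rewrite scaler0 addr0.
- by move=> s IH u v; rewrite IH opprD scalerN.
- by move=> s IHs t IHt u v; rewrite IHs IHt scalerDr addrACA.
- by move=> s IHs t IHt u v; rewrite IHt IHs.
- by move=> a s IH u v; rewrite IH scalerDr !scalerA mulrC.
Qed.

Lemma aevalD s u v : aeval s (u + v) = aeval s u + aeval s v.
Proof. by rewrite -[u]scale1r aeval_linear !scale1r. Qed.

Lemma aevalZ s k u : aeval s (k *: u) = k *: aeval s u.
Proof.
have s0 : aeval s 0 = 0 by apply: (addrI (aeval s 0)); rewrite -aevalD !addr0.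
by rewrite -[k *: u]addr0 aeval_linear s0 addr0.
Qed.

Lemma aeval_eqv s t : aeqv s t -> forall w, aeval s w = aeval t w.
Proof.
elim=> //= {s t}.
- by move=> s t u _ st _ tu w; rewrite st tu.
- by move=> s t _ st w; rewrite st.
- by move=> s s' t t' _ ss _ tt w; rewrite ss tt.
- by move=> s s' t t' _ ss _ tt w; rewrite ss tt.
- by move=> k s s' _ ss w; rewrite ss.
- by move=> *; rewrite addrA.
- by move=> *; rewrite addrC.
- by move=> *; rewrite add0r.
- by move=> *; rewrite addNr.
- by move=> *; rewrite aevalD.
- by move=> *; rewrite scalerA.
- by move=> *; rewrite scale1r.
- by move=> *; rewrite scalerDr.
- by move=> *; rewrite scalerDl.
- by move=> *; rewrite aevalZ.
Qed.

Lemma palg_act_class s w : palg_act (aclass s) w = aeval s w.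
Proof. exact/aeval_eqv/aeqv_repr. Qed.

Lemma palg_act_gen x w : palg_act (agen x) w = f x w.
Proof. exact: palg_act_class. Qed.

Lemma palg_act1 w : palg_act 1 w = w.
Proof. exact: palg_act_class. Qed.

Lemma palg_actM a b w : palg_act (a * b) w = palg_act a (palg_act b w).
Proof.
elim/pa_ind: a => s; elim/pa_ind: b => t.
by rewrite -aclassM !palg_act_class.
Qed.

Lemma palg_act_linl k a b w :
  palg_act (k *: a + b) w = k *: palg_act a w + palg_act b w.
Proof.
elim/pa_ind: a => s; elim/pa_ind: b => t.
by rewrite -aclassZ -aclassD !palg_act_class.
Qed.

Lemma palg_act_linr a k u v :
  palg_act a (k *: u + v) = k *: palg_act a u + palg_act a v.
Proof. exact: aeval_linear. Qed.

End Action.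

Lemma palg_ind (P : palg -> Prop) :
  P 1 -> (forall x, P (agen x)) -> (forall a b, P a -> P b -> P (a * b)) ->
  (forall k a b, P a -> P b -> P (k *: a + b)) -> forall q, P q.
Proof.
move=> P1 Pg PM Pl.
have P0 : P 0 by rewrite -(addNr 1) -scaleN1r; apply: Pl.
have PZ k a : P a -> P (k *: a).
  by move=> Pa; rewrite -[_ *: _]addr0; apply: Pl.
elim/pa_ind; elim=> //.
- by move=> s Ps; rewrite aclassN -scaleN1r; apply: PZ.
- by move=> s Ps t Pt; rewrite aclassD -[aclass s]scale1r; apply: Pl.
- by move=> s Ps t Pt; rewrite aclassM; apply: PM.
- by move=> k s Ps; rewrite aclassZ; apply: PZ.
Qed.

End PresentedAlgebra.

Arguments AGen {K X} _.
Arguments AZero {K X}.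
Arguments AOne {K X}.

Section AlgebraTensor.
Variables (K : fieldType) (X Y : Type).
Variables (relX : aterm K X -> aterm K X -> Prop).
Variables (relY : aterm K Y -> aterm K Y -> Prop).

Let A : Type := palg relX.
Let B : Type := palg relY.

Inductive atens_rel : aterm K (A + B) -> aterm K (A + B) -> Prop :=
| atens_linl k (a a' : palg relX) :
    atens_rel (AGen (inl (k *: a + a')))
              (AAdd (AScale k (AGen (inl a))) (AGen (inl a')))
| atens_mull (a a' : palg relX) :
    atens_rel (AGen (inl (a * a'))) (AMul (AGen (inl a)) (AGen (inl a')))
| atens_onel : atens_rel (AGen (inl (1 : palg relX))) AOne
| atens_linr k (b b' : palg relY) :
    atens_rel (AGen (inr (k *: b + b')))
              (AAdd (AScale k (AGen (inr b))) (AGen (inr b')))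
| atens_mulr (b b' : palg relY) :
    atens_rel (AGen (inr (b * b'))) (AMul (AGen (inr b)) (AGen (inr b')))
| atens_oner : atens_rel (AGen (inr (1 : palg relY))) AOne
| atens_comm a b :
    atens_rel (AMul (AGen (inl a)) (AGen (inr b)))
              (AMul (AGen (inr b)) (AGen (inl a))).

Definition atens := palg atens_rel.
HB.instance Definition _ := GRing.PzRing.on atens.
HB.instance Definition _ := GRing.Lmodule.on atens.

Definition atensor (a : palg relX) (b : palg relY) : atens :=
  agen atens_rel (inl a) * agen atens_rel (inr b).

End AlgebraTensor.

Definition dual (R : realType) (E : vectType R) : vectType R := 'Hom(E, R^o).

Record reflection_setting (R : realType) (n : nat) := ReflectionSetting {
  rs_E : vectType R;
  rs_dim : \dim {:rs_E} = n.*2;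
  rs_B : rs_E -> rs_E -> R;
  rs_B_linear : forall k u v w, rs_B (k *: u + v) w = k * rs_B u w + rs_B v w;
  rs_B_sym : forall u v, rs_B u v = rs_B v u;
  rs_B_pos : forall u, u != 0 -> 0 < rs_B u u;
  rs_gT : finGroupType;
  rs_act : rs_gT -> 'End(rs_E);
  rs_act1 : rs_act 1%g = \1%VF;
  rs_actM : forall g h, rs_act (g * h)%g = (rs_act g \o rs_act h)%VF;
  rs_act_inj : injective rs_act;
  rs_act_orth : forall g u v, rs_B (rs_act g u) (rs_act g v) = rs_B u v;
  (* The action being orthogonal, an element whose fixed space is a hyperplane
     acts as a reflection. *)
  rs_refl : {set rs_gT} :=
    [set s | (\dim (fixedSpace (rs_act s))).+1 == \dim {:rs_E}];
  rs_refl_gen : <<rs_refl>>%g = [set: rs_gT];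
  rs_dact : rs_gT -> dual rs_E -> dual rs_E :=
    fun g x => (x \o rs_act g^-1%g)%VF;
  rs_alpha : rs_gT -> rs_E;
  rs_alpha_eigen : forall s, s \in rs_refl ->
    rs_alpha s != 0 /\ rs_act s (rs_alpha s) = - rs_alpha s;
  rs_a : rs_gT -> dual rs_E;
  rs_a_eigen : forall s, s \in rs_refl ->
    rs_a s != 0 /\ rs_dact s (rs_a s) = - rs_a s;
  rs_J : 'End(rs_E);
  rs_J_orth : forall u v, rs_B (rs_J u) (rs_J v) = rs_B u v;
  rs_J_det : \det (passmx.mxof (vbasis {:rs_E}) (vbasis {:rs_E}) rs_J) = 1;
  rs_J_skew : forall u v, rs_B (rs_J u) v = - rs_B u (rs_J v);
  rs_xi : 'I_n -> rs_E;
  rs_eta : 'I_n -> rs_E;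
  rs_xi_xi : forall j k, rs_B (rs_xi j) (rs_xi k) = (j == k)%:R;
  rs_eta_eta : forall j k, rs_B (rs_eta j) (rs_eta k) = (j == k)%:R;
  rs_xi_eta : forall j k, rs_B (rs_xi j) (rs_eta k) = 0;
  rs_J_xi : forall j, rs_J (rs_xi j) = - rs_eta j;
  rs_J_eta : forall j, rs_J (rs_eta j) = rs_xi j;
  rs_x : 'I_n -> dual rs_E;
  rs_y : 'I_n -> dual rs_E;
  rs_x_xi : forall j k, rs_x j (rs_xi k) = (j == k)%:R;
  rs_x_eta : forall j k, rs_x j (rs_eta k) = 0;
  rs_y_xi : forall j k, rs_y j (rs_xi k) = 0;
  rs_y_eta : forall j k, rs_y j (rs_eta k) = (j == k)%:R }.

Section Cherednik.
Variables (R : realType) (n : nat) (D : reflection_setting R n).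
Variable c : rs_gT D -> R[i].

Local Notation C := R[i].
Local Notation E := (rs_E D).
Local Notation S := (rs_refl D).

Definition conj_invariant :=
  forall g s, s \in S -> c (s ^ g)%g = c s.

Definition coroot (s : rs_gT D) : dual E :=
  (2 / rs_a s (rs_alpha s)) *: rs_a s.

Inductive ch_gen :=
| GVec of E
| GCov of dual E
| GGrp of rs_gT D.

Local Notation vec u := (AGen (GVec u)).
Local Notation cov x := (AGen (GCov x)).
Local Notation grp g := (AGen (GGrp g)).

(* The first six relations present the semidirect product with [G] of the
   tensor algebra of the complexification of [E + E^*]. *)
Inductive ch_rel : aterm C ch_gen -> aterm C ch_gen -> Prop :=
| ch_vec_lin k u v :
    ch_rel (vec (k *: u + v)) (AAdd (AScale k%:C%C (vec u)) (vec v))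
| ch_cov_lin k x y :
    ch_rel (cov (k *: x + y)) (AAdd (AScale k%:C%C (cov x)) (cov y))
| ch_grp1 : ch_rel (grp 1%g) AOne
| ch_grpM g h : ch_rel (grp (g * h)%g) (AMul (grp g) (grp h))
| ch_grp_vec g u :
    ch_rel (AMul (grp g) (vec u)) (AMul (vec (rs_act g u)) (grp g))
| ch_grp_cov g x :
    ch_rel (AMul (grp g) (cov x)) (AMul (cov (rs_dact g x)) (grp g))
| ch_vecC u v : ch_rel (AMul (vec u) (vec v)) (AMul (vec v) (vec u))
| ch_covC x y : ch_rel (AMul (cov x) (cov y)) (AMul (cov y) (cov x))
| ch_vec_cov u x :
    ch_rel (AAdd (AMul (vec u) (cov x)) (AOpp (AMul (cov x) (vec u))))
      (AAdd (AScale (x u)%:C%C AOne)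
         (AOpp (\big[@AAdd C ch_gen/AZero]_(s in S)
            AScale ((x (rs_alpha s))%:C%C * (coroot s u)%:C%C * c s)
                   (grp s)))).

Definition cherednik := palg ch_rel.
HB.instance Definition _ := GRing.PzRing.on cherednik.
HB.instance Definition _ := GRing.Lmodule.on cherednik.

Definition chV (u : E) : cherednik := agen ch_rel (GVec u).
Definition chX (x : dual E) : cherednik := agen ch_rel (GCov x).
Definition chG (g : rs_gT D) : cherednik := agen ch_rel (GGrp g).

Definition ch_z j : cherednik := chX (rs_x D j) + 'i%C *: chX (rs_y D j).
Definition ch_zbar j : cherednik := chX (rs_x D j) - 'i%C *: chX (rs_y D j).
Definition ch_zeta j : cherednik :=
  2^-1 *: (chV (rs_xi D j) - 'i%C *: chV (rs_eta D j)).
Definition ch_zetabar j : cherednik :=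
  2^-1 *: (chV (rs_xi D j) + 'i%C *: chV (rs_eta D j)).

Definition ch_Eplus : cherednik := 2^-1 *: \sum_j ch_z j * ch_zbar j.
Definition ch_Eminus : cherednik := - 2 *: \sum_j ch_zeta j * ch_zetabar j.
Definition ch_H : cherednik :=
  \sum_j (ch_z j * ch_zeta j + ch_zbar j * ch_zetabar j) + n%:R
  - \sum_(s in S) c s *: chG s.
Definition ch_Z0 : cherednik :=
  \sum_j (ch_zbar j * ch_zetabar j - ch_z j * ch_zeta j).

(* Conjugate-linear anti-involutions taking the prescribed values on the
   generators; there is at most one. *)
Definition is_star (star : cherednik -> cherednik) :=
  [/\ (forall k a b, star (k *: a + b) = k^* *: star a + star b),
      (forall a b, star (a * b) = star b * star a),
      involutive star,
      (forall j, [/\ star (chV (rs_xi D j)) = chX (rs_x D j),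
                     star (chX (rs_x D j)) = chV (rs_xi D j),
                     star (chV (rs_eta D j)) = chX (rs_y D j) &
                     star (chX (rs_y D j)) = chV (rs_eta D j)]) &
      (forall s, s \in S -> star (chG s) = chG s)].

End Cherednik.

Section Clifford.
Variables (R : realType) (n : nat).
Local Notation C := R[i].

Inductive cl_rel : aterm C 'I_(n + n) -> aterm C 'I_(n + n) -> Prop :=
| cl_anticomm j k :
    cl_rel (AAdd (AMul (AGen j) (AGen k)) (AMul (AGen k) (AGen j)))
           (AScale (2 * (j == k)%:R) AOne).

Definition clifford := palg cl_rel.
HB.instance Definition _ := GRing.PzRing.on clifford.
HB.instance Definition _ := GRing.Lmodule.on clifford.

Definition cl_e (j : 'I_(n + n)) : clifford := agen cl_rel j.

Definition cl_f (j : 'I_n) : clifford :=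
  2^-1 *: (cl_e (lshift n j) - 'i%C *: cl_e (rshift n j)).
Definition cl_fdag (j : 'I_n) : clifford :=
  2^-1 *: (cl_e (lshift n j) + 'i%C *: cl_e (rshift n j)).

(* The exterior algebra has the basis of the monomials
   f^dag_I = f^dag_(i1) ... f^dag_(il), for I = {i1 < ... < il}.  A function
   [p : spin W] stands for the tensor \sum_I p I (x) f^dag_I; thus [spin W] is
   the tensor product of [W] with the spinor space, and [spin C^o] is the
   spinor space itself. *)
Definition spin (W : lmodType C) : lmodType C := {ffun {set 'I_n} -> W}.

Definition spin_sign (j : 'I_n) (I : {set 'I_n}) : C :=
  (-1) ^+ #|[set i in I | (i < j)%N]|.

Section Action.
Variable W : lmodType C.
Implicit Types p : spin W.

Definition spin_mul (j : 'I_n) p : spin W :=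
  [ffun I : {set 'I_n} => if j \in I then spin_sign j I *: p (I :\ j) else 0].

Definition spin_der (j : 'I_n) p : spin W :=
  [ffun I : {set 'I_n} => if j \in I then 0 else spin_sign j I *: p (j |: I)].

(* e_j = f_j + f^dag_j and e_(n+j) = i (f_j - f^dag_j) *)
Definition spin_e (j : 'I_(n + n)) p : spin W :=
  match split j with
  | inl j => spin_der j p + spin_mul j p
  | inr j => 'i%C *: (spin_der j p - spin_mul j p)
  end.

Definition cl_act : clifford -> spin W -> spin W := palg_act spin_e.

Lemma spin_mul_linear j k p q :
  spin_mul j (k *: p + q) = k *: spin_mul j p + spin_mul j q.
Proof.
apply/ffunP=> I; rewrite !ffunE; case: ifP => _; last by rewrite scaler0 addr0.
by rewrite scalerDr !scalerA mulrC.
Qed.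

Lemma spin_der_linear j k p q :
  spin_der j (k *: p + q) = k *: spin_der j p + spin_der j q.
Proof.
apply/ffunP=> I; rewrite !ffunE; case: ifP => _; first by rewrite scaler0 addr0.
by rewrite scalerDr !scalerA mulrC.
Qed.

HB.instance Definition _ j :=
  GRing.isLinear.Build C (spin W) (spin W) *:%R (spin_mul j)
    (spin_mul_linear j).
HB.instance Definition _ j :=
  GRing.isLinear.Build C (spin W) (spin W) *:%R (spin_der j)
    (spin_der_linear j).

Lemma spin_e_linear j k p q :
  spin_e j (k *: p + q) = k *: spin_e j p + spin_e j q.
Proof.
rewrite /spin_e; case: split => i; rewrite spin_der_linear spin_mul_linear.
  by rewrite scalerDr addrACA.
rewrite opprD addrACA -scalerBr scalerDr; congr (_ + _).
by rewrite !scalerA mulrC.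
Qed.

Lemma spin_signU (j k : 'I_n) (I : {set 'I_n}) : j \notin I ->
  spin_sign k (j |: I) = (-1) ^+ (j < k)%N * spin_sign k I.
Proof.
move=> jI; rewrite /spin_sign -exprD; congr (_ ^+ _).
have -> : [set i in j |: I | (i < k)%N] =
    (if (j < k)%N then [set j] else set0) :|: [set i in I | (i < k)%N].
  apply/setP=> i; rewrite !inE.
  case: (eqVneq i j) => [-> | ij] /=; case: ifP => jk;
    by rewrite !inE ?eqxx ?jk ?andbF ?(negPf ij).
rewrite cardsU; case: ifP => jk; rewrite ?cards1 ?cards0 ?set0I ?cards0 ?subn0 //.
suff -> : [set j] :&: [set i in I | (i < k)%N] = set0 by rewrite cards0 subn0.
apply/setP=> i; rewrite !inE; case: eqP => //= ->.
by rewrite (negPf jI).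
Qed.

Lemma spin_signD (j k : 'I_n) (I : {set 'I_n}) : j \in I ->
  spin_sign k (I :\ j) = (-1) ^+ (j < k)%N * spin_sign k I.
Proof.
move=> jI; rewrite -{2}(setD1K jI) spin_signU ?inE ?eqxx //.
by rewrite mulrA -exprD addnn -signr_odd odd_double mul1r.
Qed.

Lemma spin_sign2 (j : 'I_n) (I : {set 'I_n}) : spin_sign j I * spin_sign j I = 1.
Proof. by rewrite -expr2 -exprM mulnC exprM sqrrN !expr1n. Qed.

Lemma sign_swap (j k : 'I_n) : j != k ->
  (-1) ^+ (j < k)%N = - (-1) ^+ (k < j)%N :> C.
Proof.
move=> jk; case: ltngtP => /= [_ | _ | /val_inj/eqP]; last by rewrite (negPf jk).
- by rewrite expr1 expr0.
- by rewrite expr1 expr0 opprK.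
Qed.

Lemma spin_mul_anti j k p : spin_mul j (spin_mul k p) = - spin_mul k (spin_mul j p).
Proof.
apply/ffunP=> I; rewrite !ffunE !inE; case: (eqVneq j k) => [->|jk].
  by case: ifP => _ /=; rewrite ?scaler0 ?oppr0.
case jI: (j \in I); case kI: (k \in I); rewrite ?andbF ?scaler0 ?oppr0 //=.
rewrite !scalerA -scaleNr; congr (_ *: p _).
  by rewrite !spin_signD // (sign_swap jk); ring.
by apply/setP=> i; rewrite !inE andbCA.
Qed.

Lemma spin_der_anti j k p : spin_der j (spin_der k p) = - spin_der k (spin_der j p).
Proof.
apply/ffunP=> I; rewrite !ffunE !inE; case: (eqVneq j k) => [->|jk].
  by case: ifP => _ /=; rewrite ?scaler0 ?oppr0.
case jI: (j \in I); case kI: (k \in I); rewrite ?orbT ?scaler0 ?oppr0 //=.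
rewrite !scalerA -scaleNr; congr (_ *: p _).
  by rewrite !spin_signU ?jI ?kI // (sign_swap jk); ring.
by apply/setP=> i; rewrite !inE orbCA.
Qed.

Lemma spin_der_mul j k p :
  spin_der j (spin_mul k p) + spin_mul k (spin_der j p) = (j == k)%:R *: p.
Proof.
apply/ffunP=> I; rewrite !ffunE !inE; case: (eqVneq j k) => [<-|jk] /=.
  rewrite scale1r; case: ifP => jI /=.
    by rewrite add0r scalerA spin_signD // ltnn mul1r spin_sign2 scale1r setD1K.
  by rewrite addr0 scalerA spin_signU ?jI // ltnn mul1r spin_sign2 scale1r setU1K ?jI.
rewrite scale0r.
case jI: (j \in I); case kI: (k \in I); rewrite ?scaler0 ?addr0 //.
rewrite !scalerA (_ : (j |: I) :\ k = j |: (I :\ k)); last first.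
  by apply/setP=> i; rewrite !inE; case: eqVneq => [->|] //=; rewrite eq_sym (negPf jk).
rewrite -scalerDl spin_signU ?jI // spin_signD // (sign_swap jk).
by rewrite [X in X *: _](_ : _ = 0) ?scale0r //; ring.
Qed.

Let spin_lc a b j p : spin W := a *: spin_der j p + b *: spin_mul j p.

Let spin_lc_anti a b a' b' j k p :
  spin_lc a b j (spin_lc a' b' k p) + spin_lc a' b' k (spin_lc a b j p) =
  ((a * b' + b * a') * (j == k)%:R) *: p.
Proof.
have mD i u v : spin_mul i (u + v) = spin_mul i u + spin_mul i v by exact: linearD.
have dD i u v : spin_der i (u + v) = spin_der i u + spin_der i v by exact: linearD.
have mZ i x u : spin_mul i (x *: u) = x *: spin_mul i u by exact: linearZ.
have dZ i x u : spin_der i (x *: u) = x *: spin_der i u by exact: linearZ.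
rewrite /spin_lc !mD !dD !mZ !dZ !scalerDr !scalerA.
rewrite [LHS](AC ((2*2)*(2*2)) ((1*5)*(2*7)*(3*6)*(4*8))) /=.
rewrite (spin_der_anti k) (spin_mul_anti k) !scalerN.
rewrite (mulrC a' a) (mulrC b' b) !subrr add0r addr0 (mulrC b' a) (mulrC a' b).
rewrite -!scalerDr spin_der_mul [spin_mul j _ + _]addrC spin_der_mul.
by rewrite (eq_sym k) !scalerA -scalerDl mulrDl.
Qed.

Let spin_el j p : spin_e (lshift n j) p = spin_lc 1 1 j p.
Proof. by rewrite /spin_e -[lshift n j]/(unsplit (inl j)) unsplitK /spin_lc !scale1r. Qed.

Let spin_er j p : spin_e (rshift n j) p = spin_lc 'i%C (- 'i%C) j p.
Proof.
rewrite /spin_e -[rshift n j]/(unsplit (inr j)) unsplitK /spin_lc.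
by rewrite scalerBr scaleNr.
Qed.

Lemma spin_e_rel s t :
  cl_rel s t -> forall p, aeval spin_e s p = aeval spin_e t p.
Proof.
have ii : 'i%C * 'i%C = -1 :> C by rewrite -expr2 sqr_i.
case=> {s t} a b p /=; case: (split_ordP a) => j ->; case: (split_ordP b) => k ->;
  rewrite ?spin_el ?spin_er ?spin_el spin_lc_anti.
- by rewrite eq_lshift !mulr1.
- by rewrite eq_lrshift !mul1r addNr mul0r mulr0.
- by rewrite eq_rlshift !mulr1 subrr mul0r mulr0.
- by rewrite eq_rshift mulrN mulNr ii opprK.
Qed.

Lemma cl_act_e j p : cl_act (cl_e j) p = spin_e j p.
Proof. exact: palg_act_gen spin_e_linear spin_e_rel _ _. Qed.

Lemma cl_act1 p : cl_act 1 p = p.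
Proof. exact: palg_act1 spin_e_linear spin_e_rel _. Qed.

Lemma cl_actM a b p : cl_act (a * b) p = cl_act a (cl_act b p).
Proof. exact: palg_actM spin_e_linear spin_e_rel _ _ _. Qed.

Lemma cl_act_linl k a b p :
  cl_act (k *: a + b) p = k *: cl_act a p + cl_act b p.
Proof. exact: palg_act_linl spin_e_linear spin_e_rel _ _ _ _. Qed.

Lemma cl_act_linr a k p q :
  cl_act a (k *: p + q) = k *: cl_act a p + cl_act a q.
Proof. exact: palg_act_linr spin_e_linear _ _ _ _. Qed.

Lemma cl_actD a b p : cl_act (a + b) p = cl_act a p + cl_act b p.
Proof. by rewrite -[a]scale1r cl_act_linl !scale1r. Qed.

Lemma cl_act0 p : cl_act 0 p = 0.
Proof. by apply: (addrI (cl_act 0 p)); rewrite -cl_actD !addr0. Qed.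

Lemma cl_actZ k a p : cl_act (k *: a) p = k *: cl_act a p.
Proof. by rewrite -[k *: a]addr0 cl_act_linl cl_act0 addr0. Qed.

Lemma cl_act_f j p : cl_act (cl_f j) p = spin_der j p.
Proof.
rewrite /cl_f cl_actZ cl_actD -scaleNr cl_actZ !cl_act_e spin_el spin_er.
rewrite /spin_lc !scale1r [(- 'i%C) *: _]scalerDr !scalerA.
rewrite mulrNN mulNr -expr2 sqr_i opprK scale1r scaleN1r addrACA subrr addr0.
by rewrite -mulr2n -(scaler_nat 2 (spin_der j p)) scalerA mulVf ?scale1r // pnatr_eq0.
Qed.

Lemma cl_act_fdag j p : cl_act (cl_fdag j) p = spin_mul j p.
Proof.
rewrite /cl_fdag cl_actZ cl_actD cl_actZ !cl_act_e spin_el spin_er.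
rewrite /spin_lc !scale1r ['i%C *: (_ + _)]scalerDr !scalerA.
rewrite mulrN -expr2 sqr_i opprK scale1r scaleN1r addrACA subrr add0r.
by rewrite -mulr2n -(scaler_nat 2 (spin_mul j p)) scalerA mulVf ?scale1r // pnatr_eq0.
Qed.

End Action.

Definition spin_basis (I : {set 'I_n}) : spin C^o := [ffun J => (J == I)%:R].

(* The relation (f^dag_j u, w) = (u, f_j w) makes the monomials f^dag_I
   orthogonal and of equal length; the form is normalised by (1, 1) = 1. *)
Definition spin_form (u w : spin C^o) : C := \sum_I (u I : C) * (w I : C)^*.

Lemma spin_form_adj j u w :
  spin_form (spin_mul j u) w = spin_form u (spin_der j w).
Proof.
pose P (I : {set 'I_n}) := j \in I.
have sJ I : (spin_sign j I)^* = spin_sign j I by rewrite rmorphXn rmorphN1.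
rewrite /spin_form [LHS](bigID P) [RHS](bigID P) /= addrC [in LHS]big1 ?add0r; last first.
  by move=> I /negPf jI; rewrite ffunE [X in if X then _ else _]jI mul0r.
rewrite [X in _ = X + _]big1 ?add0r; last first.
  by move=> I jI; rewrite ffunE [X in if X then _ else _]jI rmorph0 mulr0.
rewrite (reindex_onto (fun I : {set 'I_n} => j |: I) (fun I => I :\ j)) /=; last first.
  by move=> I jI; rewrite setD1K.
apply: eq_big => [I | I /andP[jI /eqP IE]].
  rewrite /P setU11 /=; case jI: (j \in I); last by rewrite setU1K ?jI ?eqxx.
  by apply/eqP => /setP/(_ j); rewrite !inE eqxx jI.
have {}jI : j \notin I by rewrite -IE !inE eqxx.
rewrite !ffunE setU11 (negPf jI) setU1K // spin_signU // ltnn mul1r.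
by rewrite [in RHS]/GRing.scale /= rmorphM /= sJ mulrA [u I * _]mulrC.
Qed.

End Clifford.

Section GroupRep.
Variables (R : realType) (gT : finGroupType).
Local Notation C := R[i].

Record group_rep := GroupRep {
  gr_V : vectType C;
  gr_act : gT -> 'End(gr_V);
  gr_act1 : gr_act 1%g = \1%VF;
  gr_actM : forall g h, gr_act (g * h)%g = (gr_act g \o gr_act h)%VF }.

Definition irreducible_rep (tau : group_rep) :=
  (exists v : gr_V tau, v != 0) /\
  forall U : {vspace gr_V tau},
    (forall g, (gr_act tau g @: U <= U)%VS) -> U = 0%VS \/ U = fullv.

End GroupRep.

Section Standard.
Variables (R : realType) (n : nat) (D : reflection_setting R n).
Variables (c : rs_gT D -> R[i]) (tau : group_rep R (rs_gT D)).

Local Notation C := R[i].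
Local Notation H := (cherednik c).
Local Notation V := (gr_V tau).

(* The first two relations present the tensor product of [H] and [V] over the
   complex numbers; the last two turn it into the tensor product over the
   subalgebra generated by [E] and [G]. *)
Inductive std_rel : lterm C (H * V) -> lterm C (H * V) -> Prop :=
| std_linl k a a' v :
    std_rel (LGen (k *: a + a', v))
            (LAdd (LScale k (LGen (a, v))) (LGen (a', v)))
| std_linr k a v v' :
    std_rel (LGen (a, k *: v + v'))
            (LAdd (LScale k (LGen (a, v))) (LGen (a, v')))
| std_grp a g v : std_rel (LGen (a * chG c g, v)) (LGen (a, gr_act tau g v))
| std_vec a u v : std_rel (LGen (a * chV c u, v)) LZero.

Definition standard : lmodType C := pmod std_rel.

Definition std_gen (a : H) (v : V) : standard := pgen std_rel (a, v).

Lemma std_gen_linl k a a' v :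
  std_gen (k *: a + a') v = k *: std_gen a v + std_gen a' v.
Proof. by rewrite -lclassZ -lclassD; apply: lclass_rel; constructor. Qed.

Lemma std_gen_linr k a v v' :
  std_gen a (k *: v + v') = k *: std_gen a v + std_gen a v'.
Proof. by rewrite -lclassZ -lclassD; apply: lclass_rel; constructor. Qed.

Lemma std_gen_grp a g v : std_gen (a * chG c g) v = std_gen a (gr_act tau g v).
Proof. by apply: lclass_rel; constructor. Qed.

Lemma std_gen_vec a u v : std_gen (a * chV c u) v = 0.
Proof. by apply: lclass_rel; constructor. Qed.

Definition std_act (a : H) : standard -> standard :=
  plift (fun av : H * V => std_gen (a * av.1) av.2).

Lemma std_act_rel a s t : std_rel s t ->
  leval (fun av : H * V => std_gen (a * av.1) av.2) s =
  leval (fun av : H * V => std_gen (a * av.1) av.2) t.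
Proof.
case=> {s t} /= [k b b' v | k b v v' | b g v | b u v].
- by rewrite mulrDr -palg_scaleAr std_gen_linl.
- by rewrite std_gen_linr.
- by rewrite mulrA std_gen_grp.
- by rewrite mulrA std_gen_vec.
Qed.

Lemma std_act_gen a b v : std_act a (std_gen b v) = std_gen (a * b) v.
Proof. exact: plift_gen (@std_act_rel a) _. Qed.

Lemma std_act_linr a k p q :
  std_act a (k *: p + q) = k *: std_act a p + std_act a q.
Proof. exact: plift_linear (@std_act_rel a) _ _ _. Qed.

HB.instance Definition _ a :=
  GRing.isLinear.Build C standard standard *:%R (std_act a) (std_act_linr a).

Lemma std_act1 p : std_act 1 p = p.
Proof.
elim/pmod_ind: p => [|[b v]|k p q IHp IHq]; first by rewrite linear0.
- by rewrite std_act_gen mul1r.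
- by rewrite std_act_linr IHp IHq.
Qed.

Lemma std_actM a b p : std_act (a * b) p = std_act a (std_act b p).
Proof.
elim/pmod_ind: p => [|[b' v]|k p q IHp IHq]; first by rewrite !linear0.
- by rewrite !std_act_gen mulrA.
- by rewrite !std_act_linr IHp IHq.
Qed.

Lemma std_act_linl k a b p :
  std_act (k *: a + b) p = k *: std_act a p + std_act b p.
Proof.
elim/pmod_ind: p => [|[b' v]|x p q IHp IHq].
- by rewrite !linear0 ?scaler0 addr0.
- by rewrite !std_act_gen mulrDl -palg_scaleAl std_gen_linl.
- by rewrite !std_act_linr IHp IHq !scalerDr addrACA !scalerA mulrC.
Qed.

(* Under the isomorphism with C[E] (x) V this is C[E]_k (x) V: the products
   below are the monomials of degree [k]. *)
Definition std_deg (k : nat) : standard -> Prop :=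
  span (fun p => exists2 xs : seq (dual (rs_E D)), size xs = k &
    exists v, p = std_gen (\prod_(x <- xs) chX c x) v).

Definition is_hermitian (W : lmodType C) (h : W -> W -> C) :=
  (forall k p q r, h (k *: p + q) r = k * h p r + h q r) /\
  (forall p q, h q p = (h p q)^*).

Definition pos_definite (W : lmodType C) (h : W -> W -> C) :=
  forall p, p != 0 -> 0 < h p p.

Definition contravariant_form (star : H -> H)
    (beta : standard -> standard -> C) :=
  [/\ is_hermitian beta,
      (forall v : V, v != 0 -> 0 < beta (std_gen 1 v) (std_gen 1 v)),
      (forall g v w, beta (std_gen 1 (gr_act tau g v)) (std_gen 1 (gr_act tau g w))
                     = beta (std_gen 1 v) (std_gen 1 w)) &
      (forall a p q, beta (std_act a p) q = beta p (std_act (star a) q))].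

Definition HC := atens (@ch_rel R n D c) (@cl_rel R n).
HB.instance Definition _ := GRing.PzRing.on HC.
HB.instance Definition _ := GRing.Lmodule.on HC.

Definition hc (a : H) (b : clifford R n) : HC := atensor a b.

Definition Kmod : lmodType C := spin n standard.

Definition K_gen (x : H + clifford R n) (p : Kmod) : Kmod :=
  match x with
  | inl a => [ffun I : {set 'I_n} => std_act a (p I)]
  | inr b => cl_act b p
  end.

Definition K_act : HC -> Kmod -> Kmod := palg_act K_gen.

Lemma K_gen_linear x k p q :
  K_gen x (k *: p + q) = k *: K_gen x p + K_gen x q.
Proof.
case: x => [a|b] /=; last exact: cl_act_linr.
by apply/ffunP=> I; rewrite !ffunE std_act_linr.
Qed.

Lemma K_gen_comm a b p : K_gen (inl a) (K_gen (inr b) p) =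
  K_gen (inr b) (K_gen (inl a) p).
Proof.
have Z u k : std_act a (k *: u) = k *: std_act a u by exact: linearZ.
have mE j q : K_gen (inl a) (spin_mul j q) = spin_mul j (K_gen (inl a) q).
  by apply/ffunP=> I; rewrite !ffunE; case: ifP => _; rewrite ?Z ?linear0 ?ffunE.
have dE j q : K_gen (inl a) (spin_der j q) = spin_der j (K_gen (inl a) q).
  by apply/ffunP=> I; rewrite !ffunE; case: ifP => _; rewrite ?Z ?linear0 ?ffunE.
have KZ x q : K_gen (inl a) (x *: q) = x *: K_gen (inl a) q.
  by apply/ffunP=> I; rewrite !ffunE Z.
have KD q r : K_gen (inl a) (q + r) = K_gen (inl a) q + K_gen (inl a) r.
  by rewrite -[q]scale1r K_gen_linear !scale1r.
have KN q : K_gen (inl a) (- q) = - K_gen (inl a) q.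
  by rewrite -scaleN1r KZ scaleN1r.
have K1 q : K_gen (inr 1) q = q by exact: cl_act1.
have Ke j q : K_gen (inr (agen _ j)) q = spin_e j q by exact: cl_act_e.
have KM x y q : K_gen (inr (x * y)) q = K_gen (inr x) (K_gen (inr y) q).
  exact: cl_actM.
have KL k x y q : K_gen (inr (k *: x + y)) q =
    k *: K_gen (inr x) q + K_gen (inr y) q by exact: cl_act_linl.
elim/palg_ind: b p => [|j|b b' IHb IHb'|k b b' IHb IHb'] p.
- by rewrite !K1.
- rewrite !Ke /spin_e; case: split => i; first by rewrite KD mE dE.
  by rewrite KZ KD KN mE dE.
- by rewrite !KM IHb IHb'.
- by rewrite !KL KD KZ IHb IHb'.
Qed.

Lemma K_gen_rel s t :
  atens_rel s t -> forall p, aeval K_gen s p = aeval K_gen t p.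
Proof.
case=> {s t} /= [k a a'|a a'||k b b'|b b'||a b] p.
- by apply/ffunP=> I; rewrite !ffunE std_act_linl.
- by apply/ffunP=> I; rewrite !ffunE std_actM.
- by apply/ffunP=> I; rewrite !ffunE std_act1.
- exact: cl_act_linl.
- exact: cl_actM.
- exact: cl_act1.
- exact: K_gen_comm.
Qed.

Lemma K_act1 p : K_act 1 p = p.
Proof. exact: palg_act1 K_gen_linear K_gen_rel _. Qed.

Lemma K_actM a b p : K_act (a * b) p = K_act a (K_act b p).
Proof. exact: palg_actM K_gen_linear K_gen_rel _ _ _. Qed.

Lemma K_act_linl k a b p :
  K_act (k *: a + b) p = k *: K_act a p + K_act b p.
Proof. exact: palg_act_linl K_gen_linear K_gen_rel _ _ _ _. Qed.

Lemma K_act_linr a k p q :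
  K_act a (k *: p + q) = k *: K_act a p + K_act a q.
Proof. exact: palg_act_linr K_gen_linear _ _ _ _. Qed.

Lemma K_act0 a : K_act a 0 = 0.
Proof.
have := K_act_linr a (-1) 0 0.
by rewrite scaler0 addr0 scaleN1r addNr.
Qed.

Lemma K_act_hc a b p I :
  K_act (hc a b) p I = std_act a (cl_act b p I).
Proof.
rewrite /hc /atensor K_actM /K_act.
rewrite !(palg_act_gen K_gen_linear K_gen_rel) /=.
by rewrite ffunE.
Qed.

(* The product form, for [p = \sum_I p I (x) f^dag_I] and likewise [q]. *)
Definition K_form (beta : standard -> standard -> C) (p q : Kmod) : C :=
  \sum_I \sum_J
    beta (p I) (q J) * spin_form (spin_basis R I) (spin_basis R J).

Definition unitarisable (beta : standard -> standard -> C) :=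
  pos_definite (K_form beta).

End Standard.

Section U21.
Variables (R : realType) (n : nat) (D : reflection_setting R n).
Variable c : rs_gT D -> R[i].

Local Notation C := R[i].
Local Notation H := (cherednik c).
Local Notation A := (HC c).
Local Notation S := (rs_refl D).
Local Notation f := (@cl_f R n).
Local Notation fdag := (@cl_fdag R n).

Definition zpair (j : 'I_n) (u : rs_E D) : C :=
  (rs_x D j u)%:C%C + 'i%C * (rs_y D j u)%:C%C.
Definition zbarpair (j : 'I_n) (u : rs_E D) : C :=
  (rs_x D j u)%:C%C - 'i%C * (rs_y D j u)%:C%C.

Definition cl_tau (s : rs_gT D) : clifford R n :=
  1 - (2 / rs_B (rs_alpha s) (rs_alpha s))%:C%C *:
        ((\sum_j zbarpair j (rs_alpha s) *: fdag j) *
         (\sum_k zpair k (rs_alpha s) *: f k)).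

Definition Omega : A := \sum_(s in S) c s *: hc (chG c s) (cl_tau s).

Definition Eplus : A := hc (ch_Eplus c) 1.
Definition Eminus : A := hc (ch_Eminus c) 1.
Definition Hop : A := hc (ch_H c) 1.
Definition Z1 : A := hc (ch_Z0 c) 1 - Omega.
Definition Z2 : A := hc 1 (\sum_j fdag j * f j - (n%:R / 2) *: (1 : clifford R n)).
Definition Fplus : A := \sum_j hc (ch_zbar c j) (fdag j).
Definition Fbarplus : A := \sum_j hc (ch_z c j) (f j).
Definition Fminus : A := 2 *: \sum_j hc (ch_zeta c j) (fdag j).
Definition Fbarminus : A := 2 *: \sum_j hc (ch_zetabar c j) (f j).

Definition u21_part (odd : bool) : A -> Prop :=
  span (fun X => X \in if odd then [:: Fplus; Fbarplus; Fminus; Fbarminus]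
                       else [:: Eplus; Eminus; Hop; Z1; Z2]).

Definition u21 (X : A) :=
  exists X0 X1, [/\ u21_part false X0, u21_part true X1 & X = X0 + X1].

(* Commuting with [Z2] forces an element to be even for the Z/2-grading of the
   Clifford algebra, so the centraliser and the supercentraliser coincide. *)
Definition u21_centraliser (r : A) := forall X, u21 X -> r * X = X * r.

(* A representation of the Lie superalgebra u(2|1); [ur_act X] is only
   meaningful for [X] in u(2|1).  No Z/2-grading is recorded on the carrier:
   Z2 acts on the odd generators by +1 or -1, so in a module generated by a
   Z2-eigenvector the eigenvalues of Z2 provide the grading, and every
   submodule of it is graded. *)
Record u21_rep := U21Rep {
  ur_W : lmodType C;
  ur_act : A -> ur_W -> ur_W;
  ur_act_linr : forall X k v w, u21 X ->
    ur_act X (k *: v + w) = k *: ur_act X v + ur_act X w;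
  ur_act_linl : forall k X Y w, u21 X -> u21 Y ->
    ur_act (k *: X + Y) w = k *: ur_act X w + ur_act Y w;
  ur_act_bracket : forall a b X Y w, u21_part a X -> u21_part b Y ->
    ur_act (X * Y - (-1) ^+ (a && b) *: (Y * X)) w =
    ur_act X (ur_act Y w) - (-1) ^+ (a && b) *: ur_act Y (ur_act X w) }.

Definition ur_irreducible (L : u21_rep) :=
  (exists w : ur_W L, w != 0) /\
  forall U : subspace (ur_W L),
    (forall X w, u21 X -> U w -> U (ur_act X w)) ->
    (forall w, U w -> w = 0) \/ (forall w, U w).

Definition lowest_weight_vector (L : u21_rep) (lambda nu gamma : C)
    (w : ur_W L) :=
  [/\ w != 0,
      [/\ ur_act Eminus w = 0, ur_act Fminus w = 0 & ur_act Fbarminus w = 0] &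
      [/\ ur_act Hop w = lambda *: w, ur_act Z1 w = nu *: w &
          ur_act Z2 w = gamma *: w]].

Definition irreducible_lowest_weight (L : u21_rep) (lambda nu gamma : C) :=
  ur_irreducible L /\
  exists w : ur_W L, lowest_weight_vector lambda nu gamma w.

End U21.

Section Multiplicity.
Variables (R : realType) (n : nat) (D : reflection_setting R n).
Variables (c : rs_gT D -> R[i]) (tau : group_rep R (rs_gT D)).

Local Notation C := R[i].
Local Notation K := (Kmod c tau).

(* The degree [l] part of the spinor space is spanned by the f^dag_I with
   [#|I| = l]. *)
Definition harmonic (k l : nat) (p : K) :=
  forall I : {set 'I_n},
    if #|I| == l then std_deg k (p I) /\ std_act (ch_Eminus c) (p I) = 0
    else p I = 0.

Definition harmonic_eigen (k l : nat) (nu : C) (p : K) :=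
  harmonic k l p /\ K_act (Z1 c) p = nu *: p.

Definition spectrum (k l : nat) (nu : C) :=
  exists2 p : K, p != 0 & harmonic_eigen k l nu p.

Definition multiplicity (k l : nat) (nu : C) (p : K) :=
  [/\ harmonic_eigen k l nu p, K_act (Fminus c) p = 0
    & K_act (Fbarminus c) p = 0].

Lemma span_linear (W : lmodType C) (P : W -> Prop) k u v :
  span P u -> span P v -> span P (k *: u + v).
Proof.
move=> Pu Pv; elim: Pu => [|x a b Pa _ IH]; first by rewrite scaler0 add0r.
by rewrite scalerDr scalerA -addrA; apply: spanZD.
Qed.

Lemma multiplicity0 k l nu : multiplicity k l nu 0.
Proof.
split; rewrite ?K_act0 //; split; last by rewrite K_act0 scaler0.
move=> I; rewrite ffunE; case: ifP => // _; split; first exact: span0.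
by rewrite linear0.
Qed.

Lemma multiplicityZD k l nu x p q :
  multiplicity k l nu p -> multiplicity k l nu q ->
  multiplicity k l nu (x *: p + q).
Proof.
move=> [[hp zp] fp gp] [[hq zq] fq gq].
split; rewrite ?K_act_linr ?fp ?fq ?gp ?gq ?scaler0 ?addr0 //; split; last first.
  by rewrite K_act_linr zp zq scalerDr !scalerA mulrC.
move=> I; have := hp I; have := hq I; rewrite !ffunE; case: ifP => _.
  move=> [dq eq] [dp ep]; split; first exact: span_linear.
  by rewrite std_act_linr ep eq scaler0 addr0.
by move=> -> ->; rewrite scaler0 addr0.
Qed.

Definition Mult (k l : nat) (nu : C) : subspace K :=
  Subspace (multiplicity0 k l nu) (@multiplicityZD k l nu).

Definition decomposition_index :=
  {i : 'I_n.+1 * nat * C | `[< spectrum i.1.2 i.1.1 i.2 >]}.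

Definition idx_l (i : decomposition_index) : nat := (val i).1.1.
Definition idx_k (i : decomposition_index) : nat := (val i).1.2.
Definition idx_nu (i : decomposition_index) : C := (val i).2.

Definition idx_Mult (i : decomposition_index) : subspace K :=
  Mult (idx_k i) (idx_l i) (idx_nu i).

Definition decomposition_sum (L : decomposition_index -> u21_rep c)
    : lmodType C :=
  dsum (fun i => tens (subspace_type (idx_Mult i)) (ur_W (L i))).

Definition summand (L : decomposition_index -> u21_rep c) i
    (m : subspace_type (idx_Mult i)) (w : ur_W (L i)) : decomposition_sum L :=
  dsum_in (W := fun i => tens (subspace_type (idx_Mult i)) (ur_W (L i)))
    (tensor m w).

(* [Phi] is an isomorphism from the sum of the M_i (x) L_i onto K.  The
   centraliser preserves M_i; it acts on the factors M_i, and u(2|1) acts on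
   the factors L_i. *)
Definition joint_decomposition (L : decomposition_index -> u21_rep c)
    (Phi : {linear decomposition_sum L -> K}) :=
  [/\ bijective Phi,
      (forall i r p, u21_centraliser r ->
         idx_Mult i p -> idx_Mult i (K_act r p)),
      (forall i (m : subspace_type (idx_Mult i)) (w : ur_W (L i)) X, u21 X ->
         Phi (summand m (ur_act X w)) = K_act X (Phi (summand m w))) &
      (forall i (m m' : subspace_type (idx_Mult i)) (w : ur_W (L i)) r,
         u21_centraliser r -> val m' = K_act r (val m) ->
         Phi (summand m' w) = K_act r (Phi (summand m w)))].

End Multiplicity.

(* Main.v *)
From HB Require Import structures.
Require Import Defs.
From mathcomp Require Import all_boot all_order all_algebra all_fingroup.
From mathcomp Require Import complex boolp reals ring.

(** The module [K] is unitary, and the argument is the usual one for a unitary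
    lowest weight module, carried out with the odd generators only.

    [Fplus] and [Fbarplus] raise the degree of [K] by one, [Fminus] and
    [Fbarminus] lower it.  Their anticommutators are combinations of the even
    generators ([Fm_Gp], [Gm_Fp], [Fp_Gp], [Fm_Gm]), and for the product form
    [Fplus] is adjoint to [Fbarminus] and [Fbarplus] to [Fminus] ([h_Fp], [h_Gp]).
    As [Hop] measures the degree in the standard module and [Z2] the degree in the
    spinors, and as [Eminus] is a multiple of the anticommutator of the two
    lowering operators, the multiplicity spaces are exactly the spaces of lowest
    weight vectors of a given weight ([MultP]).

    Let [w] be the lowest weight vector of an irreducible module [L] and [m] a
    vector of the multiplicity space with the same weight.  The submodule of the
    product of [L] and [K] that [(w, m)] generates is the graph of an intertwining
    map from [L] to [K].  Every vector of [L] occurs in it, because [L] is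
    irreducible; and a vector [q] that occurs above [0] vanishes, because it is
    orthogonal to [m] and hence, moving raising operators to the other side of the
    form, to the submodule generated by [m], to which it belongs
    ([intertwiner_exists]).  An intertwining map is determined by its value at [w]
    ([intertwiner_eq]), so the map depends linearly on [m] and is compatible with
    the centraliser.  These maps together define the map from the direct sum to [K].

    It is injective because orthogonal lowest weight vectors generate orthogonal
    submodules ([gen_orth]) and every element of the direct sum can be written
    with pairwise orthogonal nonzero vectors [m] ([orthogonal_exists]).  It is
    surjective by induction on the degree ([K_generated]): a homogeneous part of
    [K] is finite-dimensional, the orthogonal complement of the raised vectors in
    it is annihilated by the lowering operators, and the self-adjoint operators
    [Z1] and [Z2] decompose that complement into weight vectors. *)

Set Implicit Arguments.
Unset Strict Implicit.
Unset Printing Implicit Defensive.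

Import Order.TTheory GRing.Theory Num.Theory.
Local Open Scope ring_scope.

Local Notation span := Defs.span.
Local Notation tens := Defs.tens.

(** * Spans, eigenvectors and Hermitian forms *)

Section Span.
Variables (R : realType) (V : lmodType R[i]).
Local Notation K := R[i].
Implicit Types P Q : V -> Prop.

Lemma span_base P v : P v -> span P v.
Proof. by move=> Pv; rewrite -[v]scale1r -[_ *: _]addr0; apply/spanZD/span0. Qed.

Lemma spanZ P k v : span P v -> span P (k *: v).
Proof. by move=> Pv; rewrite -[_ *: _]addr0; apply/span_linear/span0. Qed.

Lemma spanD P u v : span P u -> span P v -> span P (u + v).
Proof. by move=> Pu Pv; rewrite -[u]scale1r; apply: span_linear. Qed.

Lemma spanB P u v : span P u -> span P v -> span P (u - v).
Proof. by move=> Pu Pv; rewrite -scaleN1r; apply/spanD/spanZ. Qed.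

Lemma span_sum P (I : Type) (r : seq I) (F : I -> V) :
  (forall i, span P (F i)) -> span P (\sum_(i <- r) F i).
Proof. by move=> PF; apply: big_ind => //; [apply: span0 | apply: spanD]. Qed.

Lemma spanS P Q : (forall v, P v -> span Q v) -> forall v, span P v -> span Q v.
Proof.
move=> PQ v; elim=> [|k u w /PQ Qu _ Qw]; first exact: span0.
exact: span_linear.
Qed.

Lemma subspaceD (U : subspace V) u v : U u -> U v -> U (u + v).
Proof. by move=> Uu Uv; rewrite -[u]scale1r; apply: subspaceZD. Qed.

Lemma subspaceZ (U : subspace V) k u : U u -> U (k *: u).
Proof. by move=> Uu; rewrite -[_ *: _]addr0; apply/subspaceZD/subspace0. Qed.

Lemma subspaceB (U : subspace V) u v : U u -> U v -> U (u - v).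
Proof. by move=> Uu Uv; rewrite -scaleN1r; apply/subspaceD/subspaceZ. Qed.

Lemma span_sub (U : subspace V) P : (forall v, P v -> U v) ->
  forall v, span P v -> U v.
Proof.
move=> PU v; elim=> [|k u w /PU Uu _ Uw]; first exact: subspace0.
exact: subspaceZD.
Qed.

Lemma span_coord (s : seq V) v : span (fun x => x \in s) v ->
  exists a : 'I_(size s) -> K, v = \sum_j a j *: s`_j.
Proof.
elim=> [|k u w us _ [a ->]].
  by exists (fun=> 0); rewrite big1 // => j _; rewrite scale0r.
have lt_u : (index u s < size s)%N by rewrite index_mem.
pose iu := Ordinal lt_u.
exists (fun j => k * (j == iu)%:R + a j).
under [RHS]eq_bigr do rewrite scalerDl -scalerA.
rewrite big_split /= -scaler_sumr; congr (k *: _ + _).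
rewrite (bigD1 iu) //= eqxx scale1r nth_index // big1 ?addr0 // => j /negPf ->.
by rewrite scale0r.
Qed.

(** The coordinate matrix has one more row than columns, hence a nonzero row
    vector in its kernel. *)
Lemma span_dependent (s : seq V) (v : 'I_(size s).+1 -> V) :
  (forall i, span (fun x => x \in s) (v i)) ->
  exists2 u : 'rV[K]_(size s).+1, u != 0 & \sum_i u 0 i *: v i = 0.
Proof.
move=> vs; have /choice[a va] := fun i => span_coord (vs i).
pose M := \matrix_(i, j) a i j.
have /rowV0Pn[u /sub_kermxP uM u0] : kermx M != 0.
  rewrite -mxrank_eq0 mxrank_ker subn_eq0 -ltnNge ltnS; exact: rank_leq_col.
exists u => //.
under eq_bigr do rewrite va scaler_sumr.
rewrite exchange_big big1 //= => j _.
under eq_bigr do rewrite scalerA.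
rewrite -scaler_suml.
have := congr1 (fun N : 'rV_ _ => N 0 j) uM; rewrite !mxE => uMj.
rewrite [X in X *: _](_ : _ = 0) ?scale0r // -[RHS]uMj.
by apply: eq_bigr => i _; rewrite mxE.
Qed.

End Span.

Section EigenSpan.
Variables (R : realType) (V : lmodType R[i]) (T : V -> V).
Hypothesis T_lin : forall k u v, T (k *: u + v) = k *: T u + T v.

(** A product of factors [T - b] with [b] other than [a] kills [u], and acts on
    an eigenvector of eigenvalue [a] as a nonzero scalar. *)
Lemma eig_span0 a u :
  span (fun v => exists2 b, b != a & T v = b *: v) u -> T u = a *: u -> u = 0.
Proof.
pose Ts (s : seq R[i]) v := foldr (fun b q => T q - b *: q) v s.
have T_lin' b k x y : T (k *: x + y) - b *: (k *: x + y) =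
    k *: (T x - b *: x) + (T y - b *: y).
  by rewrite T_lin scalerDr opprD addrACA scalerBr !scalerA mulrC.
have Ts_lin s k x y : Ts s (k *: x + y) = k *: Ts s x + Ts s y.
  by elim: s => //= b s ->; exact: T_lin'.
have T0 : T 0 = 0 by have := T_lin (-1) 0 0; rewrite scaler0 addr0 scaleN1r addNr.
have TZ k x : T (k *: x) = k *: T x by rewrite -[k *: x]addr0 T_lin T0 addr0.
have Ts_eig s b x : T x = b *: x -> Ts s x = (\prod_(e <- s) (b - e)) *: x.
  move=> Tx; elim: s => [|e s IH] /=; first by rewrite big_nil scale1r.
  by rewrite IH big_cons TZ Tx !scalerA -scalerBl mulrBl [b * _]mulrC.
move=> su Tu; have [s as_ us] : exists2 s, a \notin s & Ts s u = 0.
  elim: su => [|k v w [b ba Tv] _ [s as_ ws]]; first by exists [::].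
  exists (b :: s); first by rewrite inE negb_or eq_sym ba.
  rewrite /= Ts_lin ws addr0 (Ts_eig _ _ _ Tv) !TZ Tv !scalerA -scalerBl.
  by rewrite [X in X *: _](_ : _ = 0) ?scale0r //; ring.
move: us; rewrite (Ts_eig _ _ _ Tu) => /eqP; rewrite scaler_eq0 => /orP[|/eqP//].
rewrite prodf_seq_eq0 => /hasP[b bs]; rewrite subr_eq0 => /eqP ab.
by rewrite ab bs in as_.
Qed.

End EigenSpan.

Section HermitianForm.
Variables (R : realType) (W : lmodType R[i]) (h : W -> W -> R[i]).
Hypothesis h_herm : is_hermitian h.
Hypothesis h_pos : pos_definite h.

Lemma hformC p q : h q p = (h p q)^*.
Proof. exact: (proj2 h_herm). Qed.

Lemma hform_linl k p q r : h (k *: p + q) r = k * h p r + h q r.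
Proof. exact: (proj1 h_herm). Qed.

Lemma hform0l r : h 0 r = 0.
Proof.
have := hform_linl (-1) 0 0 r.
by rewrite scaler0 addr0 mulN1r addNr.
Qed.

Lemma hformZl k p r : h (k *: p) r = k * h p r.
Proof. by have := hform_linl k p 0 r; rewrite !addr0 hform0l addr0. Qed.

Lemma hformDl p q r : h (p + q) r = h p r + h q r.
Proof. by have := hform_linl 1 p q r; rewrite scale1r mul1r. Qed.

Lemma hformBl p q r : h (p - q) r = h p r - h q r.
Proof. by rewrite hformDl -scaleN1r hformZl mulN1r. Qed.

Lemma hformDr p q r : h p (q + r) = h p q + h p r.
Proof. by rewrite hformC hformDl rmorphD /= -!hformC. Qed.

Lemma hformZr k p q : h p (k *: q) = k^* * h p q.
Proof. by rewrite hformC hformZl rmorphM /= -hformC. Qed.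

Lemma hform0r p : h p 0 = 0.
Proof. by rewrite hformC hform0l rmorph0. Qed.

Lemma hform_eq0 p : h p p = 0 -> p = 0.
Proof.
by case: (eqVneq p 0) => // /h_pos pp pp0; rewrite pp0 ltxx in pp.
Qed.

Lemma hform_orthC p q : h p q = 0 -> h q p = 0.
Proof. by move=> pq; rewrite hformC pq rmorph0. Qed.

Lemma hform_proj1 p a : exists k, h (p - k *: a) a = 0.
Proof.
exists (h p a / h a a); rewrite hformBl hformZl.
case: (eqVneq a 0) => [->|/h_pos aa]; first by rewrite !hform0r mulr0 subr0.
by rewrite divfK ?subrr // gt_eqF.
Qed.

Lemma span_orthr P p v : (forall x, P x -> h p x = 0) -> span P v -> h p v = 0.
Proof.
move=> pP; elim=> [|k u w Pu _ IH]; first exact: hform0r.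
by rewrite hformDr hformZr pP // IH mulr0 addr0.
Qed.

(** Gram-Schmidt: for the induction step, [a] is first made orthogonal to [s]. *)
Lemma hform_proj (s : seq W) p :
  exists2 r, span (fun x => x \in s) r & forall x, x \in s -> h (p - r) x = 0.
Proof.
elim: s p => [|a s IH] p; first by exists 0 => //; apply: span0.
have [ra sa ra0] := IH a; have [rp sp rp0] := IH p.
have [k k0] := hform_proj1 (p - rp) (a - ra).
have sS v : span (fun x => x \in s) v -> span (fun x => x \in a :: s) v.
  by apply: spanS => x xs; apply: span_base; rewrite inE xs orbT.
exists (rp + k *: (a - ra)).
  apply/spanD/spanZ/spanB; [exact: sS | | exact: sS].
  by apply: span_base; rewrite inE eqxx.
have s0 x : x \in s -> h (p - (rp + k *: (a - ra))) x = 0.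
  by move=> xs; rewrite opprD addrA hformBl hformZl rp0 // ra0 // mulr0 subr0.
move=> x; rewrite inE => /predU1P[->|]; last exact: s0.
rewrite -[in X in h _ X](subrK ra a) hformDr.
by rewrite (span_orthr s0 sa) addr0 opprD addrA.
Qed.

Section Spectral.
Variables (T : W -> W) (U : subspace W).
Hypothesis T_lin : forall k u v, T (k *: u + v) = k *: T u + T v.
Hypothesis UT : forall u, U u -> U (T u).
Hypothesis T_adj : forall u v, U u -> U v -> h (T u) v = h u (T v).

Let eig v := U v /\ exists a, T v = a *: v.

Let T0 : T 0 = 0.
Proof. by have := T_lin (-1) 0 0; rewrite scaler0 addr0 scaleN1r addNr. Qed.

Let TD u v : T (u + v) = T u + T v.
Proof. by have := T_lin 1 u v; rewrite !scale1r. Qed.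

Let TZ k u : T (k *: u) = k *: T u.
Proof. by have := T_lin k u 0; rewrite T0 !addr0. Qed.

Let TB u v : T (u - v) = T u - T v.
Proof. by rewrite TD -scaleN1r TZ scaleN1r. Qed.

(** On the eigenvectors with eigenvalue other than [a] the operator [T - a] can
    be inverted, so [p] may be corrected to a vector that [T - a] maps into the
    eigenspace of [a]; self-adjointness makes that image vanish. *)
Lemma eig_sum_preim a p : U p -> span eig (T p - a *: p) -> span eig p.
Proof.
move=> Up Tp.
have [y [ya [eigy [Uya Tya Ey]]]] : exists y ya, span eig y /\
    [/\ U ya, T ya = a *: ya & T y - a *: y = T p - a *: p - ya].
  move: (T p - _) Tp => q; elim=> [|k u w [Uu [b Tu]] _ [y [ya [eigy [Uya Tya Ey]]]]].
    exists 0, 0; split; first exact: span0.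
    by split; [exact: subspace0 | rewrite scaler0 T0 | rewrite T0 scaler0 subr0].
  case: (eqVneq b a) => [ba|ba].
    exists y, (k *: u + ya); split => //; split; first exact: subspaceZD.
      by rewrite T_lin Tu Tya ba scalerDr !scalerA mulrC.
    by rewrite Ey opprD addrACA subrr add0r.
  exists ((k / (b - a)) *: u + y), ya; split.
    by apply: spanZD => //; split=> //; exists b.
  split=> //; rewrite T_lin Tu scalerDr opprD addrACA Ey addrA; congr (_ + _ - _).
  rewrite !scalerA -scalerBl [a * _]mulrC -mulrBr divfK //.
  by rewrite subr_eq0.
have Uy : U y by apply: span_sub eigy => v [].
pose p' := p - y.
have Up' : U p' by exact: subspaceB.
have Tp' : T p' - a *: p' = ya.
  rewrite /p' TB scalerBr opprD addrACA -opprD Ey opprB addrC.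
  by rewrite subrK.
have ya0 : ya = 0.
  case: (eqVneq ya 0) => // ya_neq0; apply: hform_eq0.
  have yy := h_pos ya_neq0.
  have a_real : a^* = a.
    have := T_adj Uya Uya; rewrite Tya hformZl hformZr => /mulIf <- //.
    by rewrite gt_eqF.
  rewrite -[in X in h X _]Tp' hformBl T_adj // Tya hformZl hformZr a_real.
  by rewrite subrr.
rewrite -(subrK y p); apply: spanD => //; apply: span_base; split=> //.
by exists a; apply/eqP; rewrite -subr_eq0 Tp' ya0.
Qed.

Lemma eig_sum_split (s : seq R[i]) p : U p ->
  foldr (fun a q => T q - a *: q) p s = 0 -> span eig p.
Proof.
elim/last_ind: s p => [|s a IH] p Up /=; first by move->; apply: span0.
rewrite foldr_rcons => Tp; apply: (@eig_sum_preim a) => //.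
by apply: IH => //; apply/subspaceB/subspaceZ => //; apply: UT.
Qed.

(** Evaluation of a polynomial at [T], without forming the algebra of operators:
    [T] is only a function. *)
Let polyop (q : {poly R[i]}) p := \sum_(i < size q) q`_i *: iter i T p.

Let polyopE N (q : {poly R[i]}) p : (size q <= N)%N ->
  polyop q p = \sum_(i < N) q`_i *: iter i T p.
Proof.
move=> qN; rewrite /polyop (big_ord_widen N (fun i => q`_i *: iter i T p)) //.
rewrite big_mkcond; apply: eq_bigr => i _; case: ltnP => // iq.
by rewrite nth_default // scale0r.
Qed.

Let iter_lin i k u v : iter i T (k *: u + v) = k *: iter i T u + iter i T v.
Proof. by elim: i => //= i ->; rewrite T_lin. Qed.

Let polyopM a (q : {poly R[i]}) p :
  polyop (('X - a%:P) * q) p = polyop q (T p - a *: p).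
Proof.
have sq : (size (('X - a%:P) * q)%R <= (size q).+1)%N.
  by apply: leq_trans (size_polyMleq _ _) _; rewrite size_XsubC.
rewrite (polyopE _ sq) (polyopE _ (leqnn _)).
under eq_bigr do rewrite mulrBl coefB coefXM coefCM scalerBl.
rewrite sumrB big_ord_recl /= scale0r add0r.
rewrite [X in _ - X]big_ord_recr /= [q`_(size q)]nth_default // mulr0 scale0r addr0.
rewrite -sumrB; apply: eq_bigr => i _.
rewrite add0n [T p - _]addrC -[- (a *: p)]scaleNr iter_lin -iterSr scalerDr /= scalerA.
by rewrite mulrN scaleNr [q`_i * a]mulrC addrC.
Qed.

Let polyop_split k (s : seq R[i]) p :
  polyop (k *: \prod_(a <- s) ('X - a%:P)) p =
  k *: foldr (fun a q => T q - a *: q) p (rev s).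
Proof.
elim: s p => [|a s IH] p.
  rewrite big_nil (@polyopE 1); last first.
    exact: leq_trans (size_scale_leq _ _) (size_polyC_leq1 _).
  by rewrite big_ord1 coefZ coef1 mulr1.
by rewrite big_cons scalerAr polyopM IH rev_cons foldr_rcons.
Qed.

(** The iterates of [T] at [p] lie in a finite-dimensional space, so a nonzero
    polynomial in [T] kills [p]; it splits into linear factors over [R[i]], which
    [eig_sum_preim] removes one at a time. *)
Lemma selfadjoint_eig (s : seq W) p :
  (forall u, U u -> span (fun x => x \in s) u) -> U p -> span eig p.
Proof.
move=> Us Up.
have Ui i : U (iter i T p) by elim: i => //= i; apply: UT.
have [u u0 up] := span_dependent (fun i : 'I_(size s).+1 => Us _ (Ui i)).
pose q := \poly_(i < (size s).+1) u 0 (inord i).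
have q0 : q != 0.
  apply: contraNneq u0 => q0; apply/eqP/rowP=> i; rewrite mxE.
  have := congr1 (fun r : {poly _} => r`_i) q0.
  by rewrite coef_poly coef0 ltn_ord inord_val.
have qp : polyop q p = 0.
  rewrite (polyopE _ (size_poly _ _)) -[RHS]up; apply: eq_bigr => i _.
  by rewrite coef_poly ltn_ord inord_val.
have [r qr] := closed_field_poly_normal q.
apply: (@eig_sum_split (rev r)) => //.
move: qp; rewrite qr polyop_split => /eqP.
by rewrite scaler_eq0 lead_coef_eq0 (negPf q0) => /eqP.
Qed.

End Spectral.

End HermitianForm.

(** * Reflections and the orthonormal basis *)

Section ReflectionSetting.
Variables (R : realType) (n : nat) (D : reflection_setting R n).
Local Notation E := (rs_E D).
Local Notation B := (@rs_B R n D).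

Lemma BZDl k u v w : B (k *: u + v) w = k * B u w + B v w.
Proof. exact: rs_B_linear. Qed.

Lemma B0l w : B 0 w = 0.
Proof.
by have := BZDl (-1) 0 0 w; rewrite scaler0 addr0 mulN1r addNr.
Qed.

Lemma BZl k u w : B (k *: u) w = k * B u w.
Proof. by have := BZDl k u 0 w; rewrite !addr0 B0l addr0. Qed.

Lemma BDl u v w : B (u + v) w = B u w + B v w.
Proof. by have := BZDl 1 u v w; rewrite scale1r mul1r. Qed.

Lemma B_suml (I : finType) (F : I -> E) w : B (\sum_i F i) w = \sum_i B (F i) w.
Proof. exact: (big_morph (B^~ w) (fun u v => BDl u v w) (B0l w)). Qed.

(** An orthonormal family is free, and here it has as many elements as the
    dimension. *)
Lemma onb_expand u :
  u = \sum_j B u (rs_xi D j) *: rs_xi D j + \sum_j B u (rs_eta D j) *: rs_eta D j.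
Proof.
pose e (i : 'I_(n + n)) :=
  match split i with inl j => rs_xi D j | inr j => rs_eta D j end.
have el j : e (lshift n j) = rs_xi D j.
  by rewrite /e -[lshift n j]/(unsplit (inl j)) unsplitK.
have er j : e (rshift n j) = rs_eta D j.
  by rewrite /e -[rshift n j]/(unsplit (inr j)) unsplitK.
have ee i j : B (e i) (e j) = (i == j)%:R.
  case: (split_ordP i) => i' ->; case: (split_ordP j) => j' ->; rewrite ?el ?er.
  - by rewrite rs_xi_xi eq_lshift.
  - by rewrite rs_xi_eta eq_lrshift.
  - by rewrite rs_B_sym rs_xi_eta eq_rlshift.
  - by rewrite rs_eta_eta eq_rshift.
have Bsum (k : 'I_(n + n) -> R) j : B (\sum_i k i *: e i) (e j) = k j.
  rewrite B_suml (bigD1 j) //= BZl ee eqxx mulr1 big1 ?addr0 // => i /negPf ij.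
  by rewrite BZl ee ij mulr0.
pose X := [tuple e i | i < n + n].
have Xi (i : 'I_(n + n)) : X`_i = e i by rewrite -tnth_nth tnth_mktuple.
have freeX : free X.
  apply/freeP=> k k0 i; rewrite -(Bsum k).
  by under eq_bigr do rewrite -Xi; rewrite k0 B0l.
have basisX : basis_of fullv X.
  by rewrite basisEfree freeX subvf rs_dim size_tuple addnn leqnn.
have := coord_basis basisX (memvf u).
under eq_bigr do rewrite Xi.
move=> Eu; have Bu j : B u (e j) = coord X j u by rewrite {1}Eu Bsum.
rewrite {1}Eu big_split_ord; congr (_ + _); apply: eq_bigr => j _.
  by rewrite -Bu el.
by rewrite -Bu er.
Qed.

Lemma dual_expand (x : dual E) u :
  x u = \sum_j B u (rs_xi D j) * x (rs_xi D j)
      + \sum_j B u (rs_eta D j) * x (rs_eta D j).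
Proof.
rewrite {1}(onb_expand u) linearD !linear_sum /=.
by congr (_ + _); apply: eq_bigr => j _; rewrite linearZ.
Qed.

Lemma rs_xE j u : rs_x D j u = B u (rs_xi D j).
Proof.
rewrite dual_expand (bigD1 j) //= rs_x_xi eqxx mulr1 big1 ?addr0; last first.
  by move=> k /negPf kj; rewrite rs_x_xi eq_sym kj mulr0.
by rewrite big1 ?addr0 // => k _; rewrite rs_x_eta mulr0.
Qed.

Lemma rs_yE j u : rs_y D j u = B u (rs_eta D j).
Proof.
rewrite dual_expand big1 ?add0r; last by move=> k _; rewrite rs_y_xi mulr0.
rewrite (bigD1 j) //= rs_y_eta eqxx mulr1 big1 ?addr0 //.
by move=> k /negPf kj; rewrite rs_y_eta eq_sym kj mulr0.
Qed.

Lemma vec_expand u :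
  u = \sum_j rs_x D j u *: rs_xi D j + \sum_j rs_y D j u *: rs_eta D j.
Proof.
under eq_bigr do rewrite rs_xE; under [X in _ + X]eq_bigr do rewrite rs_yE.
exact: onb_expand.
Qed.

Lemma cov_expand (x : dual E) :
  x = \sum_j x (rs_xi D j) *: rs_x D j + \sum_j x (rs_eta D j) *: rs_y D j.
Proof.
apply/lfunP=> u; rewrite dual_expand add_lfunE !sum_lfunE.
by congr (_ + _); apply: eq_bigr => j _; rewrite scale_lfunE mulrC ?rs_xE ?rs_yE.
Qed.

Lemma norm_expand u :
  \sum_j (rs_x D j u ^+ 2 + rs_y D j u ^+ 2) = B u u.
Proof.
rewrite [X in _ = B X _]onb_expand BDl !B_suml big_split.
by congr (_ + _); apply: eq_bigr => j _;
  rewrite BZl ?rs_xE ?rs_yE expr2 [X in _ = _ * X]rs_B_sym.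
Qed.

Section Reflection.
Variable s : rs_gT D.
Hypothesis sS : s \in rs_refl D.
Local Notation alpha := (rs_alpha s).

Lemma alpha_neq0 : alpha != 0.
Proof. by case: (rs_alpha_eigen sS). Qed.

Lemma act_alpha : rs_act s alpha = - alpha.
Proof. by case: (rs_alpha_eigen sS). Qed.

Lemma Balpha_neq0 : B alpha alpha != 0.
Proof. by rewrite gt_eqF // rs_B_pos // alpha_neq0. Qed.

(** The fixed hyperplane and the line of [alpha] are complementary, because
    [alpha] is not fixed. *)
Lemma refl_split u : exists k w, rs_act s w = w /\ u = k *: alpha + w.
Proof.
pose F := fixedSpace (rs_act s).
have aF : alpha \notin F.
  apply/negP=> /fixedSpaceP; rewrite act_alpha => /eqP.
  rewrite eq_sym -addr_eq0 -mulr2n -scaler_nat scaler_eq0 pnatr_eq0 /=.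
  by rewrite (negPf alpha_neq0).
have dF : (<[alpha]> :&: F = 0)%VS.
  apply/eqP; rewrite -subv0; apply/subvP=> v; rewrite memv_cap memv0.
  case/andP=> /vlineP[k ->]; case: (eqVneq k 0) => [->|k0]; first by rewrite scale0r.
  move=> kaF; case/negP: aF.
  by rewrite -[alpha](scalerK k0); apply: memvZ.
have FE : (<[alpha]> + F = fullv)%VS.
  apply/eqP; rewrite eqEdim subvf dimv_disjoint_sum // dim_vline alpha_neq0.
  by move: sS; rewrite /rs_refl inE => /eqP <- /=; rewrite add1n.
have: u \in (<[alpha]> + F)%VS by rewrite FE memvf.
case/memv_addP=> v /vlineP[k ->] [w /fixedSpaceP wF ->].
by exists k, w.
Qed.

Lemma B_alpha_fix w : rs_act s w = w -> B w alpha = 0.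
Proof.
move=> sw; have := rs_act_orth s w alpha.
rewrite sw act_alpha -scaleN1r rs_B_sym BZl mulN1r rs_B_sym => /eqP.
by rewrite eq_sym -addr_eq0 -mulr2n -mulr_natr mulf_eq0 pnatr_eq0 orbF => /eqP.
Qed.

Lemma act_invK w : rs_act s^-1%g (rs_act s w) = w.
Proof. by rewrite -comp_lfunE -rs_actM mulVg rs_act1 id_lfunE. Qed.

Lemma a_fix w : rs_act s w = w -> rs_a s w = 0.
Proof.
move=> sw; have [_ /lfunP/(_ w)] := rs_a_eigen sS.
rewrite comp_lfunE opp_lfunE /= -{1}sw act_invK => /eqP.
by rewrite -addr_eq0 -mulr2n -mulr_natr mulf_eq0 pnatr_eq0 orbF => /eqP.
Qed.

Lemma a_alpha_neq0 : rs_a s alpha != 0.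
Proof.
have [+ _] := rs_a_eigen sS; apply: contraNneq => a0; apply/eqP/lfunP => u.
have [k [w [sw ->]]] := refl_split u.
by rewrite linearP /= a0 (a_fix sw) scaler0 addr0 lfunE.
Qed.

(** Both [rs_a s] and the form with [alpha] vanish on the fixed hyperplane, so
    they are proportional. *)
Lemma corootE u : coroot s u = 2 * B u alpha / B alpha alpha.
Proof.
rewrite scale_lfunE; have [k [w [sw ->]]] := refl_split u.
rewrite linearP /= (a_fix sw) addr0 BZDl (B_alpha_fix sw) addr0.
rewrite /GRing.scale /= [k * rs_a _ _]mulrC mulrA divfK ?a_alpha_neq0 //.
by rewrite mulrA mulfK // Balpha_neq0.
Qed.

Lemma refl_vecE u : rs_act s u = u - coroot s u *: alpha.
Proof.
rewrite corootE; have [k [w [sw ->]]] := refl_split u.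
rewrite linearP /= sw act_alpha BZDl (B_alpha_fix sw) addr0 mulrA mulfK ?Balpha_neq0 //.
by rewrite addrAC -scalerBl scalerN -scaleNr mulr_natl mulr2n opprD addrA subrr sub0r.
Qed.

Lemma refl_inv u : rs_act s^-1%g u = rs_act s u.
Proof.
have [k [w [sw ->]]] := refl_split u.
rewrite !linearP /= act_alpha sw -{1}sw act_invK.
have e : rs_act s (- alpha) = alpha by rewrite linearN /= act_alpha opprK.
by rewrite -{1}e act_invK.
Qed.

Lemma refl_covE (x : dual E) : rs_dact s x = x - x alpha *: coroot s.
Proof.
apply/lfunP=> u; rewrite comp_lfunE /= refl_inv refl_vecE.
rewrite linearB linearZ /= add_lfunE opp_lfunE; congr (_ - _).
by rewrite [RHS]scale_lfunE /GRing.scale /= mulrC.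
Qed.

End Reflection.

End ReflectionSetting.

(** * Relations in the Cherednik algebra *)

Section Commutators.
Variables (K : fieldType) (X : Type) (rel : aterm K X -> aterm K X -> Prop).
Local Notation A := (palg rel).
Implicit Types a b d : A.

Definition pcomm a b := a * b - b * a.
Definition pacomm a b := a * b + b * a.

Lemma pZl k a b : (k *: a) * b = k *: (a * b). Proof. by rewrite palg_scaleAl. Qed.
Lemma pZr k a b : a * (k *: b) = k *: (a * b). Proof. by rewrite palg_scaleAr. Qed.

Lemma pcommC a b : pcomm a b = - pcomm b a.
Proof. by rewrite /pcomm opprB. Qed.
Lemma pcommDl a b d : pcomm (a + b) d = pcomm a d + pcomm b d.
Proof. by rewrite /pcomm mulrDl mulrDr opprD addrACA. Qed.
Lemma pcommZl k a b : pcomm (k *: a) b = k *: pcomm a b.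
Proof. by rewrite /pcomm pZl pZr scalerBr. Qed.
Lemma pcommNl a b : pcomm (- a) b = - pcomm a b.
Proof. by rewrite -scaleN1r pcommZl scaleN1r. Qed.
Lemma pcomm0l a : pcomm 0 a = 0. Proof. by rewrite /pcomm mul0r mulr0 subr0. Qed.
Lemma pcomm1l a : pcomm 1 a = 0. Proof. by rewrite /pcomm mul1r mulr1 subrr. Qed.
Lemma pcomm_suml (I : Type) (r : seq I) (P : pred I) F a :
  pcomm (\sum_(i <- r | P i) F i) a = \sum_(i <- r | P i) pcomm (F i) a.
Proof. exact: (big_morph (pcomm^~ a) (fun u v => pcommDl u v a) (pcomm0l a)). Qed.
Lemma pcommDr a b d : pcomm d (a + b) = pcomm d a + pcomm d b.
Proof. by rewrite pcommC pcommDl opprD -!pcommC. Qed.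
Lemma pcommZr k a b : pcomm b (k *: a) = k *: pcomm b a.
Proof. by rewrite pcommC pcommZl -scalerN -pcommC. Qed.
Lemma pcommMl a b d : pcomm (a * b) d = a * pcomm b d + pcomm a d * b.
Proof. by rewrite /pcomm mulrBr mulrBl !mulrA addrA subrK. Qed.

Lemma pacommC a b : pacomm a b = pacomm b a. Proof. exact: addrC. Qed.
Lemma pacommDl a b d : pacomm (a + b) d = pacomm a d + pacomm b d.
Proof. by rewrite /pacomm mulrDl mulrDr addrACA. Qed.
Lemma pacommZl k a b : pacomm (k *: a) b = k *: pacomm a b.
Proof. by rewrite /pacomm pZl pZr scalerDr. Qed.
Lemma pacommDr a b d : pacomm d (a + b) = pacomm d a + pacomm d b.
Proof. by rewrite pacommC pacommDl -!(pacommC d). Qed.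
Lemma pacommZr k a b : pacomm b (k *: a) = k *: pacomm b a.
Proof. by rewrite pacommC pacommZl pacommC. Qed.
Lemma pacomm0l a : pacomm 0 a = 0. Proof. by rewrite /pacomm mul0r mulr0 addr0. Qed.
Lemma pacomm_suml (I : Type) (r : seq I) (P : pred I) F a :
  pacomm (\sum_(i <- r | P i) F i) a = \sum_(i <- r | P i) pacomm (F i) a.
Proof. exact: (big_morph (pacomm^~ a) (fun u v => pacommDl u v a) (pacomm0l a)). Qed.
Lemma pacomm_sumr (I : Type) (r : seq I) (P : pred I) F a :
  pacomm a (\sum_(i <- r | P i) F i) = \sum_(i <- r | P i) pacomm a (F i).
Proof. by rewrite pacommC pacomm_suml; apply: eq_bigr => i _; apply: pacommC. Qed.

End Commutators.

Section CherednikRelations.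
Variables (R : realType) (n : nat) (D : reflection_setting R n).
Variable c : rs_gT D -> R[i].
Local Notation C := R[i].
Local Notation S := (rs_refl D).
Local Notation V := (chV c).
Local Notation X := (chX c).
Local Notation G := (chG c).
Local Notation B := (@rs_B R n D).
Local Notation xi := (rs_xi D).
Local Notation eta := (rs_eta D).
Local Notation x_ := (rs_x D).
Local Notation y_ := (rs_y D).
Local Notation H := (cherednik c).

Lemma chV_lin k u v : V (k *: u + v) = k%:C%C *: V u + V v.
Proof. by rewrite /chV /agen -aclassZ -aclassD; apply: aclass_rel; constructor. Qed.

Lemma chX_lin k u v : X (k *: u + v) = k%:C%C *: X u + X v.
Proof. by rewrite /chX /agen -aclassZ -aclassD; apply: aclass_rel; constructor. Qed.

Lemma chV0 : V 0 = 0.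
Proof.
have := chV_lin (-1) 0 0; rewrite scaler0 addr0 => E0.
by rewrite [LHS]E0 rmorphN1 scaleN1r addNr.
Qed.

Lemma chX0 : X 0 = 0.
Proof.
have := chX_lin (-1) 0 0; rewrite scaler0 addr0 => E0.
by rewrite [LHS]E0 rmorphN1 scaleN1r addNr.
Qed.

Lemma chVZ k u : V (k *: u) = k%:C%C *: V u.
Proof. by rewrite -[_ *: u]addr0 chV_lin chV0 addr0. Qed.
Lemma chVD u v : V (u + v) = V u + V v.
Proof. by rewrite -[u]scale1r chV_lin rmorph1 !scale1r. Qed.
Lemma chXZ k u : X (k *: u) = k%:C%C *: X u.
Proof. by rewrite -[_ *: u]addr0 chX_lin chX0 addr0. Qed.
Lemma chXD u v : X (u + v) = X u + X v.
Proof. by rewrite -[u]scale1r chX_lin rmorph1 !scale1r. Qed.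

Lemma chV_expand u : V u = \sum_j (x_ j u)%:C%C *: V (xi j)
                         + \sum_j (y_ j u)%:C%C *: V (eta j).
Proof.
rewrite {1}(vec_expand u) chVD !(big_morph _ chVD chV0).
by congr (_ + _); apply: eq_bigr => j _; rewrite chVZ.
Qed.

Lemma chX_expand x : X x = \sum_j (x (xi j))%:C%C *: X (x_ j)
                         + \sum_j (x (eta j))%:C%C *: X (y_ j).
Proof.
rewrite {1}(cov_expand x) chXD !(big_morph _ chXD chX0).
by congr (_ + _); apply: eq_bigr => j _; rewrite chXZ.
Qed.

Lemma chG_V g u : G g * V u = V (rs_act g u) * G g.
Proof. by rewrite /chG /chV /agen -!aclassM; apply: aclass_rel; constructor. Qed.

Lemma chG_X g x : G g * X x = X (rs_dact g x) * G g.
Proof. by rewrite /chG /chX /agen -!aclassM; apply: aclass_rel; constructor. Qed.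

Lemma chV_V u v : pcomm (V u) (V v) = 0.
Proof.
apply/eqP; rewrite subr_eq0; apply/eqP.
by rewrite /chV /agen -!aclassM; apply: aclass_rel; constructor.
Qed.

Lemma chX_X u v : pcomm (X u) (X v) = 0.
Proof.
apply/eqP; rewrite subr_eq0; apply/eqP.
by rewrite /chX /agen -!aclassM; apply: aclass_rel; constructor.
Qed.

Lemma chV_X u x : pcomm (V u) (X x) = (x u)%:C%C *: (1 : H) -
  \sum_(s in S) ((x (rs_alpha s))%:C%C * (coroot s u)%:C%C * c s) *: G s.
Proof.
have := aclass_rel (ch_vec_cov c u x).
rewrite !(aclassD, aclassN, aclassZ, aclassM, aclass1).
rewrite (big_morph _ (@aclassD _ _ (ch_rel c)) (@aclass0 _ _ (ch_rel c))).
by under eq_bigr do rewrite aclassZ.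
Qed.

Lemma refl_V s u : s \in S ->
  pcomm (G s) (V u) = - ((coroot s u)%:C%C *: (V (rs_alpha s) * G s)).
Proof.
move=> sS; rewrite /pcomm chG_V refl_vecE // -scaleNr [u + _]addrC chV_lin mulrDl addrK.
by rewrite rmorphN scaleNr mulNr pZl.
Qed.

Lemma refl_X s x : s \in S ->
  pcomm (G s) (X x) = - ((x (rs_alpha s))%:C%C *: (X (coroot s) * G s)).
Proof.
move=> sS; rewrite /pcomm chG_X refl_covE // -scaleNr [x + _]addrC chX_lin mulrDl addrK.
by rewrite rmorphN scaleNr mulNr pZl.
Qed.

Let sumG : H := \sum_(s in S) c s *: G s.
Let euler : H := \sum_j X (x_ j) * V (xi j) + \sum_j X (y_ j) * V (eta j).

(** The correction term is the one that the group elements in [ch_H] produce by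
    [refl_X]: this is why [ch_H] acts as a grading element. *)
Lemma euler_X x :
  pcomm euler (X x) = X x - \sum_(s in S)
    ((x (rs_alpha s))%:C%C * c s) *: (X (coroot s) * G s).
Proof.
have E a u : pcomm (X a * V u) (X x) = (x u)%:C%C *: X a
    - \sum_(s in S) ((x (rs_alpha s))%:C%C * c s) *: (((coroot s u)%:C%C *: X a) * G s).
  rewrite pcommMl chX_X mul0r addr0 chV_X mulrBr pZr mulr1 mulr_sumr.
  by congr (_ - _); apply: eq_bigr => s _; rewrite pZr pZl scalerA mulrAC.
rewrite pcommDl !pcomm_suml.
under eq_bigr do rewrite E; under [X in _ + X]eq_bigr do rewrite E.
rewrite !sumrB addrACA -chX_expand; congr (_ + _); rewrite -opprD; congr (- _).
rewrite exchange_big [X in _ + X]exchange_big -big_split; apply: eq_bigr => s _ /=.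
by rewrite -!scaler_sumr -scalerDr -!mulr_suml -mulrDl -chX_expand.
Qed.

Lemma euler_V u :
  pcomm euler (V u) = - V u + \sum_(s in S)
    ((coroot s u)%:C%C * c s) *: (G s * V (rs_alpha s)).
Proof.
have E a w : pcomm (X a * V w) (V u) = - ((a u)%:C%C *: V w)
    + \sum_(s in S) ((coroot s u)%:C%C * c s) *: (G s * ((a (rs_alpha s))%:C%C *: V w)).
  rewrite pcommMl chV_V mulr0 add0r pcommC chV_X opprB mulrBl pZl mul1r addrC mulr_suml.
  congr (_ + _); apply: eq_bigr => s _; rewrite pZr pZl scalerA; congr (_ *: _).
  by ring.
rewrite pcommDl !pcomm_suml.
under eq_bigr do rewrite E; under [X in _ + X]eq_bigr do rewrite E.
rewrite !big_split /= !sumrN addrACA -opprD -chV_expand; congr (_ + _).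
rewrite exchange_big [X in _ + X]exchange_big -big_split; apply: eq_bigr => s _ /=.
by rewrite -!scaler_sumr -scalerDr -!mulr_sumr -mulrDr -chV_expand.
Qed.

(** The elements [z], [zeta] and their conjugates are all of one of these two
    forms (up to a factor 2), so that one commutator formula serves for all. *)
Definition ch_pv (a b : C) j : H := a *: V (xi j) + b *: V (eta j).
Definition ch_px (a b : C) j : H := a *: X (x_ j) + b *: X (y_ j).

Lemma ch_zE j : ch_z c j = ch_px 1 'i%C j.
Proof. by rewrite /ch_px scale1r. Qed.
Lemma ch_zbarE j : ch_zbar c j = ch_px 1 (- 'i%C) j.
Proof. by rewrite /ch_px scale1r scaleNr. Qed.
Lemma ch_zetaE j : ch_zeta c j = 2^-1 *: ch_pv 1 (- 'i%C) j.
Proof. by rewrite /ch_pv scale1r scaleNr. Qed.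
Lemma ch_zetabarE j : ch_zetabar c j = 2^-1 *: ch_pv 1 'i%C j.
Proof. by rewrite /ch_pv scale1r. Qed.

Lemma ch_pv_pv a b a' b' j k : pcomm (ch_pv a b j) (ch_pv a' b' k) = 0.
Proof. by rewrite !(pcommDl, pcommDr, pcommZl, pcommZr, chV_V, scaler0, addr0). Qed.
Lemma ch_px_px a b a' b' j k : pcomm (ch_px a b j) (ch_px a' b' k) = 0.
Proof. by rewrite !(pcommDl, pcommDr, pcommZl, pcommZr, chX_X, scaler0, addr0). Qed.

Let chV_px u a b j : pcomm (V u) (ch_px a b j) =
  (a * (x_ j u)%:C%C + b * (y_ j u)%:C%C) *: (1 : H) -
  \sum_(s in S) (c s * (coroot s u)%:C%C *
    (a * (x_ j (rs_alpha s))%:C%C + b * (y_ j (rs_alpha s))%:C%C)) *: G s.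
Proof.
rewrite pcommDr !pcommZr !chV_X !scalerBr !scalerA addrACA -scalerDl -opprD.
congr (_ - _); rewrite !scaler_sumr -big_split; apply: eq_bigr => s _ /=.
by rewrite !scalerA -scalerDl; congr (_ *: _); ring.
Qed.

Lemma ch_pv_px a b a' b' k j : pcomm (ch_pv a b k) (ch_px a' b' j) =
  ((j == k)%:R * (a * a' + b * b')) *: (1 : H) -
  \sum_(s in S) (c s * (2 / B (rs_alpha s) (rs_alpha s))%:C%C *
    ((a' * (x_ j (rs_alpha s))%:C%C + b' * (y_ j (rs_alpha s))%:C%C) *
     (a * (x_ k (rs_alpha s))%:C%C + b * (y_ k (rs_alpha s))%:C%C))) *: G s.
Proof.
rewrite pcommDl !pcommZl !chV_px rs_x_xi rs_x_eta rs_y_xi rs_y_eta.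
rewrite !scalerBr !scalerA addrACA -scalerDl -opprD; congr (_ - _).
  by rewrite rmorph0 rmorph_nat; congr (_ *: _); ring.
rewrite !scaler_sumr -big_split; apply: eq_bigr => s sS /=.
rewrite !scalerA -scalerDl; congr (_ *: _).
rewrite !corootE // [B (xi k) _]rs_B_sym [B (eta k) _]rs_B_sym -rs_xE -rs_yE.
have realM (a0 b0 d0 : R) : (a0 * b0 / d0)%:C%C = (a0 / d0)%:C%C * b0%:C%C.
  by rewrite -rmorphM mulrAC.
by rewrite !realM; ring.
Qed.

Lemma ch_HE : ch_H c = euler + n%:R - sumG.
Proof.
rewrite /ch_H; congr (_ + _ - _).
rewrite /euler -big_split; apply: eq_bigr => j _ /=.
rewrite ch_zE ch_zbarE ch_zetaE ch_zetabarE !pZr -scalerDr /ch_pv /ch_px.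
move: (X (x_ j)) (X (y_ j)) (V (xi j)) (V (eta j)) => x y u v.
rewrite !scale1r !(mulrDl, mulrDr, pZl, pZr) !scalerA.
rewrite mulrN mulNr -expr2 sqr_i opprK !scaleNr !scale1r.
rewrite addrACA [X in X + _]addrACA [X in _ + X]addrACA addNr subrr addr0 add0r.
rewrite -!mulr2n -mulrnDl -[(x * u + y * v) *+ 2]scaler_nat scalerA mulVf ?scale1r //.
by rewrite pnatr_eq0.
Qed.

Lemma ch_H_X x : pcomm (ch_H c) (X x) = X x.
Proof.
rewrite ch_HE pcommDl pcommNl pcommDl euler_X pcomm_suml.
have -> : pcomm n%:R (X x) = 0 by rewrite -scaler_nat pcommZl pcomm1l scaler0.
rewrite addr0 -addrA -opprD -big_split big1 ?subr0 // => s sS /=.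
by rewrite pcommZl refl_X // scalerN scalerA mulrC subrr.
Qed.

Lemma ch_H_V u : pcomm (ch_H c) (V u) = - V u.
Proof.
rewrite ch_HE pcommDl pcommNl pcommDl euler_V pcomm_suml.
have -> : pcomm n%:R (V u) = 0 by rewrite -scaler_nat pcommZl pcomm1l scaler0.
rewrite addr0 -addrA -sumrB big1 ?addr0 // => s sS /=.
rewrite pcommZl refl_V // chG_V act_alpha // -scaleN1r chVZ rmorphN1 pZl.
by rewrite scaleN1r !scalerN opprK scalerA mulrC addNr.
Qed.

Lemma ch_H_px a b j : pcomm (ch_H c) (ch_px a b j) = ch_px a b j.
Proof. by rewrite pcommDr !pcommZr !ch_H_X. Qed.

Lemma ch_H_pv a b j : pcomm (ch_H c) (ch_pv a b j) = - ch_pv a b j.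
Proof. by rewrite pcommDr !pcommZr !ch_H_V !scalerN -opprD. Qed.

End CherednikRelations.

(** * Relations in the Clifford algebra *)

Section CliffordRelations.
Variables (R : realType) (n : nat).
Local Notation C := R[i].
Local Notation f := (@cl_f R n).
Local Notation fdag := (@cl_fdag R n).

Let ee j k : pacomm (@cl_e R n j) (cl_e R k) = (2 * (j == k)%:R) *: (1 : clifford R n).
Proof.
have := aclass_rel (cl_anticomm R j k).
by rewrite !(aclassD, aclassM, aclassZ, aclass1).
Qed.

Let flc (a : C) j : clifford R n :=
  2^-1 *: (cl_e R (lshift n j) + a *: cl_e R (rshift n j)).

Let flc_acomm a b j k : pacomm (flc a j) (flc b k) =
  (2^-1 * (1 + a * b) * (j == k)%:R) *: (1 : clifford R n).
Proof.
rewrite !(pacommDl, pacommDr, pacommZl, pacommZr, ee).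
rewrite eq_lshift eq_rshift eq_lrshift eq_rlshift !mulr0 !scale0r !scaler0 addr0 add0r.
rewrite !scalerA -scalerDl scalerA; congr (_ *: _).
have h2 : 2^-1 * 2 = 1 :> C by rewrite mulVf // pnatr_eq0.
by ring: h2.
Qed.

Let fE j : f j = flc (- 'i%C) j. Proof. by rewrite /flc scaleNr. Qed.
Let ii : 'i%C * 'i%C = -1 :> C. Proof. by rewrite -expr2 sqr_i. Qed.

Lemma cl_ff j k : pacomm (f j) (f k) = 0.
Proof. by rewrite !fE flc_acomm mulrNN ii subrr mulr0 mul0r scale0r. Qed.

Lemma cl_dd j k : pacomm (fdag j) (fdag k) = 0.
Proof. by rewrite flc_acomm ii subrr mulr0 mul0r scale0r. Qed.

Lemma cl_df j k : pacomm (fdag j) (f k) = (j == k)%:R *: (1 : clifford R n).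
Proof.
rewrite fE flc_acomm mulrN ii opprK -[1 + 1]/(2%:R) mulVf ?mul1r //.
by rewrite pnatr_eq0.
Qed.

Lemma cl_fd j k : pacomm (f j) (fdag k) = (j == k)%:R *: (1 : clifford R n).
Proof. by rewrite pacommC cl_df eq_sym. Qed.

Definition cl_N : clifford R n := \sum_j fdag j * f j.

Lemma cl_N_d k : pcomm cl_N (fdag k) = fdag k.
Proof.
rewrite pcomm_suml (bigD1 k) //= big1 ?addr0 => [|j /negPf jk].
  rewrite /pcomm -mulrA -[f k * _](addrK (fdag k * f k)) -/(pacomm _ _) cl_fd eqxx.
  have d0 : fdag k * fdag k = 0.
    have := cl_dd k k; rewrite /pacomm -mulr2n -scaler_nat => /eqP.
    by rewrite scaler_eq0 pnatr_eq0 /= => /eqP.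
  by rewrite scale1r mulrBr mulr1 !mulrA d0 mul0r subr0 subr0.
rewrite /pcomm -mulrA -[f j * _](addrK (fdag k * f j)) -/(pacomm _ _) cl_fd jk.
rewrite scale0r add0r mulrN -opprD !mulrA -mulrDl -/(pacomm _ _) cl_dd.
by rewrite mul0r oppr0.
Qed.

Lemma cl_N_f k : pcomm cl_N (f k) = - f k.
Proof.
rewrite pcomm_suml (bigD1 k) //= big1 ?addr0 => [|j /negPf jk].
  have f0 : f k * f k = 0.
    have := cl_ff k k; rewrite /pacomm -mulr2n -scaler_nat => /eqP.
    by rewrite scaler_eq0 pnatr_eq0 /= => /eqP.
  rewrite /pcomm -mulrA f0 mulr0 sub0r mulrA.
  rewrite -[f k * fdag k](addrK (fdag k * f k)) -/(pacomm _ _) cl_fd eqxx.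
  by rewrite scale1r mulrBl mul1r -mulrA f0 mulr0 subr0.
rewrite /pcomm mulrA -[f k * _](addrK (fdag j * f k)) -/(pacomm _ _) cl_fd.
rewrite eq_sym jk scale0r add0r mulNr opprK -!mulrA -mulrDr -/(pacomm _ _) cl_ff.
by rewrite mulr0.
Qed.

End CliffordRelations.

(** * Relations between the generators of u(2|1) *)

Section U21Relations.
Variables (R : realType) (n : nat) (D : reflection_setting R n).
Variable c : rs_gT D -> R[i].
Local Notation C := R[i].
Local Notation H := (cherednik c).
Local Notation Cl := (clifford R n).
Local Notation A := (HC c).
Local Notation S := (rs_refl D).
Local Notation G := (chG c).
Local Notation B := (@rs_B R n D).
Local Notation f := (@cl_f R n).
Local Notation fdag := (@cl_fdag R n).
Implicit Types (a : H) (b : Cl).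

Lemma hc_linl k a a' b : hc (k *: a + a') b = k *: hc a b + hc a' b :> A.
Proof.
rewrite /hc /atensor palg_scaleAl -mulrDl; congr (_ * _).
by rewrite /agen -aclassZ -aclassD; apply: aclass_rel; constructor.
Qed.

Lemma hc_linr k a b b' : hc a (k *: b + b') = k *: hc a b + hc a b' :> A.
Proof.
rewrite /hc /atensor palg_scaleAr -mulrDr; congr (_ * _).
by rewrite /agen -aclassZ -aclassD; apply: aclass_rel; constructor.
Qed.

Lemma hcM a a' b b' : hc (a * a') (b * b') = hc a b * hc a' b' :> A.
Proof.
rewrite /hc /atensor.
have -> : agen (@atens_rel _ _ _ (ch_rel c) (@cl_rel R n)) (inl (a * a')) =
    agen _ (inl a) * agen _ (inl a').
  by rewrite /agen -aclassM; apply: aclass_rel; constructor.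
have -> : agen (@atens_rel _ _ _ (ch_rel c) (@cl_rel R n)) (inr (b * b')) =
    agen _ (inr b) * agen _ (inr b').
  by rewrite /agen -aclassM; apply: aclass_rel; constructor.
rewrite -!mulrA; congr (_ * _); rewrite !mulrA; congr (_ * _).
by rewrite /agen -!aclassM; apply: aclass_rel; constructor.
Qed.

Lemma hc11 : hc 1 1 = 1 :> A.
Proof.
rewrite /hc /atensor -[RHS]mulr1.
by congr (_ * _); rewrite /agen -aclass1; apply: aclass_rel; constructor.
Qed.

Lemma hc0l b : hc 0 b = 0 :> A.
Proof. by have := hc_linl (-1) 0 0 b; rewrite scaler0 addr0 scaleN1r addNr. Qed.
Lemma hc0r a : hc a 0 = 0 :> A.
Proof. by have := hc_linr (-1) a 0 0; rewrite scaler0 addr0 scaleN1r addNr. Qed.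
Lemma hcZl k a b : hc (k *: a) b = k *: hc a b :> A.
Proof. by have := hc_linl k a 0 b; rewrite !addr0 hc0l addr0. Qed.
Lemma hcZr k a b : hc a (k *: b) = k *: hc a b :> A.
Proof. by have := hc_linr k a b 0; rewrite !addr0 hc0r addr0. Qed.
Lemma hcDl a a' b : hc (a + a') b = hc a b + hc a' b :> A.
Proof. by have := hc_linl 1 a a' b; rewrite !scale1r. Qed.
Lemma hcDr a b b' : hc a (b + b') = hc a b + hc a b' :> A.
Proof. by have := hc_linr 1 a b b'; rewrite !scale1r. Qed.
Lemma hcNl a b : hc (- a) b = - hc a b :> A.
Proof. by rewrite -scaleN1r hcZl scaleN1r. Qed.
Lemma hcNr a b : hc a (- b) = - hc a b :> A.
Proof. by rewrite -scaleN1r hcZr scaleN1r. Qed.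
Lemma hc_suml (I : Type) (r : seq I) (P : pred I) F b :
  hc (\sum_(i <- r | P i) F i) b = \sum_(i <- r | P i) hc (F i) b :> A.
Proof.
by apply: (big_morph (fun a => hc a b : A)) => [u v|]; [apply: hcDl | apply: hc0l].
Qed.
Lemma hc_sumr (I : Type) (r : seq I) (P : pred I) F a :
  hc a (\sum_(i <- r | P i) F i) = \sum_(i <- r | P i) hc a (F i) :> A.
Proof.
by apply: (big_morph (fun b => hc a b : A)) => [u v|]; [apply: hcDr | apply: hc0r].
Qed.

(** In all applications the Clifford anticommutator is a scalar, so that this
    reduces a relation between odd generators to the commutators of their
    coefficients. *)
Lemma hc_pacomm a b a' b' : pacomm (hc a b : A) (hc a' b') =
  hc (pcomm a a') (b * b') + hc (a' * a) (pacomm b b').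
Proof.
by rewrite /pcomm /pacomm hcDl hcNl hcDr !hcM addrA subrK.
Qed.

Definition odd_el (a : 'I_n -> H) (b : 'I_n -> Cl) : A := \sum_j hc (a j) (b j).

Lemma odd_pacomm (a : 'I_n -> H) (b : 'I_n -> Cl)
    (a' : 'I_n -> H) (b' : 'I_n -> Cl) :
  pacomm (odd_el a b) (odd_el a' b') =
  \sum_j \sum_k hc (pcomm (a j) (a' k)) (b j * b' k) +
  \sum_j \sum_k hc (a' k * a j) (pacomm (b j) (b' k)).
Proof.
rewrite pacomm_suml -big_split; apply: eq_bigr => j _ /=.
rewrite pacomm_sumr -big_split; apply: eq_bigr => k _ /=.
exact: hc_pacomm.
Qed.

Lemma odd_pcommH h (a : 'I_n -> H) (b : 'I_n -> Cl) e :
  (forall j, pcomm h (a j) = e *: a j) ->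
  pcomm (hc h 1 : A) (odd_el a b) = e *: odd_el a b.
Proof.
move=> ha; rewrite pcommC pcomm_suml scaler_sumr -sumrN; apply: eq_bigr => j _.
rewrite -pcommC /pcomm -!hcM mul1r mulr1 -hcNl -hcDl -/(pcomm _ _).
by rewrite ha hcZl.
Qed.

Lemma odd_pcommN z (a : 'I_n -> H) (b : 'I_n -> Cl) e :
  (forall j, pcomm z (b j) = e *: b j) ->
  pcomm (hc 1 z : A) (odd_el a b) = e *: odd_el a b.
Proof.
move=> zb; rewrite pcommC pcomm_suml scaler_sumr -sumrN; apply: eq_bigr => j _.
rewrite -pcommC /pcomm -!hcM mul1r mulr1 -hcNr -hcDr -/(pcomm _ _).
by rewrite zb hcZr.
Qed.

Local Notation Fp := (Fplus c).
Local Notation Gp := (Fbarplus c).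
Local Notation Fm := (Fminus c).
Local Notation Gm := (Fbarminus c).

Lemma FpE : Fp = odd_el (ch_px c 1 (- 'i%C)) fdag.
Proof. by apply: eq_bigr => j _; rewrite ch_zbarE. Qed.
Lemma GpE : Gp = odd_el (ch_px c 1 'i%C) f.
Proof. by apply: eq_bigr => j _; rewrite ch_zE. Qed.
Let half2 : 2 * 2^-1 = 1 :> C. Proof. by rewrite divff // pnatr_eq0. Qed.
Lemma FmE : Fm = odd_el (ch_pv c 1 (- 'i%C)) fdag.
Proof.
rewrite /Fm scaler_sumr; apply: eq_bigr => j _.
by rewrite ch_zetaE hcZl scalerA half2 scale1r.
Qed.
Lemma GmE : Gm = odd_el (ch_pv c 1 'i%C) f.
Proof.
rewrite /Gm scaler_sumr; apply: eq_bigr => j _.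
by rewrite ch_zetabarE hcZl scalerA half2 scale1r.
Qed.
Let ii : 'i%C * 'i%C = -1 :> C. Proof. by rewrite -expr2 sqr_i. Qed.

Let pacomm0 (a : 'I_n -> H) (b : 'I_n -> Cl)
    (a' : 'I_n -> H) (b' : 'I_n -> Cl) :
  (forall j k, pcomm (a j) (a' k) = 0) ->
  (forall j k, pacomm (b j) (b' k) = 0) -> pacomm (odd_el a b) (odd_el a' b') = 0.
Proof.
move=> aa bb; rewrite odd_pacomm !big1 ?addr0 // => j _; rewrite big1 // => k _.
  by rewrite bb hc0r.
by rewrite aa hc0l.
Qed.

Lemma Fp_Fp : pacomm Fp Fp = 0.
Proof. by rewrite FpE pacomm0 // => *; rewrite ?ch_px_px ?cl_dd. Qed.
Lemma Gp_Gp : pacomm Gp Gp = 0.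
Proof. by rewrite GpE pacomm0 // => *; rewrite ?ch_px_px ?cl_ff. Qed.
Lemma Fm_Fm : pacomm Fm Fm = 0.
Proof. by rewrite FmE pacomm0 // => *; rewrite ?ch_pv_pv ?cl_dd. Qed.
Lemma Gm_Gm : pacomm Gm Gm = 0.
Proof. by rewrite GmE pacomm0 // => *; rewrite ?ch_pv_pv ?cl_ff. Qed.

Let eq_opp0 (V : lmodType C) (v : V) : v = - v -> v = 0.
Proof.
move/eqP; rewrite -addr_eq0 -mulr2n -scaler_nat scaler_eq0 pnatr_eq0 /=.
by move/eqP.
Qed.

(** Used for the anticommutators of two generators with the same Clifford type:
    the commutators of their coefficients do not vanish, but are symmetric. *)
Let hc_sym_anti (a : 'I_n -> 'I_n -> H) (b : 'I_n -> Cl) :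
  (forall j k, a j k = a k j) ->
  (forall j k, pacomm (b j) (b k) = 0) ->
  \sum_j \sum_k hc (a j k) (b j * b k) = 0 :> A.
Proof.
move=> sa bb; apply: eq_opp0; rewrite [LHS]exchange_big -sumrN.
apply: eq_bigr => j _; rewrite -sumrN; apply: eq_bigr => k _.
rewrite sa -hcNr; congr hc; apply/eqP; rewrite -addr_eq0 addrC; apply/eqP.
exact: bb.
Qed.

Lemma Fm_Fp : pacomm Fm Fp = 0.
Proof.
rewrite FmE FpE odd_pacomm hc_sym_anti ?add0r => [|j k|]; last exact: cl_dd.
  by rewrite big1 // => j _; rewrite big1 // => k _; rewrite cl_dd hc0r.
rewrite !ch_pv_px mulrNN ii [1 * 1]mul1r subrr !mulr0 !scale0r; congr (_ - _).
by apply: eq_bigr => s _; congr (_ * _ *: _); apply: mulrC.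
Qed.

Lemma Gm_Gp : pacomm Gm Gp = 0.
Proof.
rewrite GmE GpE odd_pacomm hc_sym_anti ?add0r => [|j k|]; last exact: cl_ff.
  by rewrite big1 // => j _; rewrite big1 // => k _; rewrite cl_ff hc0r.
rewrite !ch_pv_px ii [1 * 1]mul1r subrr !mulr0 !scale0r; congr (_ - _).
by apply: eq_bigr => s _; congr (_ * _ *: _); apply: mulrC.
Qed.

Let sum_delta (F : 'I_n -> 'I_n -> H) :
  \sum_j \sum_k hc (F k j) ((j == k)%:R *: (1 : Cl)) = hc (\sum_j F j j) 1 :> A.
Proof.
rewrite hc_suml; apply: eq_bigr => j _.
rewrite (bigD1 j) //= eqxx scale1r big1 ?addr0 // => k.
by rewrite eq_sym => /negPf ->; rewrite scale0r hc0r.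
Qed.

Lemma Fp_Gp : pacomm Fp Gp = 2 *: Eplus c.
Proof.
rewrite FpE GpE odd_pacomm big1 ?add0r; last first.
  by move=> j _; rewrite big1 // => k _; rewrite ch_px_px hc0l.
under eq_bigr do under eq_bigr do rewrite cl_df.
rewrite sum_delta /Eplus /ch_Eplus hcZl scalerA half2 scale1r; congr hc.
by apply: eq_bigr => j _; rewrite ch_zE ch_zbarE.
Qed.

Lemma Fm_Gm : pacomm Fm Gm = - 2 *: Eminus c.
Proof.
rewrite FmE GmE odd_pacomm big1 ?add0r; last first.
  by move=> j _; rewrite big1 // => k _; rewrite ch_pv_pv hc0l.
under eq_bigr do under eq_bigr do rewrite cl_df.
rewrite sum_delta /Eminus /ch_Eminus hcZl scalerA mulrNN -hcZl scaler_sumr; congr hc.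
apply: eq_bigr => j _; rewrite ch_zetaE ch_zetabarE pZl pZr !scalerA.
have -> : 2 * 2 * (2^-1 * 2^-1) = 1 :> C by rewrite mulrACA half2 mulr1.
rewrite scale1r; apply/eqP; rewrite -subr_eq0; apply/eqP.
exact: (ch_pv_pv c 1 'i%C 1 (- 'i%C) j j).
Qed.

Let sumG : H := \sum_(s in S) c s *: G s.
Let pv := ch_pv c 1 (- 'i%C).
Let pvb := ch_pv c 1 'i%C.
Let px := ch_px c 1 'i%C.
Let pxb := ch_px c 1 (- 'i%C).

Let ks s : C := c s * (2 / B (rs_alpha s) (rs_alpha s))%:C%C.

Let pv_px k j : pcomm (pv k) (px j) = ((j == k)%:R * 2) *: (1 : H) -
  \sum_(s in S) (ks s * (zpair j (rs_alpha s) * zbarpair k (rs_alpha s))) *: G s.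
Proof.
rewrite ch_pv_px mul1r mulNr ii opprK; congr (_ - _); apply: eq_bigr => s _.
by rewrite !mul1r mulNr.
Qed.

Let pvb_pxb k j : pcomm (pvb k) (pxb j) = pcomm (pv j) (px k).
Proof.
rewrite pv_px ch_pv_px mul1r mulrN ii opprK eq_sym; congr (_ - _).
apply: eq_bigr => s _; congr (_ * _ *: _).
by rewrite !mul1r mulNr mulrC.
Qed.

(** The element [Omega] of [Z1] comes from here: the reflection terms of the
    commutators of [zeta] and [z] assemble to [cl_tau s - 1]. *)
Let cross_sum : \sum_k \sum_j hc (pcomm (pv k) (px j)) (fdag k * f j) =
  2 *: hc 1 (cl_N R n) + (Omega c - hc sumG 1) :> A.
Proof.
under eq_bigr do under eq_bigr do rewrite pv_px hcDl.
rewrite -[X in X = _]/(\sum_k \sum_j (_ + _)).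
under eq_bigr do rewrite big_split /=.
rewrite big_split /=; congr (_ + _).
  rewrite hc_sumr scaler_sumr; apply: eq_bigr => k _.
  rewrite (bigD1 k) //= eqxx mul1r hcZl big1 ?addr0 // => j /negPf ->.
  by rewrite mul0r scale0r hc0l.
under eq_bigr do under eq_bigr do rewrite hcNl hc_suml -sumrN.
under eq_bigr do rewrite exchange_big /=.
rewrite exchange_big /= hc_suml -sumrB; apply: eq_bigr => s _.
rewrite [hc (c s *: _) _]hcZl -scalerBr.
have -> : hc (G s) (cl_tau s) - hc (G s) 1 =
    - ((2 / B (rs_alpha s) (rs_alpha s))%:C%C *: hc (G s)
      ((\sum_j zbarpair j (rs_alpha s) *: fdag j) *
       (\sum_k zpair k (rs_alpha s) *: f k))) :> A.
  by rewrite hcDr addrAC subrr add0r hcNr hcZr.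
rewrite scalerN scalerA -/(ks s).
rewrite mulr_suml hc_sumr scaler_sumr -sumrN; apply: eq_bigr => k _.
rewrite mulr_sumr hc_sumr scaler_sumr -sumrN; apply: eq_bigr => j _.
move: (fdag k) (f j) => u v; rewrite pZl pZr !hcZr hcZl !scalerA.
by rewrite [zpair _ _ * _]mulrC.
Qed.

(** On the diagonal the reflection terms add up by
    [\sum_j |z_j(alpha)|^2 = B(alpha, alpha)]. *)
Let diag_sum : hc (\sum_k pcomm (pv k) (px k)) 1 =
  (2 * n%:R) *: (1 : A) - 2 *: hc sumG 1 :> A.
Proof.
under eq_bigr do rewrite pv_px eqxx mul1r.
rewrite sumrB sumr_const card_ord hcDl hcNl -scaler_nat hcZl hcZl hc11 scalerA.
rewrite [n%:R * 2]mulrC; congr (_ - _).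
rewrite exchange_big /= !hc_suml scaler_sumr; apply: eq_bigr => s sS.
rewrite -scaler_suml !hcZl scalerA; congr (_ *: _).
rewrite -mulr_sumr.
have -> : \sum_i zpair i (rs_alpha s) * zbarpair i (rs_alpha s) =
    (B (rs_alpha s) (rs_alpha s))%:C%C.
  rewrite -norm_expand rmorph_sum /=; apply: eq_bigr => j _.
  rewrite /zpair /zbarpair rmorphD !rmorphXn /=.
  have : 'i%C ^+ 2 = -1 :> C by rewrite sqr_i.
  by move=> i2; ring: i2.
rewrite -mulrA -rmorphM /= divfK ?Balpha_neq0 // rmorph_nat.
exact: mulrC.
Qed.

Let H_sub_Z0 : ch_H c - ch_Z0 c = \sum_j px j * pv j + n%:R - sumG.
Proof.
rewrite addrAC [X in X - _]addrAC; congr (_ + _ - _); rewrite -sumrB.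
apply: eq_bigr => j _; rewrite opprB addrACA subrr addr0 ch_zE ch_zetaE pZr.
by rewrite -mulr2n -scaler_nat scalerA half2 scale1r.
Qed.

Let H_add_Z0 : ch_H c + ch_Z0 c = \sum_j pxb j * pvb j + n%:R - sumG.
Proof.
rewrite addrAC [X in X - _]addrAC; congr (_ + _ - _); rewrite -big_split.
apply: eq_bigr => j _ /=; rewrite [_ - _]addrC addrACA subrr add0r.
by rewrite ch_zbarE ch_zetabarE pZr -mulr2n -scaler_nat scalerA half2 scale1r.
Qed.

Let hcn : hc n%:R 1 = n%:R *: (1 : A) :> A.
Proof. by rewrite -[n%:R : H](scaler_nat n) hcZl hc11. Qed.

Let Z2E : 2 *: Z2 c = 2 *: hc 1 (cl_N R n) - n%:R *: (1 : A).
Proof.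
by rewrite /Z2 hcDr hcNr hcZr hc11 scalerBr scalerA mulrC divfK // pnatr_eq0.
Qed.

Lemma Fm_Gp : pacomm Fm Gp = Hop c - Z1 c + 2 *: Z2 c.
Proof.
rewrite FmE GpE odd_pacomm cross_sum.
under [X in _ + X]eq_bigr do under eq_bigr do rewrite cl_df.
rewrite (sum_delta (fun k j => px k * pv j)).
rewrite Z2E /Hop /Z1 opprB [hc (ch_H c) 1 + _]addrCA -[- hc (ch_Z0 c) 1]hcNl.
rewrite -[hc (ch_H c) 1 + _]hcDl H_sub_Z0 !(hcDl, hcNl) hcn.
rewrite [RHS](AC (1*3*2) (5*(1*4)*2*(3*6))) /=.
by rewrite subrr addr0.
Qed.

Lemma Gm_Fp : pacomm Gm Fp = Hop c + Z1 c - 2 *: Z2 c.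
Proof.
rewrite GmE FpE odd_pacomm.
under [X in _ + X]eq_bigr do under eq_bigr do rewrite cl_fd.
rewrite (sum_delta (fun k j => pxb k * pvb j)).
have -> : \sum_j \sum_k hc (pcomm (pvb j) (pxb k)) (f j * fdag k) =
    hc (\sum_k pcomm (pv k) (px k)) 1 -
    \sum_k \sum_j hc (pcomm (pv k) (px j)) (fdag k * f j) :> A.
  rewrite -(sum_delta (fun k j => pcomm (pv k) (px j))) [X in _ - X]exchange_big.
  rewrite -sumrB; apply: eq_bigr => j _; rewrite -sumrB; apply: eq_bigr => k _ /=.
  by rewrite pvb_pxb -cl_fd -hcNr -hcDr /pacomm addrK.
rewrite cross_sum diag_sum.
rewrite Z2E /Hop /Z1 [hc (ch_H c) 1 + (_ - _)]addrA.
rewrite -[hc (ch_H c) 1 + hc _ _]hcDl H_add_Z0 !(hcDl, hcNl) hcn.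
have -> : (2 * n%:R) *: (1 : A) = n%:R *: (1 : A) + n%:R *: (1 : A).
  by rewrite mulr_natl mulr2n scalerDl.
have -> : 2 *: hc sumG 1 = hc sumG 1 + hc sumG 1 :> A by rewrite scaler_nat.
rewrite !opprD !opprK.
rewrite [LHS](AC ((2*2)*(1*2)*1) ((8*1*3*6*(5*2))*(4*7))) /=.
by rewrite addNr addr0.
Qed.

Lemma H_Fp : pcomm (Hop c) Fp = Fp.
Proof.
by rewrite FpE (@odd_pcommH _ _ _ 1) ?scale1r // => j; rewrite scale1r ch_H_px.
Qed.
Lemma H_Gp : pcomm (Hop c) Gp = Gp.
Proof.
by rewrite GpE (@odd_pcommH _ _ _ 1) ?scale1r // => j; rewrite scale1r ch_H_px.
Qed.
Lemma H_Fm : pcomm (Hop c) Fm = - Fm.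
Proof.
by rewrite FmE (@odd_pcommH _ _ _ (-1)) ?scaleN1r // => j; rewrite scaleN1r ch_H_pv.
Qed.
Lemma H_Gm : pcomm (Hop c) Gm = - Gm.
Proof.
by rewrite GmE (@odd_pcommH _ _ _ (-1)) ?scaleN1r // => j; rewrite scaleN1r ch_H_pv.
Qed.

Let N_d k : pcomm (cl_N R n - (n%:R / 2) *: (1 : Cl)) (fdag k) = 1 *: fdag k.
Proof. by rewrite pcommDl pcommNl pcommZl pcomm1l scaler0 subr0 cl_N_d scale1r. Qed.
Let N_f k : pcomm (cl_N R n - (n%:R / 2) *: (1 : Cl)) (f k) = -1 *: f k.
Proof. by rewrite pcommDl pcommNl pcommZl pcomm1l scaler0 subr0 cl_N_f scaleN1r. Qed.

Lemma Z2_Fp : pcomm (Z2 c) Fp = Fp.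
Proof. by rewrite FpE (odd_pcommN _ N_d) scale1r. Qed.
Lemma Z2_Fm : pcomm (Z2 c) Fm = Fm.
Proof. by rewrite FmE (odd_pcommN _ N_d) scale1r. Qed.
Lemma Z2_Gp : pcomm (Z2 c) Gp = - Gp.
Proof. by rewrite GpE (odd_pcommN _ N_f) scaleN1r. Qed.
Lemma Z2_Gm : pcomm (Z2 c) Gm = - Gm.
Proof. by rewrite GmE (odd_pcommN _ N_f) scaleN1r. Qed.

(** Since [Y] squares to zero, it commutes with every anticommutator [X Y + Y X].
    Applied to the anticommutators that contain [Z1], this yields the commutators
    with [Z1] from those with [Hop] and [Z2], without touching [Omega]. *)
Let pcomm_pacomm0 (X Y : A) : pacomm Y Y = 0 -> pcomm (pacomm X Y) Y = 0.
Proof.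
move=> YY0; have YY : Y * Y = 0.
  apply: eq_opp0; apply/eqP; rewrite -addr_eq0; exact/eqP.
rewrite /pcomm mulrDl mulrDr -!mulrA YY mulr0 add0r.
by rewrite !mulrA YY mul0r addr0 subrr.
Qed.

Lemma Z1_Fp : pcomm (Z1 c) Fp = Fp.
Proof.
have := pcomm_pacomm0 Gm Fp_Fp.
rewrite Gm_Fp pcommDl pcommNl pcommZl Z2_Fp pcommDl H_Fp => /eqP.
rewrite subr_eq0 scaler_nat mulr2n => /eqP; exact: addrI.
Qed.
Lemma Z1_Gm : pcomm (Z1 c) Gm = - Gm.
Proof.
have := pcomm_pacomm0 Fp Gm_Gm.
rewrite pacommC Gm_Fp pcommDl pcommNl pcommZl Z2_Gm pcommDl H_Gm => /eqP.
rewrite subr_eq0 scaler_nat mulr2n => /eqP; exact: addrI.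
Qed.
Lemma Z1_Gp : pcomm (Z1 c) Gp = - Gp.
Proof.
have := pcomm_pacomm0 Fm Gp_Gp.
rewrite Fm_Gp pcommDl pcommZl Z2_Gp pcommDl pcommNl H_Gp => /eqP.
rewrite scalerN subr_eq0 scaler_nat mulr2n => /eqP /addrI Z.
by rewrite -[LHS]opprK Z.
Qed.
Lemma Z1_Fm : pcomm (Z1 c) Fm = Fm.
Proof.
have := pcomm_pacomm0 Gp Fm_Fm.
rewrite pacommC Fm_Gp pcommDl pcommZl Z2_Fm pcommDl pcommNl H_Fm => /eqP.
rewrite -opprD addrC subr_eq0 scaler_nat mulr2n => /eqP /esym /addrI.
by [].
Qed.

Let pcommMr (X Y Y' : A) : pcomm X (Y * Y') = pcomm X Y * Y' + Y * pcomm X Y'.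
Proof. by rewrite pcommC pcommMl opprD -mulrN -mulNr -!pcommC addrC. Qed.

Lemma H_Z2 : pcomm (Hop c) (Z2 c) = 0.
Proof. by rewrite /pcomm -!hcM !mul1r !mulr1 subrr. Qed.

Let Z1E : Z1 c = Hop c + 2 *: Z2 c - pacomm Fm Gp.
Proof. by rewrite Fm_Gp opprD addrACA subrr addr0 opprB addrCA subrr addr0. Qed.

Lemma H_Z1 : pcomm (Hop c) (Z1 c) = 0.
Proof.
rewrite Z1E pcommC pcommDl pcommNl pcommDl pcommZl [pcomm (Z2 c) _]pcommC H_Z2.
rewrite oppr0 scaler0 addr0 {1}/pcomm subrr add0r opprK -[LHS]opprK -pcommC.
rewrite pcommDr !pcommMr H_Fm H_Gp mulNr mulrN addNr add0r.
by rewrite subrr oppr0.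
Qed.

Lemma Z2_Z1 : pcomm (Z2 c) (Z1 c) = 0.
Proof.
rewrite Z1E pcommC pcommDl pcommNl pcommDl pcommZl H_Z2.
rewrite add0r {1}/pcomm subrr scaler0 add0r opprK -[LHS]opprK -pcommC.
rewrite pcommDr !pcommMr Z2_Fm Z2_Gp mulNr mulrN addrN add0r.
by rewrite addNr oppr0.
Qed.

End U21Relations.

(** * Representations of u(2|1) and intertwining maps *)

Section U21Rep.
Variables (R : realType) (n : nat) (D : reflection_setting R n).
Variable c : rs_gT D -> R[i].
Local Notation C := R[i].
Local Notation A := (HC c).
Local Notation Fp := (Fplus c).
Local Notation Gp := (Fbarplus c).
Local Notation Fm := (Fminus c).
Local Notation Gm := (Fbarminus c).
Local Notation H := (Hop c).
Local Notation Z1 := (Z1 c).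
Local Notation Z2 := (Z2 c).

Implicit Types X Y : A.

Lemma u21_oddP X : X \in [:: Fp; Gp; Fm; Gm] -> u21_part true X.
Proof. exact: span_base. Qed.

Lemma u21_evenP X : X \in [:: Eplus c; Eminus c; H; Z1; Z2] -> u21_part false X.
Proof. exact: span_base. Qed.

Lemma oddFp : u21_part true Fp. Proof. by apply: u21_oddP; rewrite !inE eqxx. Qed.
Lemma oddGp : u21_part true Gp. Proof. by apply: u21_oddP; rewrite !inE eqxx orbT. Qed.
Lemma oddFm : u21_part true Fm. Proof. by apply: u21_oddP; rewrite !inE eqxx !orbT. Qed.
Lemma oddGm : u21_part true Gm. Proof. by apply: u21_oddP; rewrite !inE eqxx !orbT. Qed.
Lemma evenEp : u21_part false (Eplus c).
Proof. by apply: u21_evenP; rewrite !inE eqxx. Qed.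
Lemma evenEm : u21_part false (Eminus c).
Proof. by apply: u21_evenP; rewrite !inE eqxx !orbT. Qed.
Lemma evenH : u21_part false H.
Proof. by apply: u21_evenP; rewrite !inE eqxx !orbT. Qed.
Lemma evenZ1 : u21_part false Z1.
Proof. by apply: u21_evenP; rewrite !inE eqxx !orbT. Qed.
Lemma evenZ2 : u21_part false Z2.
Proof. by apply: u21_evenP; rewrite !inE eqxx !orbT. Qed.

Lemma u21_partW b X : u21_part b X -> u21 X.
Proof.
by case: b => [X1|X0]; [exists 0, X; split=> //; [exact: span0 | rewrite add0r]
  | exists X, 0; split=> //; [exact: span0 | rewrite addr0]].
Qed.

Lemma u21_lin k X Y : u21 X -> u21 Y -> u21 (k *: X + Y).
Proof.
move=> [X0 [X1 [x0 x1 ->]]] [Y0 [Y1 [y0 y1 ->]]].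
exists (k *: X0 + Y0), (k *: X1 + Y1); split; try exact: span_linear.
by rewrite scalerDr addrACA.
Qed.

Lemma u210 : u21 (0 : A). Proof. by apply: (@u21_partW true); exact: span0. Qed.
Lemma u21Z k X : u21 X -> u21 (k *: X).
Proof. by move=> gX; rewrite -[_ *: _]addr0; apply: u21_lin => //; apply: u210. Qed.
Lemma u21D X Y : u21 X -> u21 Y -> u21 (X + Y).
Proof. by move=> gX gY; rewrite -[X]scale1r; apply: u21_lin. Qed.

Hint Resolve oddFp oddGp oddFm oddGm evenEp evenEm evenH evenZ1 evenZ2 : u21.
Hint Extern 2 (u21 _) => solve [eapply u21_partW; eauto with u21] : u21.

Section Rep.
Variable P : u21_rep c.
Local Notation act := (ur_act (u := P)).
Implicit Types w : ur_W P.

Lemma act_lin X k v w : u21 X -> act X (k *: v + w) = k *: act X v + act X w.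
Proof. exact: ur_act_linr. Qed.
Lemma act0r X : u21 X -> act X 0 = 0.
Proof.
by move=> gX; have := act_lin (-1) 0 0 gX; rewrite scaler0 addr0 scaleN1r addNr.
Qed.
Lemma actZr X k w : u21 X -> act X (k *: w) = k *: act X w.
Proof. by move=> gX; rewrite -[k *: w]addr0 act_lin // act0r // addr0. Qed.
Lemma act0l w : act 0 w = 0.
Proof.
have := ur_act_linl (-1) w u210 u210.
by rewrite scaler0 addr0 scaleN1r addNr.
Qed.
Lemma actZl X k w : u21 X -> act (k *: X) w = k *: act X w.
Proof.
by move=> gX; have := ur_act_linl k w gX u210; rewrite !addr0 act0l addr0.
Qed.
Lemma actDl X Y w : u21 X -> u21 Y -> act (X + Y) w = act X w + act Y w.
Proof. by move=> gX gY; have := ur_act_linl 1 w gX gY; rewrite !scale1r. Qed.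
Lemma actNl X w : u21 X -> act (- X) w = - act X w.
Proof. by move=> gX; rewrite -[- X]scaleN1r actZl // scaleN1r. Qed.

Lemma act_pacomm X Y w : u21_part true X -> u21_part true Y ->
  act X (act Y w) = act (pacomm X Y) w - act Y (act X w).
Proof.
move=> oX oY; have := ur_act_bracket w oX oY.
by rewrite /= expr1 !scaleN1r !opprK => ->; rewrite addrK.
Qed.

Lemma act_pcomm X Y w : u21_part false X -> u21_part true Y ->
  act X (act Y w) = act (pcomm X Y) w + act Y (act X w).
Proof.
move=> eX oY; have := ur_act_bracket w eX oY.
by rewrite /= expr0 !scale1r => ->; rewrite subrK.
Qed.

Let anti0 X Y w : u21_part true X -> u21_part true Y -> pacomm X Y = 0 ->
  act X (act Y w) = - act Y (act X w).
Proof. by move=> oX oY XY; rewrite act_pacomm // XY act0l sub0r. Qed.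

Lemma act_FmFp w : act Fm (act Fp w) = - act Fp (act Fm w).
Proof. by apply: anti0; auto with u21; exact: Fm_Fp. Qed.
Lemma act_GmGp w : act Gm (act Gp w) = - act Gp (act Gm w).
Proof. by apply: anti0; auto with u21; exact: Gm_Gp. Qed.
Lemma act_FmGp w : act Fm (act Gp w) =
  act H w - act Z1 w + 2 *: act Z2 w - act Gp (act Fm w).
Proof.
have gH : u21 H by auto with u21. have gZ1 : u21 Z1 by auto with u21.
have gZ2 : u21 Z2 by auto with u21.
have gN : u21 (- Z1) by rewrite -scaleN1r; apply: u21Z.
rewrite act_pacomm; auto with u21; congr (_ - _).
have gHZ : u21 (H - Z1) by exact: u21D.
have gZ22 : u21 (2 *: Z2) by exact: u21Z.
by rewrite Fm_Gp (actDl _ gHZ gZ22) (actDl _ gH gN) (actNl _ gZ1) (actZl _ _ gZ2).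
Qed.
Lemma act_GmFp w : act Gm (act Fp w) =
  act H w + act Z1 w - 2 *: act Z2 w - act Fp (act Gm w).
Proof.
have gH : u21 H by auto with u21. have gZ1 : u21 Z1 by auto with u21.
have gZ2 : u21 Z2 by auto with u21.
have gZ22 : u21 (2 *: Z2) by exact: u21Z.
have gN : u21 (- (2 *: Z2)) by rewrite -scaleN1r; apply: u21Z.
rewrite act_pacomm; auto with u21; congr (_ - _).
have gHZ : u21 (H + Z1) by exact: u21D.
by rewrite Gm_Fp (actDl _ gHZ gN) (actDl _ gH gZ1) (actNl _ gZ22) (actZl _ _ gZ2).
Qed.
Lemma act_Ep w : act (Eplus c) w = 2^-1 *: (act Fp (act Gp w) + act Gp (act Fp w)).
Proof.
rewrite act_pacomm; auto with u21; rewrite subrK Fp_Gp actZl; auto with u21.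
by rewrite scalerA mulVf ?scale1r // pnatr_eq0.
Qed.
Lemma act_Em w : act (Eminus c) w = - 2^-1 *: (act Fm (act Gm w) + act Gm (act Fm w)).
Proof.
rewrite act_pacomm; auto with u21; rewrite subrK Fm_Gm actZl; auto with u21.
by rewrite scalerA mulrNN mulVf ?scale1r // pnatr_eq0.
Qed.

Let comm_pm e X Y w : u21_part false X -> u21_part true Y ->
  pcomm X Y = e *: Y -> act X (act Y w) = act Y (e *: w + act X w).
Proof.
move=> eX oY XY; have gY := u21_partW oY.
by rewrite act_pcomm // XY actZl // act_lin.
Qed.

Lemma act_H_Fp w : act H (act Fp w) = act Fp (1 *: w + act H w).
Proof. by apply: comm_pm; auto with u21; rewrite H_Fp scale1r. Qed.
Lemma act_H_Gp w : act H (act Gp w) = act Gp (1 *: w + act H w).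
Proof. by apply: comm_pm; auto with u21; rewrite H_Gp scale1r. Qed.
Lemma act_H_Fm w : act H (act Fm w) = act Fm (-1 *: w + act H w).
Proof. by apply: comm_pm; auto with u21; rewrite H_Fm scaleN1r. Qed.
Lemma act_H_Gm w : act H (act Gm w) = act Gm (-1 *: w + act H w).
Proof. by apply: comm_pm; auto with u21; rewrite H_Gm scaleN1r. Qed.
Lemma act_Z1_Fp w : act Z1 (act Fp w) = act Fp (1 *: w + act Z1 w).
Proof. by apply: comm_pm; auto with u21; rewrite Z1_Fp scale1r. Qed.
Lemma act_Z1_Gp w : act Z1 (act Gp w) = act Gp (-1 *: w + act Z1 w).
Proof. by apply: comm_pm; auto with u21; rewrite Z1_Gp scaleN1r. Qed.
Lemma act_Z2_Fp w : act Z2 (act Fp w) = act Fp (1 *: w + act Z2 w).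
Proof. by apply: comm_pm; auto with u21; rewrite Z2_Fp scale1r. Qed.
Lemma act_Z2_Gp w : act Z2 (act Gp w) = act Gp (-1 *: w + act Z2 w).
Proof. by apply: comm_pm; auto with u21; rewrite Z2_Gp scaleN1r. Qed.

(** Stability under [Eplus] and [Eminus] follows, because they are multiples of
    anticommutators of odd generators. *)
Lemma u21_stable (U : subspace (ur_W P)) :
  (forall w, U w -> U (act Fp w)) -> (forall w, U w -> U (act Gp w)) ->
  (forall w, U w -> U (act Fm w)) -> (forall w, U w -> U (act Gm w)) ->
  (forall w, U w -> U (act H w)) -> (forall w, U w -> U (act Z1 w)) ->
  (forall w, U w -> U (act Z2 w)) ->
  forall X w, u21 X -> U w -> U (act X w).
Proof.
move=> UFp UGp UFm UGm UH UZ1 UZ2 X w gX Uw.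
have part_stable b Y : u21_part b Y -> U (act Y w).
  elim=> [|k Y1 Y2 Y1in sY2 IH]; first by rewrite act0l; apply: subspace0.
  have gY1 : u21 Y1 by apply: (@u21_partW b); exact: span_base.
  rewrite ur_act_linl //; last exact: (@u21_partW b).
  apply: subspaceZD => //; case: b Y1in {sY2}; rewrite !inE.
    by case/or4P=> /eqP ->; auto.
  case/or4P=> [/eqP->|/eqP->|/eqP->|/orP[]/eqP->]; auto.
    by rewrite act_Ep; apply/subspaceZ/subspaceD; auto.
  by rewrite act_Em; apply/subspaceZ/subspaceD; auto.
case: gX => X0 [X1 [x0 x1 ->]].
rewrite actDl; [|exact: u21_partW x0|exact: u21_partW x1].
by apply: subspaceD; [apply: part_stable x0 | apply: part_stable x1].
Qed.

Section Generated.
Variable v : ur_W P.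

(** The submodule generated by a lowest weight vector [v]; that the raising
    operators suffice is [gen_stable]. *)
Inductive gen : ur_W P -> Prop :=
| gen_base : gen v
| gen_zero : gen 0
| gen_lin k p q of gen p & gen q : gen (k *: p + q)
| gen_Fp p of gen p : gen (act Fp p)
| gen_Gp p of gen p : gen (act Gp p).

Definition gen_space := Subspace gen_zero gen_lin.

Lemma gen_ind_sub (U : subspace (ur_W P)) : U v ->
  (forall p, gen p -> U p -> U (act Fp p)) ->
  (forall p, gen p -> U p -> U (act Gp p)) -> forall p, gen p -> U p.
Proof.
move=> Uv UF UG p; elim=> // [|k q r _ Uq _ Ur]; first exact: subspace0.
exact: subspaceZD.
Qed.

Variables lambda nu gamma : C.

Definition lowvec :=
  [/\ act Fm v = 0, act Gm v = 0, act H v = lambda *: v, act Z1 v = nu *: v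
    & act Z2 v = gamma *: v].

Hypothesis low_v : lowvec.

Let gZ k p : gen p -> gen (k *: p). Proof. exact: (@subspaceZ _ _ gen_space). Qed.
Let gD p q : gen p -> gen q -> gen (p + q).
Proof. exact: (@subspaceD _ _ gen_space). Qed.
Let gB p q : gen p -> gen q -> gen (p - q).
Proof. exact: (@subspaceB _ _ gen_space). Qed.
Let gN p : gen p -> gen (- p). Proof. by move=> gp; rewrite -scaleN1r; apply: gZ. Qed.

Let preim0 X : u21 X -> gen (act X 0).
Proof. by move=> gX; rewrite act0r //; apply: gen_zero. Qed.

Let preimZD X : u21 X -> forall k q r,
  gen (act X q) -> gen (act X r) -> gen (act X (k *: q + r)).
Proof. by move=> gX k q r gq gr; rewrite act_lin //; apply: gen_lin. Qed.

Let preim X (gX : u21 X) := Subspace (preim0 gX) (preimZD gX).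

Lemma gen_stable X p : u21 X -> gen p -> gen (act X p).
Proof.
have [vFm vGm vH vZ1 vZ2] := low_v.
have gH q : gen q -> gen (act H q).
  have gX' : u21 H by auto with u21.
  apply: (@gen_ind_sub (preim gX')) => /= [|r gr Ur|r gr Ur].
  - by rewrite vH; apply/gZ/gen_base.
  - by rewrite act_H_Fp; apply/gen_Fp/gen_lin.
  - by rewrite act_H_Gp; apply/gen_Gp/gen_lin.
have gZ1 q : gen q -> gen (act Z1 q).
  have gX' : u21 Z1 by auto with u21.
  apply: (@gen_ind_sub (preim gX')) => /= [|r gr Ur|r gr Ur].
  - by rewrite vZ1; apply/gZ/gen_base.
  - by rewrite act_Z1_Fp; apply/gen_Fp/gen_lin.
  - by rewrite act_Z1_Gp; apply/gen_Gp/gen_lin.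
have gZ2 q : gen q -> gen (act Z2 q).
  have gX' : u21 Z2 by auto with u21.
  apply: (@gen_ind_sub (preim gX')) => /= [|r gr Ur|r gr Ur].
  - by rewrite vZ2; apply/gZ/gen_base.
  - by rewrite act_Z2_Fp; apply/gen_Fp/gen_lin.
  - by rewrite act_Z2_Gp; apply/gen_Gp/gen_lin.
apply: (@u21_stable gen_space) => //= q.
- exact: gen_Fp.
- exact: gen_Gp.
- have gX' : u21 Fm by auto with u21.
  apply: (@gen_ind_sub (preim gX')) => /= [|r gr Ur|r gr Ur].
  + by rewrite vFm; apply: gen_zero.
  + by rewrite act_FmFp; apply/gN/gen_Fp.
  + by rewrite act_FmGp; apply/gB/gen_Gp/Ur/gD/gZ/gZ2/gr/gB/gZ1/gr/gH.
- have gX' : u21 Gm by auto with u21.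
  apply: (@gen_ind_sub (preim gX')) => /= [|r gr Ur|r gr Ur].
  + by rewrite vGm; apply: gen_zero.
  + by rewrite act_GmFp; apply/gB/gen_Fp/Ur/gB/gZ/gZ2/gr/gD/gZ1/gr/gH.
  + by rewrite act_GmGp; apply/gN/gen_Gp.
Qed.

Definition raised := span (fun r => exists2 p, gen p & r = act Fp p \/ r = act Gp p).

Lemma gen_split p : gen p -> exists a r, raised r /\ p = a *: v + r.
Proof.
elim=> [||k q r _ [a [q' [Rq ->]]] _ [b [r' [Rr ->]]]|q gq _|q gq _].
- by exists 1, 0; split; [exact: span0 | rewrite scale1r addr0].
- by exists 0, 0; split; [exact: span0 | rewrite scale0r addr0].
- exists (k * a + b), (k *: q' + r'); split; first exact: span_linear.
  by rewrite scalerDr scalerA scalerDl addrACA.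
- exists 0, (act Fp q); split; last by rewrite scale0r add0r.
  by apply: span_base; exists q; auto.
- exists 0, (act Gp q); split; last by rewrite scale0r add0r.
  by apply: span_base; exists q; auto.
Qed.

Let heig (e : nat) :=
  span (fun p => exists d : nat, act H p = (lambda + (e + d)%:R) *: p).

Let heigF X e p : u21 X -> (forall w, act H (act X w) = act X (1 *: w + act H w)) ->
  heig e p -> heig e.+1 (act X p).
Proof.
move=> gX HX; elim=> [|k q r [d Hq] _ IH]; first by rewrite act0r //; exact: span0.
rewrite act_lin //; apply: span_linear => //; apply: span_base; exists d.
rewrite HX Hq -scalerDl actZr //; congr (_ *: _).
by rewrite addSn -addn1 [in RHS]natrD addrCA [1 + _]addrC.
Qed.

Lemma gen_heig p : gen p -> heig 0 p.
Proof.
have [_ _ vH _ _] := low_v.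
have heigS e q : heig e.+1 q -> heig e q.
  by apply: spanS => r [d Hr]; apply: span_base; exists d.+1; rewrite addnS -addSn.
have gFp : u21 Fp by auto with u21. have gGp : u21 Gp by auto with u21.
elim=> [||k q r _ Hq _ Hr|q _ Hq|q _ Hq].
- by apply: span_base; exists 0; rewrite addr0.
- exact: span0.
- exact: span_linear.
- by apply/heigS/heigF => // w; exact: act_H_Fp.
- by apply/heigS/heigF => // w; exact: act_H_Gp.
Qed.

Lemma raised_heig p : raised p -> heig 1 p.
Proof.
have gFp : u21 Fp by auto with u21. have gGp : u21 Gp by auto with u21.
elim=> [|k _ r [q gq [->|->]] _ Hr]; first exact: span0.
  by apply: span_linear => //; apply/heigF/gen_heig => // w; exact: act_H_Fp.
by apply: span_linear => //; apply/heigF/gen_heig => // w; exact: act_H_Gp.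
Qed.

(** All weights of raised vectors are strictly above [lambda]. *)
Lemma raised_low p : raised p -> act H p = lambda *: p -> p = 0.
Proof.
move=> /raised_heig Rp; apply: eig_span0.
  by move=> k u w; apply: act_lin; auto with u21.
apply: spanS Rp => q [d Hq]; apply: span_base.
exists (lambda + (1 + d)%:R) => //.
by rewrite -subr_eq0 addrAC subrr add0r pnatr_eq0.
Qed.

End Generated.

End Rep.

Section ProdRep.
Variables L P : u21_rep c.

Definition prod_act (X : A) (uq : ur_W L * ur_W P) : (ur_W L * ur_W P)%type :=
  (ur_act X uq.1, ur_act X uq.2).

Lemma prod_act_linr X k v w : u21 X ->
  prod_act X (k *: v + w) = k *: prod_act X v + prod_act X w.
Proof. by move=> gX; congr pair; exact: act_lin. Qed.

Lemma prod_act_linl k X Y w : u21 X -> u21 Y ->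
  prod_act (k *: X + Y) w = k *: prod_act X w + prod_act Y w.
Proof. by move=> gX gY; congr pair; exact: ur_act_linl. Qed.

Lemma prod_act_bracket a b X Y w : u21_part a X -> u21_part b Y ->
  prod_act (X * Y - (-1) ^+ (a && b) *: (Y * X)) w =
  prod_act X (prod_act Y w) - (-1) ^+ (a && b) *: prod_act Y (prod_act X w).
Proof. by move=> gX gY; congr pair; exact: ur_act_bracket. Qed.

Definition prod_rep := U21Rep prod_act_linr prod_act_linl prod_act_bracket.

Lemma gen_prod1 w m p : gen (P := prod_rep) (w, m) p -> gen w p.1.
Proof.
elim=> [||k q r _ Gq _ Gr|q _ Gq|q _ Gq] /=;
  by [exact: gen_base | exact: gen_zero | exact: gen_lin | exact: gen_Fp | exact: gen_Gp].
Qed.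

Lemma gen_prod2 w m p : gen (P := prod_rep) (w, m) p -> gen m p.2.
Proof.
elim=> [||k q r _ Gq _ Gr|q _ Gq|q _ Gq] /=;
  by [exact: gen_base | exact: gen_zero | exact: gen_lin | exact: gen_Fp | exact: gen_Gp].
Qed.

Lemma raised_prod1 w m p : raised (P := prod_rep) (w, m) p -> raised w p.1.
Proof.
elim=> [|k e r [q gq E] _ IH] /=; first exact: span0.
apply: span_linear => //; apply: span_base; exists q.1; first exact: gen_prod1 gq.
by case: E => ->; auto.
Qed.

Lemma raised_prod2 w m p : raised (P := prod_rep) (w, m) p -> raised m p.2.
Proof.
elim=> [|k e r [q gq E] _ IH] /=; first exact: span0.
apply: span_linear => //; apply: span_base; exists q.2; first exact: gen_prod2 gq.
by case: E => ->; auto.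
Qed.

Lemma lowvec_prod w m lambda nu gamma :
  lowvec w lambda nu gamma -> lowvec m lambda nu gamma ->
  lowvec (P := prod_rep) (w, m) lambda nu gamma.
Proof.
by move=> [w1 w2 w3 w4 w5] [m1 m2 m3 m4 m5]; split; congr pair.
Qed.

End ProdRep.

Section Intertwiner.
Variables (L P : u21_rep c).

Definition intertwiner (phi : ur_W L -> ur_W P) :=
  (forall k u v, phi (k *: u + v) = k *: phi u + phi v) /\
  (forall X u, u21 X -> phi (ur_act X u) = ur_act X (phi u)).

Hypothesis L_irr : ur_irreducible L.
Variable w : ur_W L.
Hypothesis w_neq0 : w != 0.

Lemma irr_ind (U : subspace (ur_W L)) : U w ->
  (forall X u, u21 X -> U u -> U (ur_act X u)) -> forall u, U u.
Proof.
move=> Uw gU; case: (proj2 L_irr U gU) => // U0.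
by move/eqP: w_neq0; case; apply: U0.
Qed.

Lemma intertwiner_eq phi psi : intertwiner phi -> intertwiner psi ->
  phi w = psi w -> forall u, phi u = psi u.
Proof.
move=> [phil phig] [psil psig] Ew.
have lin0 f : (forall k u v, f (k *: u + v) = k *: f u + f v) -> f 0 = 0 :> ur_W P.
  by move=> fl; have := fl (-1) 0 0; rewrite scaler0 addr0 scaleN1r addNr.
have U0 : phi 0 = psi 0 by rewrite !lin0.
have Ul k u v : phi u = psi u -> phi v = psi v -> phi (k *: u + v) = psi (k *: u + v).
  by move=> Eu Ev; rewrite phil psil Eu Ev.
apply: (@irr_ind (Subspace U0 Ul)) => //= X u gX Eu.
by rewrite phig // psig // Eu.
Qed.

Lemma intertwiner_inj phi : intertwiner phi -> phi w != 0 ->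
  forall u, phi u = 0 -> u = 0.
Proof.
move=> [phil phig] phiw.
have phi0 : phi 0 = 0 by have := phil (-1) 0 0; rewrite scaler0 addr0 scaleN1r addNr.
have Ul k u v : phi u = 0 -> phi v = 0 -> phi (k *: u + v) = 0.
  by move=> Eu Ev; rewrite phil Eu Ev scaler0 addr0.
case: (proj2 L_irr (Subspace phi0 Ul)) => //=.
  by move=> X u gX Eu; rewrite phig // Eu act0r.
by move=> /(_ w) /eqP; rewrite (negPf phiw).
Qed.

Variable h : ur_W P -> ur_W P -> C.
Hypothesis h_herm : is_hermitian h.
Hypothesis h_pos : pos_definite h.
Hypothesis h_Fp : forall p q, h (ur_act Fp p) q = h p (ur_act Gm q).
Hypothesis h_Gp : forall p q, h (ur_act Gp p) q = h p (ur_act Fm q).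

Variables lambda nu gamma : C.

Lemma raised_orth v m r : lowvec m lambda nu gamma -> raised v r -> h r m = 0.
Proof.
move=> [mF mG _ _ _]; elim=> [|k e q [p gp E] _ IH]; first exact: hform0l.
rewrite (hform_linl h_herm) IH addr0.
by case: E => ->; rewrite ?h_Fp ?h_Gp ?mF ?mG (hform0r h_herm) mulr0.
Qed.

(** Raising operators are moved to the other side of the form until only the
    lowest weight vector [m] is left, which is orthogonal to [m'] and to all raised
    vectors. *)
Lemma gen_orth m m' nu' lambda' gamma' p p' :
  lowvec m lambda nu gamma -> lowvec m' lambda' nu' gamma' ->
  h m m' = 0 -> gen m p -> gen m' p' -> h p p' = 0.
Proof.
move=> lm lm' mm' gp; elim: gp p' => [||k q r _ IHq _ IHr|q _ IH|q _ IH] p' gp'.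
- have [a [r [Rr ->]]] := gen_split gp'; apply: (hform_orthC h_herm).
  rewrite (hform_linl h_herm) (raised_orth lm Rr) addr0.
  by rewrite (hform_orthC h_herm mm') mulr0.
- by rewrite (hform0l h_herm).
- by rewrite (hform_linl h_herm) IHq // IHr // mulr0 addr0.
- by rewrite h_Fp IH //; apply: (gen_stable lm') => //; auto with u21.
- by rewrite h_Gp IH //; apply: (gen_stable lm') => //; auto with u21.
Qed.

Hypothesis low_w : lowvec w lambda nu gamma.

(** What lies above [0] has no component along [m], by comparing weights in [L],
    so it is orthogonal to [m]; being stable under the lowering operators, the
    set of such vectors is then orthogonal to everything that is generated by
    [m], in particular to itself. *)
Lemma graph_fun m q : lowvec m lambda nu gamma ->
  gen (P := prod_rep L P) (w, m) (0, q) -> q = 0.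
Proof.
move=> lm g0q; have lwm := lowvec_prod low_w lm.
have qm q' : gen (P := prod_rep L P) (w, m) (0, q') -> h q' m = 0.
  move=> /gen_split[a [r [Rr [E0 ->]]]].
  have a0 : a = 0.
    have /eqP : a *: w = 0; last by rewrite scaler_eq0 (negPf w_neq0) orbF => /eqP.
    have r1 : r.1 = - (a *: w) by apply/eqP; rewrite -addr_eq0 addrC -E0.
    rewrite -[LHS]opprK -r1 (raised_low low_w (raised_prod1 Rr)) ?oppr0 //.
    rewrite r1 -scaleNr actZr; last by auto with u21.
    by have [_ _ -> _ _] := low_w; rewrite !scalerA mulrC.
  by rewrite /= a0 scale0r add0r (raised_orth lm (raised_prod2 Rr)).
have ortho p : gen m p ->
    forall q', gen (P := prod_rep L P) (w, m) (0, q') -> h q' p = 0.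
  have down X q' : u21 X -> gen (P := prod_rep L P) (w, m) (0, q') ->
      gen (P := prod_rep L P) (w, m) (0, ur_act X q').
    move=> gX /(gen_stable lwm gX); rewrite /= /prod_act /= act0r //.
  elim=> [||k r s _ IHr _ IHs|r _ IH|r _ IH] q' gq'.
  - exact: qm.
  - exact: (hform0r h_herm).
  - by rewrite (hformDr h_herm) (hformZr h_herm) IHr // IHs // mulr0 addr0.
  - rewrite (hform_orthC h_herm) // h_Fp (hform_orthC h_herm) //; apply: IH.
    by apply: down => //; auto with u21.
  - rewrite (hform_orthC h_herm) // h_Gp (hform_orthC h_herm) //; apply: IH.
    by apply: down => //; auto with u21.
apply: (hform_eq0 h_pos); apply: ortho => //.
exact: (gen_prod2 g0q).
Qed.

(** The graph of [phi] is the submodule of the product generated by [(w, m)]. *)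
Lemma intertwiner_exists m : lowvec m lambda nu gamma ->
  exists phi, [/\ intertwiner phi, phi w = m & forall u, gen m (phi u)].
Proof.
move=> lm; have lwm := lowvec_prod low_w lm.
pose graph u q := gen (P := prod_rep L P) (w, m) (u, q).
have graph_total u : exists q, graph u q.
  have U0 : exists q, graph 0 q by exists 0; exact: gen_zero.
  have Ul k u1 u2 : (exists q, graph u1 q) -> (exists q, graph u2 q) ->
      exists q, graph (k *: u1 + u2) q.
    by move=> [q1 g1] [q2 g2]; exists (k *: q1 + q2); exact: gen_lin g1 g2.
  apply: (@irr_ind (Subspace U0 Ul)) => [|X u' gX [q gq]] /=.
    by exists m; exact: gen_base.
  by exists (ur_act X q); exact: (gen_stable lwm gX gq).
have [phi phiP] := choice graph_total.
have graph_uniq u q : graph u q -> phi u = q.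
  move=> gq; apply/eqP; rewrite -subr_eq0; apply/eqP/(@graph_fun m) => //.
  have -> : (0, phi u - q) = -1 *: (u, q) + (u, phi u) :> (ur_W L * ur_W P)%type.
    by congr pair; rewrite /= scaleN1r ?addNr // addrC.
  exact: gen_lin (phiP u).
exists phi; split.
- split=> [k u v|X u gX]; apply: graph_uniq.
    exact: gen_lin (phiP u) (phiP v).
  exact: (gen_stable lwm gX (phiP u)).
- by apply: graph_uniq; exact: gen_base.
- by move=> u; exact: gen_prod2 (phiP u).
Qed.

End Intertwiner.

End U21Rep.

(** * The grading of the standard module *)

Section StandardModule.
Variables (R : realType) (n : nat) (D : reflection_setting R n).
Variables (c : rs_gT D -> R[i]) (tau : group_rep R (rs_gT D)).
Local Notation C := R[i].
Local Notation H := (cherednik c).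
Local Notation M := (standard c tau).
Local Notation V := (gr_V tau).
Implicit Types (a : H) (p q : M) (v : V).

Lemma std_actD a b p : std_act (a + b) p = std_act a p + std_act b p.
Proof. by have := std_act_linl 1 a b p; rewrite !scale1r. Qed.
Lemma std_act0l p : std_act (0 : H) p = 0.
Proof.
by have := std_act_linl (-1) (0 : H) 0 p; rewrite scaler0 addr0 scaleN1r addNr.
Qed.
Lemma std_actZ k a p : std_act (k *: a) p = k *: std_act a p.
Proof. by have := std_act_linl k a 0 p; rewrite !addr0 std_act0l addr0. Qed.
Lemma std_actN a p : std_act (- a) p = - std_act a p.
Proof. by rewrite -[- a]scaleN1r std_actZ scaleN1r. Qed.
Lemma std_act_sum (I : Type) (r : seq I) (P : pred I) F p :
  std_act (\sum_(i <- r | P i) F i : H) p = \sum_(i <- r | P i) std_act (F i) p.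
Proof.
apply: (big_morph (fun a : H => std_act a p)) => [a b|]; last exact: std_act0l.
exact: std_actD.
Qed.
Lemma std_actZr a k p : std_act a (k *: p) = k *: std_act a p.
Proof. exact: linearZ. Qed.

Definition monom (xs : seq (dual (rs_E D))) v : M :=
  std_gen (\prod_(x <- xs) chX c x) v.

Lemma monom_cons x xs v : monom (x :: xs) v = std_act (chX c x) (monom xs v).
Proof. by rewrite /monom big_cons std_act_gen. Qed.

Lemma std_deg_monom xs v : std_deg (size xs) (monom xs v).
Proof. by apply: span_base; exists xs => //; exists v. Qed.

Let span_act (P Q : M -> Prop) a : (forall p, P p -> span Q (std_act a p)) ->
  forall p, span P p -> span Q (std_act a p).
Proof.
move=> PQ p; elim=> [|k u w Pu _ IH]; first by rewrite linear0; apply: span0.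
by rewrite std_act_linr; apply: span_linear => //; apply: PQ.
Qed.

Let Mtot := span (fun p => exists xs v, p = monom xs v).

Let Mtot_X x p : Mtot p -> Mtot (std_act (chX c x) p).
Proof.
apply: span_act => q [xs [v ->]]; apply: span_base.
by exists (x :: xs), v; rewrite monom_cons.
Qed.

Let Mtot_G g p : Mtot p -> Mtot (std_act (chG c g) p).
Proof.
apply: span_act => q [xs [v ->]]; elim: xs => [|x xs IH].
  apply: span_base; exists [::], (gr_act tau g v).
  by rewrite /monom std_act_gen big_nil mulr1 -[chG c g]mul1r std_gen_grp.
by rewrite monom_cons -std_actM chG_X std_actM; apply: Mtot_X.
Qed.

Let Mtot_V u p : Mtot p -> Mtot (std_act (chV c u) p).
Proof.
apply: span_act => q [xs [v ->]]; elim: xs => [|x xs IH].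
  rewrite /monom std_act_gen big_nil mulr1 -[chV c u]mul1r std_gen_vec.
  exact: span0.
have mM : Mtot (monom xs v) by apply: span_base; exists xs, v.
rewrite monom_cons -std_actM.
have -> : chV c u * chX c x = pcomm (chV c u) (chX c x) + chX c x * chV c u.
  by rewrite subrK.
rewrite std_actD chV_X; apply: spanD; last by rewrite std_actM; apply: Mtot_X.
rewrite std_actD std_actN std_actZ std_act1 std_act_sum.
apply: spanB; first exact: spanZ.
apply: (big_ind Mtot) => [||s _]; [exact: span0 | exact: spanD |].
by rewrite std_actZ; apply/spanZ/Mtot_G.
Qed.

(** The spanning half of the Poincare-Birkhoff-Witt theorem: [chG] and [chV] can
    be moved to the right, past all [chX], where [V] absorbs them. *)
Lemma monom_span p : span (fun p => exists xs v, p = monom xs v) p.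
Proof.
rewrite -/(Mtot p).
have Mact a q : Mtot q -> Mtot (std_act a q).
  elim/palg_ind: a q => [|[u|x|g]|a b IHa IHb|k a b IHa IHb] q Mq.
  - by rewrite std_act1.
  - exact: Mtot_V.
  - exact: Mtot_X.
  - exact: Mtot_G.
  - by rewrite std_actM; apply/IHa/IHb.
  - by rewrite std_act_linl; apply: span_linear; [exact: IHa | exact: IHb].
elim/pmod_ind: p => [|[a v]|k p q IHp IHq]; first exact: span0.
  rewrite -/(std_gen a v) -[a]mulr1 -std_act_gen; apply: Mact.
  by apply: span_base; exists [::], v; rewrite /monom big_nil.
exact: span_linear.
Qed.

Variable N : C.
Hypothesis tau_N : forall v, \sum_(s in rs_refl D) c s *: gr_act tau s v = N *: v.

(** The eigenvalue of [ch_H] in degree [k]. *)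
Definition H_weight (k : nat) : C := k%:R + n%:R - N.

Lemma H_weightS k : H_weight k.+1 = 1 + H_weight k.
Proof. by rewrite /H_weight -natr1; ring. Qed.

Lemma H_weight_inj k l : H_weight k = H_weight l -> k = l.
Proof.
rewrite /H_weight => /addIr/addIr/eqP; rewrite eqr_nat => /eqP //.
Qed.

Lemma H_monom xs v : std_act (ch_H c) (monom xs v) = H_weight (size xs) *: monom xs v.
Proof.
elim: xs => [|x xs IH].
  rewrite ch_HE !(std_actD, std_actN, std_act_sum).
  have XV x u : std_act (chX c x * chV c u) (monom [::] v) = 0.
    by rewrite /monom std_act_gen big_nil mulr1 std_gen_vec.
  rewrite [X in X + _ + _ - _]big1 => [|j _]; last exact: XV.
  rewrite [X in _ + X + _ - _]big1 => [|j _]; last exact: XV.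
  rewrite !add0r.
  rewrite -[n%:R](scaler_nat n) std_actZ std_act1 /H_weight add0r scalerBl.
  congr (_ - _); under eq_bigr => s _.
    rewrite std_actZ /monom std_act_gen big_nil mulr1 -[chG c s]mul1r std_gen_grp.
    over.
  have std_gen1_lin : forall k v w, std_gen (c := c) 1 (k *: v + w) =
    k *: std_gen 1 v + std_gen 1 w by move=> *; exact: std_gen_linr.
  have std0 : std_gen (c := c) 1 (0 : V) = 0.
    by have := std_gen1_lin (-1) 0 0; rewrite scaler0 addr0 scaleN1r addNr.
  have stdZ k w : std_gen (c := c) 1 (k *: w : V) = k *: std_gen 1 w.
    by rewrite -[k *: w]addr0 std_gen1_lin std0 addr0.
  rewrite /monom big_nil -stdZ -tau_N.
  rewrite (big_morph (fun w : V => std_gen 1 w) (id1 := 0) (op1 := +%R)) //.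
    by apply: eq_bigr => s _; rewrite stdZ.
  by move=> w w' /=; rewrite -[w]scale1r std_gen1_lin !scale1r.
rewrite monom_cons -std_actM.
have -> : ch_H c * chX c x = pcomm (ch_H c) (chX c x) + chX c x * ch_H c.
  by rewrite subrK.
by rewrite ch_H_X std_actD std_actM IH linearZ /= H_weightS scalerDl scale1r.
Qed.

(** Monomials are eigenvectors of [ch_H] and span the module, and different
    degrees have different eigenvalues. *)
Lemma std_degP k p : std_deg k p <-> std_act (ch_H c) p = H_weight k *: p.
Proof.
split.
  elim=> [|e u w [xs <- [v ->]] _ IH]; first by rewrite linear0 scaler0.
  by rewrite std_act_linr IH -/(monom xs v) H_monom scalerDr !scalerA mulrC.
move=> Hp.
have [q [r [pE dq sr]]] : exists q r, [/\ p = q + r, std_deg k q &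
    span (fun u => exists2 b, b != H_weight k & std_act (ch_H c) u = b *: u) r].
  have := monom_span p; clear Hp; elim=> [|e u w [xs [v ->]] _ [q [r [-> dq sr]]]].
    by exists 0, 0; rewrite addr0; split=> //; exact: span0.
  case: (eqVneq (size xs) k) => xsk.
    exists (e *: monom xs v + q), r; rewrite addrA; split=> //.
    by apply: span_linear => //; rewrite -xsk; exact: std_deg_monom.
  exists q, (e *: monom xs v + r); rewrite addrCA; split=> //.
  apply: spanZD => //; exists (H_weight (size xs)); last exact: H_monom.
  by apply: contraNneq xsk => /H_weight_inj ->.
have -> : p = q; last by [].
rewrite pE (_ : r = 0) ?addr0 //; apply: eig_span0 sr _.
  by move=> e u w; exact: std_act_linr.
have Hq : std_act (ch_H c) q = H_weight k *: q.
  elim: dq => [|e u w [xs <- [v ->]] _ IH]; first by rewrite linear0 scaler0.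
  by rewrite std_act_linr IH -/(monom xs v) H_monom scalerDr !scalerA mulrC.
have -> : r = p - q by rewrite pE addrC addKr.
by rewrite linearB /= Hp Hq scalerBr.
Qed.

Lemma std_deg_fin k : exists s : seq M, (forall x, x \in s -> std_deg k x) /\
  forall p, std_deg k p -> span (fun x => x \in s) p.
Proof.
elim: k => [|k [s [sk ks]]].
  exists [seq monom [::] b | b <- vbasis {:V}]; split=> [x /mapP[b _ ->]|p].
    exact: (std_deg_monom [::]).
  elim=> [|e u w [xs /size0nil -> [v ->]] _ IH]; first exact: span0.
  apply: span_linear => //; rewrite -/(monom [::] v) (coord_vbasis (memvf v)).
  elim/big_rec: _ => [|j y _ IHy].
    have -> : monom [::] (0 : V) = 0.
      rewrite /monom big_nil; have := std_gen_linr (c := c) (-1) 1 0 (0 : V).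
      by rewrite scaler0 addr0 scaleN1r addNr.
    exact: span0.
  rewrite /monom std_gen_linr -/(monom [::] y); apply: spanZD => //.
  by apply: map_f; apply: mem_nth; rewrite size_tuple.
pose bs := [seq rs_x D j | j : 'I_n] ++ [seq rs_y D j | j : 'I_n].
exists [seq std_act (chX c b) x | b <- bs, x <- s]; split.
  move=> x /allpairsP[[b y] /= [_ /sk ys ->]].
  elim: ys => [|e u w [xs <- [v ->]] _ IH]; first by rewrite linear0; exact: span0.
  rewrite std_act_linr; apply: spanZD => //; exists (b :: xs) => //.
  by exists v; rewrite -/(monom xs v) -monom_cons.
move=> p; elim=> [|e u w [[|x xs] //= [xsk] [v ->]] _ IH]; first exact: span0.
apply: span_linear => //; rewrite -/(monom (x :: xs) v) monom_cons.
have := ks (monom xs v); rewrite -xsk => /(_ (std_deg_monom _ _)).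
have bX b q : b \in bs -> span (fun x => x \in s) q ->
    span (fun x => x \in [seq std_act (chX c b) x | b <- bs, x <- s])
      (std_act (chX c b) q).
  move=> b_bs; apply: span_act => y ys; apply: span_base.
  by apply/allpairsP; exists (b, y).
move: (monom xs v) => q sq; rewrite chX_expand std_actD !std_act_sum.
apply: spanD; apply: span_sum => j; rewrite std_actZ; apply/spanZ/bX => //.
  by rewrite mem_cat map_f ?mem_enum.
by rewrite mem_cat orbC map_f ?mem_enum.
Qed.

End StandardModule.

(** * The module K and its Hermitian form *)

Section SpinModule.
Variables (R : realType) (n : nat) (D : reflection_setting R n).
Variables (c : rs_gT D -> R[i]) (tau : group_rep R (rs_gT D)).
Local Notation C := R[i].
Local Notation H := (cherednik c).
Local Notation A := (HC c).
Local Notation M := (standard c tau).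
Local Notation K := (Kmod c tau).
Local Notation Kact := (@K_act R n D c tau).
Implicit Types p q : K.

Lemma K_actBl (X Y : A) e p : Kact (X - e *: Y) p = Kact X p - e *: Kact Y p.
Proof.
have -> : X - e *: Y = - e *: Y + X by rewrite scaleNr addrC.
by rewrite K_act_linl scaleNr addrC.
Qed.

Lemma K_act_bracket a b (X Y : A) p : u21_part a X -> u21_part b Y ->
  Kact (X * Y - (-1) ^+ (a && b) *: (Y * X)) p =
  Kact X (Kact Y p) - (-1) ^+ (a && b) *: Kact Y (Kact X p).
Proof. by move=> _ _; rewrite K_actBl !K_actM. Qed.

Definition K_rep : u21_rep c := @U21Rep R n D c K Kact
  (fun X k v w _ => K_act_linr X k v w)
  (fun k X Y w _ _ => K_act_linl k X Y w) K_act_bracket.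

Lemma K_act_sum (I : Type) (r : seq I) (P : pred I) (F : I -> A) p :
  Kact (\sum_(i <- r | P i) F i) p = \sum_(i <- r | P i) Kact (F i) p.
Proof.
have K0 : Kact 0 p = 0.
  by have := K_act_linl (-1) (0 : A) 0 p; rewrite scaler0 addr0 scaleN1r addNr.
apply: (big_morph (fun X : A => Kact X p)) => [X Y|]; last exact: K0.
by have := K_act_linl 1 X Y p; rewrite !scale1r.
Qed.

Lemma K_act_even (a : H) p I : Kact (hc a 1) p I = std_act a (p I).
Proof. by rewrite K_act_hc cl_act1. Qed.

Lemma cl_act_sum (I : Type) (r : seq I) (P : pred I) (F : I -> clifford R n) p :
  cl_act (\sum_(i <- r | P i) F i) p = \sum_(i <- r | P i) cl_act (F i) p.
Proof.
apply: (big_morph (fun X => cl_act X p)) => [X Y|]; last exact: cl_act0.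
exact: cl_actD.
Qed.

Lemma K_act_Z2 p I : Kact (Z2 c) p I = (#|I|%:R - n%:R / 2) *: p I.
Proof.
rewrite K_act_hc std_act1 cl_actD -scaleNr cl_actZ cl_act1 cl_act_sum.
rewrite ffunE sum_ffunE ffunE scalerBl scaleNr; congr (_ - _).
transitivity (\sum_(j in I) p I).
  rewrite [RHS]big_mkcond; apply: eq_bigr => j _.
  rewrite cl_actM cl_act_f cl_act_fdag !ffunE; case: ifP => // jI.
  rewrite !inE eqxx /= scalerA setD1K // spin_signD // ltnn mul1r.
  by rewrite spin_sign2 scale1r.
by rewrite sumr_const scaler_nat.
Qed.

Lemma K_Z2P (l : nat) p : Kact (Z2 c) p = (l%:R - n%:R / 2) *: p <->
  forall I : {set 'I_n}, #|I| != l -> p I = 0.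
Proof.
split=> [Zp I Il | p0].
  have := congr1 (fun q : K => q I) Zp; rewrite K_act_Z2 ffunE => /eqP.
  rewrite -subr_eq0 -scalerBl opprB addrA subrK scaler_eq0 subr_eq0 eqr_nat.
  by rewrite (negPf Il) => /eqP.
apply/ffunP=> I; rewrite K_act_Z2 ffunE; case: (eqVneq #|I| l) => [->//|/p0 ->].
by rewrite !scaler0.
Qed.

Lemma K_Z2_eig g p : p != 0 -> Kact (Z2 c) p = g *: p ->
  exists2 l : nat, (l <= n)%N & g = l%:R - n%:R / 2.
Proof.
move=> p0 Zp; have [I pI] : exists I, p I != 0.
  apply/existsP; apply: contraR p0 => /existsPn p0; apply/eqP/ffunP => I.
  by rewrite ffunE; apply/eqP; rewrite -[_ == _]negbK p0.
exists #|I|; first by rewrite -[X in (_ <= X)%N](card_ord n) max_card.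
have := congr1 (fun q : K => q I) Zp; rewrite K_act_Z2 ffunE => /eqP.
by rewrite -subr_eq0 -scalerBl scaler_eq0 (negPf pI) orbF subr_eq0 => /eqP.
Qed.

Variable N : C.
Hypothesis tau_N : forall v, \sum_(s in rs_refl D) c s *: gr_act tau s v = N *: v.
Local Notation lam := (@H_weight R n N).

Lemma K_HP k p : Kact (Hop c) p = lam k *: p <-> forall I, std_deg k (p I).
Proof.
split=> [Hp I | pk].
  apply/(std_degP tau_N).
  by have := congr1 (fun q : K => q I) Hp; rewrite K_act_even ffunE.
by apply/ffunP=> I; rewrite K_act_even ffunE; apply/(std_degP tau_N).
Qed.

Definition single (J : {set 'I_n}) (m : M) : K := [ffun I => if I == J then m else 0].

Lemma single_lin J k u v : single J (k *: u + v) = k *: single J u + single J v.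
Proof. by apply/ffunP=> I; rewrite !ffunE; case: ifP; rewrite ?scaler0 ?addr0. Qed.

Lemma single0 J : single J 0 = 0.
Proof. by apply/ffunP=> I; rewrite !ffunE; case: ifP. Qed.

Lemma sum_single p : p = \sum_J single J (p J).
Proof.
apply/ffunP=> I; rewrite sum_ffunE (bigD1 I) //= ffunE eqxx big1 ?addr0 //.
by move=> J; rewrite ffunE eq_sym => /negPf ->.
Qed.

Lemma span_single (P : M -> Prop) (Q : K -> Prop) J :
  (forall m, P m -> span Q (single J m)) ->
  forall m, span P m -> span Q (single J m).
Proof.
move=> PQ m; elim=> [|k u v Pu _ IH]; first by rewrite single0; exact: span0.
by rewrite single_lin; apply: span_linear => //; apply: PQ.
Qed.

Lemma K_H_single k J m : std_deg k m -> Kact (Hop c) (single J m) = lam k *: single J m.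
Proof.
move=> km; apply/K_HP => I; rewrite ffunE; case: ifP => // _; exact: span0.
Qed.

Lemma K_H_span p : span (fun q => exists k, Kact (Hop c) q = lam k *: q) p.
Proof.
rewrite (sum_single p); apply: span_sum => J.
apply: span_single (monom_span (p J)) => m [xs [v ->]]; apply: span_base.
by exists (size xs); apply: K_H_single; exact: std_deg_monom.
Qed.

Lemma K_H_fin k : exists s : seq K,
  (forall x, x \in s -> Kact (Hop c) x = lam k *: x) /\
  forall p, Kact (Hop c) p = lam k *: p -> span (fun x => x \in s) p.
Proof.
have [s [sk ks]] := std_deg_fin c tau k.
exists [seq single J x | J <- enum {set 'I_n}, x <- s]; split.
  by move=> x /allpairsP[[J m] /= [_ /sk ms ->]]; apply: K_H_single.
move=> p /K_HP pk; rewrite (sum_single p); apply: span_sum => J.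
apply: span_single (ks _ (pk J)) => m ms; apply: span_base.
by apply/allpairsP; exists (J, m); rewrite mem_enum.
Qed.

(** The eigenvalue would be that of degree -1. *)
Lemma K_H_neg p : Kact (Hop c) p = (n%:R - N - 1) *: p -> p = 0.
Proof.
apply: eig_span0; first by move=> k u v; exact: K_act_linr.
apply: spanS (K_H_span p) => q [k Hq]; apply: span_base; exists (lam k) => //.
rewrite -subr_eq0.
have -> : lam k - (n%:R - N - 1) = k.+1%:R by rewrite /H_weight -natr1; ring.
by rewrite pnatr_eq0.
Qed.

(** [Eminus] is a multiple of the anticommutator of [Fminus] and [Fbarminus], and
    the degrees in [harmonic] are eigenvalues of [Hop] and [Z2]. *)
Lemma MultP k l nu p : multiplicity k l nu p <->
  lowvec (P := K_rep) p (lam k) nu (l%:R - n%:R / 2).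
Proof.
split=> [[[pkl Zp] Fp Gp] | [Fp Gp Hp Zp Z2p]].
  split=> //=.
    apply/K_HP => I; have := pkl I; case: ifP => _ [] //.
    by move=> ->; exact: span0.
  by apply/K_Z2P => I Il; have := pkl I; rewrite (negPf Il).
split=> //; split=> // I; case: ifP => [_ | /negbT Il]; last by move/K_Z2P: Z2p => ->.
split; first by move/K_HP: Hp.
have := act_Em (P := K_rep) p; rewrite Fp Gp.
rewrite (act0r _ (u21_partW (oddFm c))) (act0r _ (u21_partW (oddGm c))).
move=> Emp; have := congr1 (fun q : K => q I) Emp.
by rewrite addr0 scaler0 K_act_even ffunE.
Qed.

Section Form.
Variables (star : H -> H) (beta : M -> M -> C).
Hypothesis star_ok : is_star star.
Hypothesis beta_ok : contravariant_form star beta.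

Let h := K_form beta.

Lemma K_formE p q : h p q = \sum_I beta (p I) (q I).
Proof.
apply: eq_bigr => I _; rewrite (bigD1 I) //= big1 ?addr0.
  rewrite /spin_form (bigD1 I) //= big1 ?addr0 => [|J /negPf JI].
    by rewrite !ffunE eqxx mul1r rmorph1 mulr1.
  by rewrite !ffunE JI mul0r.
move=> J JI; rewrite /spin_form big1 ?mulr0 // => I' _; rewrite !ffunE.
by case: (eqVneq I' I) => [->|_]; rewrite ?mul0r // eq_sym (negPf JI) rmorph0 mulr0.
Qed.

Lemma K_form_herm : is_hermitian h.
Proof.
have [[bl bC] _ _ _] := beta_ok; split=> [k p q r|p q]; rewrite !K_formE.
  by rewrite mulr_sumr -big_split; apply: eq_bigr => I _; rewrite !ffunE bl.
by rewrite rmorph_sum; apply: eq_bigr => I _; exact: bC.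
Qed.

Lemma K_form_mul j p q : h (spin_mul j p) q = h p (spin_der j q).
Proof.
have [bh _ _ _] := beta_ok.
pose jin (I : {set 'I_n}) := j \in I.
rewrite !K_formE (bigID jin) /= addrC big1 ?add0r; last first.
  by move=> I; rewrite /jin => /negPf jI; rewrite ffunE jI (hform0l bh).
rewrite [RHS](bigID jin) /= [X in _ = X + _]big1 ?add0r; last first.
  by move=> I; rewrite /jin => jI; rewrite ffunE jI (hform0r bh).
rewrite (reindex_onto (fun I : {set 'I_n} => j |: I) (fun I => I :\ j)) /=; last first.
  by move=> I jI; rewrite setD1K.
apply: eq_big => [I | I /andP[jI /eqP IE]].
  rewrite /jin setU11 /=; case jI: (j \in I); last by rewrite setU1K ?jI ?eqxx.
  by apply/eqP => /setP/(_ j); rewrite !inE eqxx jI.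
have {}jI : j \notin I by rewrite -IE !inE eqxx.
rewrite !ffunE setU11 (negPf jI) setU1K // spin_signU // ltnn mul1r.
by rewrite (hformZl bh) (hformZr bh) rmorphXn /= rmorphN1.
Qed.

Lemma K_act_d a j p : Kact (hc a (cl_fdag R j)) p =
  spin_mul j (Kact (hc a 1) p).
Proof.
apply/ffunP=> I; rewrite K_act_hc cl_act_fdag !ffunE; case: ifP => _.
  by rewrite K_act_even std_actZr.
by rewrite linear0.
Qed.

Lemma K_act_f a j p : Kact (hc a (cl_f R j)) p =
  Kact (hc a 1) (spin_der j p).
Proof. by apply/ffunP=> I; rewrite K_act_hc cl_act_f K_act_even. Qed.

Lemma K_form_even a p q : h (Kact (hc a 1) p) q = h p (Kact (hc (star a) 1) q).
Proof.
have [_ _ _ ba] := beta_ok.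
by rewrite !K_formE; apply: eq_bigr => I _; rewrite !K_act_even ba.
Qed.

Lemma K_form_odd a j p q :
  h (Kact (hc a (cl_fdag R j)) p) q = h p (Kact (hc (star a) (cl_f R j)) q).
Proof.
by rewrite K_act_d K_form_mul K_form_even -K_act_f.
Qed.

End Form.

End SpinModule.

(** * The decomposition *)

Section Lifts.
Variables (K : fieldType) (W : lmodType K).

Lemma pmod_lift X (rel : lterm K X -> lterm K X -> Prop) (f : X -> W) :
  (forall s t, rel s t -> leval f s = leval f t) ->
  exists g : {linear pmod rel -> W}, forall x, g (pgen rel x) = f x.
Proof.
move=> frel.
pose g : {linear pmod rel -> W} := HB.pack (plift (rel := rel) f)
  (GRing.isLinear.Build K (pmod rel) W *:%R (plift (rel := rel) f) (plift_linear frel)).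
by exists g => x; exact: plift_gen.
Qed.

Lemma tens_lift (U V : lmodType K) (f : U -> V -> W) :
  (forall k u u' v, f (k *: u + u') v = k *: f u v + f u' v) ->
  (forall k u v v', f u (k *: v + v') = k *: f u v + f u v') ->
  exists g : {linear tens U V -> W}, forall u v, g (tensor u v) = f u v.
Proof.
move=> fl fr.
have [_ _ [k u u' v|k u v v']|g gE] :=
  @pmod_lift _ (@tens_rel K U V) (fun uv => f uv.1 uv.2).
- exact: fl.
- exact: fr.
by exists g => u v; exact: gE.
Qed.

Lemma dsum_lift (I : Type) (V : I -> lmodType K) (f : forall i, {linear V i -> W}) :
  exists g : {linear dsum V -> W}, forall i v, g (dsum_in v) = f i v.
Proof.
have [_ _ [i k u v]|g gE] := @pmod_lift _ (dsum_rel (W := V))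
    (fun iv => f (projT1 iv) (projT2 iv)).
  exact: linearP.
by exists g => i v; exact: gE.
Qed.

Lemma dsum_in_lin (I : Type) (V : I -> lmodType K) i k (u v : V i) :
  dsum_in (k *: u + v) = k *: dsum_in u + dsum_in v.
Proof. by rewrite /dsum_in /pgen -lclassZ -lclassD; apply: lclass_rel; constructor. Qed.

Lemma tensor_linl (U V : lmodType K) k (u u' : U) (v : V) :
  tensor (k *: u + u') v = k *: tensor u v + tensor u' v.
Proof. by rewrite /tensor /pgen -lclassZ -lclassD; apply: lclass_rel; constructor. Qed.

Lemma tensor_linr (U V : lmodType K) k (u : U) (v v' : V) :
  tensor u (k *: v + v') = k *: tensor u v + tensor u v'.
Proof. by rewrite /tensor /pgen -lclassZ -lclassD; apply: lclass_rel; constructor. Qed.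

End Lifts.

Section Decomposition.
Variables (R : realType) (n : nat) (D : reflection_setting R n).
Variables (c : rs_gT D -> R[i]) (tau : group_rep R (rs_gT D)).
Local Notation C := R[i].
Local Notation H := (cherednik c).
Local Notation A := (HC c).
Local Notation M := (standard c tau).
Local Notation K := (Kmod c tau).
Local Notation Kact := (@K_act R n D c tau).
Implicit Types p q : K.
Local Notation Fp := (Fplus c).
Local Notation Gp := (Fbarplus c).
Local Notation Fm := (Fminus c).
Local Notation Gm := (Fbarminus c).

Variable N : C.
Hypothesis tau_N : forall v, \sum_(s in rs_refl D) c s *: gr_act tau s v = N *: v.
Local Notation lam := (@H_weight R n N).
Local Notation gam l := (l%:R - n%:R / 2 : C).

Variables (star : H -> H) (beta : M -> M -> C).
Hypothesis star_ok : is_star star.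
Hypothesis beta_ok : contravariant_form star beta.
Hypothesis h_pos : unitarisable beta.

Local Notation h := (K_form beta).
Let h_herm := K_form_herm beta_ok.

Let h_suml (I : finType) (F : I -> K) q : h (\sum_i F i) q = \sum_i h (F i) q.
Proof.
apply: (big_morph (fun p => h p q)) => [p p'|]; last exact: (hform0l h_herm).
exact: (hformDl h_herm).
Qed.

Let h_sumr (I : finType) (F : I -> K) q : h q (\sum_i F i) = \sum_i h q (F i).
Proof.
apply: (big_morph (h q)) => [p p'|]; last exact: (hform0r h_herm).
exact: (hformDr h_herm).
Qed.

Let star_px a b j : star (ch_px c a b j) = ch_pv c a^* b^* j.
Proof.
have [sl _ _ /(_ j)[_ sx _ sy] _] := star_ok.
have s0 : star 0 = 0.
  by have := sl (-1) 0 0; rewrite scaler0 addr0 rmorphN1 scaleN1r addNr.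
by rewrite /ch_px sl sx -[b *: _]addr0 sl sy s0 addr0.
Qed.

Let conj_i : ('i%C : C)^* = - 'i%C. Proof. exact: conjCi. Qed.
Let conj_Ni : (- 'i%C : C)^* = 'i%C.
Proof.
rewrite -[LHS]opprK -rmorphN opprK -[RHS]opprK; congr (- _); exact: conj_i.
Qed.

Lemma h_Fp p q : h (Kact Fp p) q = h p (Kact Gm q).
Proof.
rewrite FpE GmE /odd_el !K_act_sum h_suml h_sumr; apply: eq_bigr => j _.
by rewrite (K_form_odd beta_ok) star_px rmorph1 conj_Ni.
Qed.

Lemma h_Gp p q : h (Kact Gp p) q = h p (Kact Fm q).
Proof.
have [_ _ starK _ _] := star_ok.
rewrite GpE FmE /odd_el !K_act_sum h_suml h_sumr; apply: eq_bigr => j _.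
rewrite (hformC h_herm) -[ch_px c _ _ _]starK -(K_form_odd beta_ok) -(hformC h_herm).
by rewrite star_px rmorph1 conj_i.
Qed.

Let sym (T : K -> K) := forall p q, h (T p) q = h p (T q).

Let h_FmGp p q : h (Kact Fm (Kact Gp p)) q = h p (Kact Fm (Kact Gp q)).
Proof. by rewrite -h_Gp (hformC h_herm) -h_Gp -(hformC h_herm). Qed.
Let h_GpFm p q : h (Kact Gp (Kact Fm p)) q = h p (Kact Gp (Kact Fm q)).
Proof. by rewrite h_Gp (hformC h_herm (Kact _ q)) -h_Gp -(hformC h_herm). Qed.
Let h_GmFp p q : h (Kact Gm (Kact Fp p)) q = h p (Kact Gm (Kact Fp q)).
Proof. by rewrite -h_Fp (hformC h_herm) -h_Fp -(hformC h_herm). Qed.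
Let h_FpGm p q : h (Kact Fp (Kact Gm p)) q = h p (Kact Fp (Kact Gm q)).
Proof. by rewrite h_Fp (hformC h_herm (Kact _ q)) -h_Fp -(hformC h_herm). Qed.

(** [Z2] is diagonal with real entries in the monomial basis of the spinors.  The
    symmetry of [Hop] and [Z1] follows from it and from the adjointness of the odd
    generators, since the product of an odd generator with its adjoint is
    symmetric. *)
Lemma sym_Z2 p q : h (Kact (Z2 c) p) q = h p (Kact (Z2 c) q).
Proof.
have [bh _ _ _] := beta_ok.
rewrite !K_formE; apply: eq_bigr => I _; rewrite !K_act_Z2 (hformZl bh) (hformZr bh).
by congr (_ * _); rewrite rmorphB rmorphM fmorphV !rmorph_nat.
Qed.

Let Hact2 p : 2 *: Kact (Hop c) p =
  (Kact Fm (Kact Gp p) + Kact Gp (Kact Fm p)) +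
  (Kact Gm (Kact Fp p) + Kact Fp (Kact Gm p)).
Proof.
have := act_FmGp (P := K_rep c tau) p; have := act_GmFp (P := K_rep c tau) p.
rewrite /= => -> ->; rewrite !subrK.
move: (Kact (Hop c) p) (Kact (Z1 c) p) (2 *: Kact (Z2 c) p) => x y z.
rewrite [RHS](AC (3*3) ((1*4)*(2*5)*(3*6))) /=.
by rewrite addNr subrr !addr0 scaler_nat mulr2n.
Qed.

Lemma sym_H p q : h (Kact (Hop c) p) q = h p (Kact (Hop c) q).
Proof.
have two : (2 : C) != 0 by rewrite pnatr_eq0.
have two_real : (2 : C)^* = 2 by rewrite rmorph_nat.
apply: (mulfI two); rewrite -(hformZl h_herm) -[X in _ = X * _]two_real.
rewrite -(hformZr h_herm) !Hact2 !(hformDl h_herm) !(hformDr h_herm).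
by rewrite h_FmGp h_GpFm h_GmFp h_FpGm.
Qed.

Let Z1act p : Kact (Z1 c) p = Kact (Hop c) p + 2 *: Kact (Z2 c) p -
  (Kact Fm (Kact Gp p) + Kact Gp (Kact Fm p)).
Proof.
have := act_FmGp (P := K_rep c tau) p; rewrite /= => ->; rewrite subrK.
move: (Kact (Hop c) p) (Kact (Z1 c) p) (2 *: Kact (Z2 c) p) => x y z.
by rewrite [x - y + z]addrAC opprB [RHS]addrCA subrr addr0.
Qed.

Lemma sym_Z1 p q : h (Kact (Z1 c) p) q = h p (Kact (Z1 c) q).
Proof.
rewrite !Z1act (hformBl h_herm) !(hformDl h_herm) (hformZl h_herm).
rewrite -scaleN1r !(hformDr h_herm) !(hformZr h_herm) !(hformDr h_herm).
by rewrite h_FmGp h_GpFm sym_Z2 sym_H rmorph_nat rmorphN1 mulN1r.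
Qed.

Lemma sym_eig_orth (T : K -> K) a b p q : sym T ->
  T p = a *: p -> T q = b *: q -> a != b -> h p q = 0.
Proof.
move=> sT Tp Tq ab; case: (eqVneq q 0) => [->|q0]; first exact: (hform0r h_herm).
have br : b^* = b.
  have := sT q q; rewrite Tq (hformZl h_herm) (hformZr h_herm) => /mulIf <- //.
  by rewrite gt_eqF // h_pos.
have := sT p q; rewrite Tp Tq (hformZl h_herm) (hformZr h_herm) br => /eqP.
by rewrite -subr_eq0 -mulrBl mulf_eq0 subr_eq0 (negPf ab) => /eqP.
Qed.

Local Notation low := (lowvec (P := K_rep c tau)).

Definition low_space (k : nat) p :=
  [/\ Kact Fm p = 0, Kact Gm p = 0 & Kact (Hop c) p = lam k *: p].

Lemma low_space0 k : low_space k 0.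
Proof. by split; rewrite K_act0 ?scaler0. Qed.

Lemma low_spaceZD k e p q : low_space k p -> low_space k q -> low_space k (e *: p + q).
Proof.
move=> [p1 p2 p3] [q1 q2 q3].
split; rewrite K_act_linr ?p1 ?p2 ?q1 ?q2 ?scaler0 ?addr0 //.
by rewrite p3 q3 scalerDr !scalerA mulrC.
Qed.

Lemma low_space_Z k X p :
  (forall q, Kact Fm q = 0 -> Kact Fm (Kact X q) = 0) ->
  (forall q, Kact Gm q = 0 -> Kact Gm (Kact X q) = 0) ->
  pcomm (Hop c) X = 0 ->
  low_space k p -> low_space k (Kact X p).
Proof.
move=> XF XG HX [p1 p2 p3]; split; [exact: XF | exact: XG |].
have /eqP := HX; rewrite subr_eq0 => /eqP HX'.
rewrite -K_actM HX' K_actM p3.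
by rewrite -[lam k *: p]addr0 K_act_linr K_act0 addr0.
Qed.

Let commute0 (X Y : A) e p : pcomm X Y = e *: Y ->
  Kact Y p = 0 -> Kact Y (Kact X p) = 0.
Proof.
move=> /eqP; rewrite subr_eq addrC -subr_eq => /eqP E Yp.
by rewrite -K_actM -E K_actBl K_actM Yp K_act0 scaler0 subr0.
Qed.

Lemma low_space_Z1 k p : low_space k p -> low_space k (Kact (Z1 c) p).
Proof.
apply: low_space_Z => [q|q|]; last exact: H_Z1.
  by apply: (@commute0 _ _ 1); rewrite Z1_Fm scale1r.
by apply: (@commute0 _ _ (-1)); rewrite Z1_Gm scaleN1r.
Qed.

Lemma low_space_Z2 k p : low_space k p -> low_space k (Kact (Z2 c) p).
Proof.
apply: low_space_Z => [q|q|]; last exact: H_Z2.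
  by apply: (@commute0 _ _ 1); rewrite Z2_Fm scale1r.
by apply: (@commute0 _ _ (-1)); rewrite Z2_Gm scaleN1r.
Qed.

(** [Z2] is diagonalised first, then [Z1] on each of its eigenspaces. *)
Lemma low_span k p : low_space k p ->
  span (fun q => exists2 l : nat, (l <= n)%N & exists nu, low q (lam k) nu (gam l)) p.
Proof.
move=> lp; have [s [_ ks]] := K_H_fin tau_N k.
pose U := Subspace (low_space0 k) (@low_spaceZD k).
have Us u : U u -> span (fun x => x \in s) u by case=> _ _; exact: ks.
have := @selfadjoint_eig _ _ _ h_herm h_pos (Kact (Z2 c)) U
  (fun e u v => K_act_linr (Z2 c) e u v) (@low_space_Z2 k)
  (fun u v _ _ => sym_Z2 u v) s p Us lp.
elim=> [|e u w [Uu [g Zu]] _ IH]; first exact: span0.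
apply: span_linear => // {w IH}; case: (eqVneq u 0) => [->|u0]; first exact: span0.
have [l ln gE] := K_Z2_eig u0 Zu.
pose Q q := U q /\ Kact (Z2 c) q = g *: q.
have Q0 : Q 0 by split; [exact: subspace0 | rewrite K_act0 scaler0].
have QZD a q q' : Q q -> Q q' -> Q (a *: q + q').
  move=> [Uq Zq] [Uq' Zq']; split; first exact: subspaceZD.
  by rewrite K_act_linr Zq Zq' scalerDr !scalerA mulrC.
have QZ1 q : Q q -> Q (Kact (Z1 c) q).
  move=> [Uq Zq]; split; first exact: low_space_Z1.
  have /eqP := Z2_Z1 c; rewrite subr_eq0 => /eqP E.
  by rewrite -K_actM E K_actM Zq -[g *: q]addr0 K_act_linr K_act0 addr0.
have Qs q : Q q -> span (fun x => x \in s) q by case=> /Us.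
have := @selfadjoint_eig _ _ _ h_herm h_pos (Kact (Z1 c)) (Subspace Q0 QZD)
  (fun e u v => K_act_linr (Z1 c) e u v) QZ1
  (fun u v _ _ => sym_Z1 u v) s u Qs (conj Uu Zu).
apply: spanS => q [[[q1 q2 q3] q4] [nu q5]]; apply: span_base.
by exists l => //; exists nu; split=> //=; rewrite q4 gE.
Qed.

(** In each degree the orthogonal complement of the raised vectors is killed by
    the lowering operators, because these are the adjoints of the raising ones;
    by [low_span] it consists of sums of lowest weight vectors. *)
Lemma K_generated (T : subspace K) :
  (forall k l nu p, (l <= n)%N -> low p (lam k) nu (gam l) -> T p) ->
  (forall p, T p -> T (Kact Fp p)) -> (forall p, T p -> T (Kact Gp p)) ->
  forall p, T p.
Proof.
move=> Tlow TF TG p.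
apply: span_sub (K_H_span tau_N p) => {}p [k].
have low_T j q : low_space j q -> T q.
  by move=> /low_span; apply: span_sub => r [l ln [nu lr]]; apply: Tlow lr.
have act_lam X j q :
    (forall q, Kact (Hop c) (Kact X q) = Kact X (1 *: q + Kact (Hop c) q)) ->
    Kact (Hop c) q = lam j *: q -> Kact (Hop c) (Kact X q) = lam j.+1 *: Kact X q.
  move=> HX Hq; rewrite HX Hq -scalerDl -H_weightS -[_ *: q]addr0 K_act_linr K_act0.
  by rewrite addr0.
have lam_act X j q :
    (forall q, Kact (Hop c) (Kact X q) = Kact X (-1 *: q + Kact (Hop c) q)) ->
    Kact (Hop c) q = lam j.+1 *: q -> Kact (Hop c) (Kact X q) = lam j *: Kact X q.
  move=> HX Hq; rewrite HX Hq -scalerDl H_weightS addKr -[_ *: q]addr0.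
  by rewrite K_act_linr K_act0 addr0.
have HFp := act_H_Fp (P := K_rep c tau); have HGp := act_H_Gp (P := K_rep c tau).
have HFm := act_H_Fm (P := K_rep c tau); have HGm := act_H_Gm (P := K_rep c tau).
elim: k p => [|k IH] p Hp.
  (* in degree 0 the lowering operators would lead to degree -1 *)
  have lower0 X :
      (forall q, Kact (Hop c) (Kact X q) = Kact X (-1 *: q + Kact (Hop c) q)) ->
      Kact X p = 0.
    move=> HX; apply: (K_H_neg tau_N); rewrite HX Hp -scalerDl -[_ *: p]addr0.
    by rewrite K_act_linr K_act0 addr0 /H_weight add0r addrC.
  by apply: (low_T 0); split=> //; apply: lower0.
have [s [sk ks]] := K_H_fin tau_N k.
pose r := [seq Kact Fp x | x <- s] ++ [seq Kact Gp x | x <- s].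
have [q rq pq] := hform_proj h_herm h_pos r p.
have rP x : x \in r -> T x /\ Kact (Hop c) x = lam k.+1 *: x.
  rewrite mem_cat => /orP[] /mapP[y /sk Hy ->].
    by split; [apply/TF/IH | apply: act_lam].
  by split; [apply/TG/IH | apply: act_lam].
have Tq : T q by apply: span_sub rq => x /rP[].
rewrite -(subrK q p); apply: subspaceD => //; apply: (low_T k.+1).
have Hq : Kact (Hop c) q = lam k.+1 *: q.
  elim: rq => [|e u w /rP[_ Hu] _ Hw]; first by rewrite K_act0 scaler0.
  by rewrite K_act_linr Hu Hw scalerDr !scalerA mulrC.
have Hpq : Kact (Hop c) (p - q) = lam k.+1 *: (p - q).
  by rewrite -scaleN1r addrC K_act_linr Hp Hq scalerDr !scalerA mulrC.
have orth X : (forall x, x \in s -> Kact X x \in r) ->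
    forall y, Kact (Hop c) y = lam k *: y -> h (p - q) (Kact X y) = 0.
  move=> Xr y /ks; elim=> [|e u w us _ IHy]; first by rewrite K_act0 (hform0r h_herm).
  by rewrite K_act_linr (hformDr h_herm) (hformZr h_herm) IHy pq ?Xr // mulr0 addr0.
split=> //; apply: (hform_eq0 h_pos).
  rewrite (hformC h_herm) -h_Gp -(hformC h_herm); apply: orth; last exact: lam_act.
  by move=> x xs; rewrite mem_cat orbC map_f.
rewrite (hformC h_herm) -h_Fp -(hformC h_herm); apply: orth; last exact: lam_act.
by move=> x xs; rewrite mem_cat map_f.
Qed.

Local Notation idx := (decomposition_index c tau).
Implicit Types i j : idx.
Local Notation Mi i := (subspace_type (idx_Mult i)).

Lemma idx_low i (m : Mi i) :
  low (val m) (lam (idx_k i)) (idx_nu i) (gam (idx_l i)).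
Proof. by apply/(MultP tau_N); have := valP m; rewrite inE => /asboolP. Qed.

Lemma idx_orth i j (m : Mi i) (m' : Mi j) : i != j -> h (val m) (val m') = 0.
Proof.
move=> ij; have [_ _ Hm Zm Ym] := idx_low m; have [_ _ Hm' Zm' Ym'] := idx_low m'.
case: (eqVneq (idx_k i) (idx_k j)) => [kk|kk]; last first.
  by apply: (sym_eig_orth sym_H Hm Hm'); apply: contraNneq kk => /H_weight_inj ->.
case: (eqVneq (idx_nu i) (idx_nu j)) => [nn|nn]; last first.
  exact: (sym_eig_orth sym_Z1 Zm Zm').
apply: (sym_eig_orth sym_Z2 Ym Ym'); apply: contraNneq ij => /addIr/eqP.
rewrite eqr_nat => /eqP ll; apply/eqP/val_inj.
move: kk nn ll; rewrite /idx_k /idx_nu /idx_l.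
by case: (val i) (val j) => [[l k] e] [[l' k'] e'] /= -> -> /val_inj ->.
Qed.

Lemma centraliser_Mult i r p : u21_centraliser r ->
  idx_Mult i p -> idx_Mult i (Kact r p).
Proof.
move=> rC /(MultP tau_N) [p1 p2 p3 p4 p5]; apply/(MultP tau_N).
have rX (X : A) e : u21 X -> Kact X p = e *: p -> Kact X (Kact r p) = e *: Kact r p.
  move=> gX Xp; rewrite -K_actM -rC // K_actM Xp -[e *: p]addr0.
  by rewrite K_act_linr K_act0 addr0.
have gF := u21_partW (oddFm c); have gG := u21_partW (oddGm c).
have gH := u21_partW (evenH c); have gZ1 := u21_partW (evenZ1 c).
have gZ2 := u21_partW (evenZ2 c).
split; try exact: rX.
  by have := rX _ 0 gF; rewrite !scale0r; apply.
by have := rX _ 0 gG; rewrite !scale0r; apply.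
Qed.

Variable L : idx -> u21_rep c.
Hypothesis L_low : forall i,
  irreducible_lowest_weight (L i) (lam (idx_k i)) (idx_nu i) (gam (idx_l i)).

Lemma lw_vector i : {w : ur_W (L i) | w != 0 &
  lowvec w (lam (idx_k i)) (idx_nu i) (gam (idx_l i))}.
Proof.
apply/cid2; have [_ [w [w0 [_ w1 w2] [w3 w4 w5]]]] := L_low i.
by exists w.
Qed.

Let wi i : ur_W (L i) := s2val (lw_vector i).
Let wi_neq0 i : wi i != 0 := s2valP (lw_vector i).
Let wi_low i : lowvec (wi i) (lam (idx_k i)) (idx_nu i) (gam (idx_l i)) :=
  s2valP' (lw_vector i).
Let Li_irr i : ur_irreducible (L i) := proj1 (L_low i).

Let phi_exists i (m : Mi i) :=
  @intertwiner_exists _ _ _ _ (L i) (K_rep c tau) (Li_irr i) (wi i) (wi_neq0 i) h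
    h_herm h_pos h_Fp h_Gp _ _ _ (wi_low i) (val m) (idx_low m).

Definition phi i (m : Mi i) : ur_W (L i) -> K := projT1 (cid (phi_exists m)).

Lemma phiP i (m : Mi i) : [/\ intertwiner (P := K_rep c tau) (phi m),
  phi m (wi i) = val m & forall u, gen (P := K_rep c tau) (val m) (phi m u)].
Proof. exact: projT2 (cid (phi_exists m)). Qed.

(** Linearity of [phi] in [m] and its compatibility with the centraliser come from
    here: the right-hand sides of these identities are intertwining maps [psi]. *)
Lemma phi_uniq i (m : Mi i) psi : intertwiner (P := K_rep c tau) psi ->
  psi (wi i) = val m -> forall u, phi m u = psi u.
Proof.
move=> psi_int psiw; have [phi_int phiw _] := phiP m.
have Ew := etrans phiw (esym psiw).
exact: (intertwiner_eq (Li_irr i) (wi_neq0 i) phi_int psi_int Ew).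
Qed.

Lemma phi_linr i (m : Mi i) k u v : phi m (k *: u + v) = k *: phi m u + phi m v.
Proof. by have [[pl _] _ _] := phiP m; exact: pl. Qed.

Lemma phi_act i (m : Mi i) X u : u21 X -> phi m (ur_act X u) = Kact X (phi m u).
Proof. by have [[_ pX] _ _] := phiP m; exact: pX. Qed.

Lemma phi_linl i k (m m' : Mi i) u : phi (k *: m + m') u = k *: phi m u + phi m' u.
Proof.
apply: (@phi_uniq i _ (fun u => k *: phi m u + phi m' u)).
  split=> [e v v'|X v gX]; last first.
    by rewrite !phi_act //; exact/esym/K_act_linr.
  by rewrite !phi_linr !scalerDr addrACA !scalerA mulrC.
by have [_ -> _] := phiP m; have [_ -> _] := phiP m'; rewrite linearP.
Qed.

Lemma phi_centraliser i (m m' : Mi i) r u : u21_centraliser r ->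
  val m' = Kact r (val m) -> phi m' u = Kact r (phi m u).
Proof.
move=> rC m'E; apply: (@phi_uniq i _ (fun u => Kact r (phi m u))).
  split=> [e v v'|X v gX]; first by rewrite phi_linr K_act_linr.
  by rewrite phi_act // -K_actM rC // K_actM.
by have [_ -> _] := phiP m.
Qed.

Lemma phi_inj i (m : Mi i) u : val m != 0 -> phi m u = 0 -> u = 0.
Proof.
move=> m0; have [phi_int phiw _] := phiP m.
have pw : phi m (wi i) != 0 by rewrite phiw.
exact: (intertwiner_inj (Li_irr i) phi_int pw).
Qed.

Lemma phi_orth i j (m : Mi i) (m' : Mi j) u u' :
  h (val m) (val m') = 0 -> h (phi m u) (phi m' u') = 0.
Proof.
move=> mm'; have [_ _ g] := phiP m; have [_ _ g'] := phiP m'.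
exact: (gen_orth (P := K_rep c tau) h_herm h_Fp h_Gp
  (idx_low m) (idx_low m') mm' (g u) (g' u')).
Qed.

Local Notation T := (decomposition_sum L).

Lemma Phi_exists : exists Phi : {linear T -> K},
  forall i (m : Mi i) u, Phi (summand m u) = phi m u.
Proof.
have F i : {f : {linear tens (Mi i) (ur_W (L i)) -> K} |
    forall m u, f (tensor m u) = phi m u}.
  apply/cid/tens_lift => [k m m' u|k m u u']; first exact: phi_linl.
  exact: phi_linr.
have [Phi PhiE] := dsum_lift (fun i => projT1 (F i)).
exists Phi => i m u; rewrite /summand PhiE.
exact: (projT2 (F i)).
Qed.

Lemma summand_linl i k (m m' : Mi i) (u : ur_W (L i)) :
  summand (k *: m + m') u = k *: summand m u + summand m' u.
Proof. by rewrite /summand tensor_linl dsum_in_lin. Qed.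

Lemma summand_linr i k (m : Mi i) (u u' : ur_W (L i)) :
  summand m (k *: u + u') = k *: summand m u + summand m u'.
Proof. by rewrite /summand tensor_linr dsum_in_lin. Qed.

Lemma summand0l i (u : ur_W (L i)) : summand (0 : Mi i) u = 0.
Proof.
by have := summand_linl (-1) (0 : Mi i) 0 u; rewrite scaler0 addr0 scaleN1r addNr.
Qed.

Lemma summand0r i (m : Mi i) : summand m (0 : ur_W (L i)) = 0.
Proof.
by have := summand_linr (-1) m (0 : ur_W (L i)) 0; rewrite scaler0 addr0 scaleN1r addNr.
Qed.

(** Elements of the direct sum are handled as lists of pure tensors, of possibly
    different indices. *)
Record pure := Pure { pure_i : idx; pure_m : Mi pure_i; pure_w : ur_W (L pure_i) }.

Definition psum (s : seq pure) : T := \sum_(x <- s) summand (pure_m x) (pure_w x).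

Lemma psum_exists (t : T) : exists s, t = psum s.
Proof.
have P_lin k (t1 t2 : T) : (exists s, t1 = psum s) -> (exists s, t2 = psum s) ->
    exists s, k *: t1 + t2 = psum s.
  move=> [s1 ->] [s2 ->].
  exists ([seq Pure (k *: pure_m x) (pure_w x) | x <- s1] ++ s2).
  rewrite /psum big_cat big_map scaler_sumr; congr (_ + _).
  apply: eq_bigr => x _ /=; rewrite -[k *: pure_m x]addr0 summand_linl.
  by rewrite summand0l addr0.
elim/pmod_ind: t => [|[i t]|k t1 t2 IH1 IH2]; last exact: P_lin.
  by exists [::]; rewrite /psum big_nil.
elim/pmod_ind: t => [|[m u]|k t1 t2 IH1 IH2].
- exists [::]; rewrite /psum big_nil.
  have := dsum_in_lin (V := fun i => tens (Mi i) (ur_W (L i))) (i := i) (-1) 0 0.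
  by rewrite scaler0 addr0 scaleN1r addNr; apply.
- by exists [:: Pure m u]; rewrite /psum big_seq1.
- have := dsum_in_lin (V := fun i => tens (Mi i) (ur_W (L i))) (i := i) k t1 t2.
  by rewrite {1}/dsum_in => ->; exact: P_lin.
Qed.

Definition orth_to p (s : seq pure) :=
  foldr (fun x P => h p (val (pure_m x)) = 0 /\ P) True s.

Fixpoint orthogonal (s : seq pure) := match s with
  | [::] => True
  | x :: s => [/\ val (pure_m x) != 0, orth_to (val (pure_m x)) s & orthogonal s]
  end.

(** Gram-Schmidt inside the tensor product: writing [m] as [k e + m'] with [m']
    orthogonal to [e], the part [k e] is absorbed in the summand of [e].  For
    different indices the multiplicity spaces are orthogonal ([idx_orth]). *)
Lemma orthogonal_add s i (m : Mi i) (u : ur_W (L i)) : orthogonal s ->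
  exists s', [/\ orthogonal s', psum s' = summand m u + psum s &
    forall p, orth_to p s -> h p (val m) = 0 -> orth_to p s'].
Proof.
elim: s m => [|[j e v] s IH] m /=.
  move=> _; case: (eqVneq m 0) => [->|m0].
    by exists [::]; split=> //; rewrite summand0l add0r.
  exists [:: Pure m u]; split=> //; last by rewrite /psum big_seq1 big_nil addr0.
move=> [e0 es os]; case: (eqVneq i j) => [ij|ij]; last first.
  have [s' [os' Es' ts']] := IH m os.
  exists (Pure e v :: s'); split.
  - by split=> //; apply: ts' => //; apply: (idx_orth e m); rewrite eq_sym.
  - by rewrite /psum !big_cons -/(psum s') Es' addrCA.
  - by move=> p /= [pe ps] pm; split=> //; apply: ts'.
case: j / ij e v e0 es => e v e0 es.
have [k mk] := hform_proj1 h_herm h_pos (val m) (val e).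
have [s' [os' Es' ts']] := IH (- k *: e + m) os.
have val_m1 : val (- k *: e + m) = val m - k *: val e.
  by rewrite linearP /= scaleNr addrC.
exists (Pure e (k *: u + v) :: s'); split.
- split=> //; apply: ts' => //; apply: (hform_orthC h_herm); by rewrite val_m1.
- rewrite /psum !big_cons -/(psum s') Es' /= summand_linr summand_linl.
  rewrite scaleNr -/(psum s).
  by rewrite [LHS](AC (2*3) (4*(2*5)*(1*3))) /= subrr addr0.
- move=> p /= [pe ps] pm; split=> //; apply: ts' => //.
  rewrite val_m1 -scaleN1r (hformDr h_herm) pm add0r !(hformZr h_herm) pe.
  by rewrite !mulr0.
Qed.

Lemma orthogonal_exists (t : T) : exists s, orthogonal s /\ t = psum s.
Proof.
have [s ->] := psum_exists t; elim: s => [|[i m u] s [s' [os' Es']]].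
  by exists [::].
have [s'' [os'' Es'' _]] := orthogonal_add m u os'.
by exists s''; split=> //; rewrite Es'' -Es' /psum big_cons.
Qed.

Section Phi.
Variable Phi : {linear T -> K}.
Hypothesis PhiE : forall i (m : Mi i) u, Phi (summand m u) = phi m u.

Lemma Phi_psum s : Phi (psum s) = \sum_(x <- s) phi (pure_m x) (pure_w x).
Proof. by rewrite linear_sum; apply: eq_bigr => x _; exact: PhiE. Qed.

Lemma Phi_act X t : u21 X -> exists t', Kact X (Phi t) = Phi t'.
Proof.
move=> gX; have [s ->] := psum_exists t.
exists (psum [seq Pure (pure_m x) (ur_act X (pure_w x)) | x <- s]).
rewrite !Phi_psum big_map.
elim: s => [|x s IH]; first by rewrite !big_nil K_act0.
rewrite !big_cons -IH /= phi_act //.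
have := K_act_linr X 1 (phi (pure_m x) (pure_w x))
  (\sum_(y <- s) phi (pure_m y) (pure_w y)).
by rewrite !scale1r.
Qed.

Lemma Phi_ker t : Phi t = 0 -> t = 0.
Proof.
have [s [os ->]] := orthogonal_exists t.
rewrite Phi_psum; elim: s os => [|[i m u] s IH] /=.
  by move=> _ _; rewrite /psum big_nil.
move=> [m0 ms os]; rewrite big_cons /= => E.
have pm : h (phi m u) (\sum_(x <- s) phi (pure_m x) (pure_w x)) = 0.
  elim: s ms {os E IH} => [|[j m' u'] s IH] /=.
    by rewrite big_nil (hform0r h_herm).
  move=> [mm' ms]; rewrite big_cons (hformDr h_herm) IH // addr0.
  exact: phi_orth.
have phi0 : phi m u = 0.
  apply: (hform_eq0 h_pos).
  by have := congr1 (h (phi m u)) E; rewrite (hformDr h_herm) pm addr0 (hform0r h_herm).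
rewrite /psum big_cons /= (phi_inj m0 phi0) summand0r add0r.
by apply: IH => //; rewrite -[RHS]E phi0 add0r.
Qed.

Lemma Phi_surj p : exists t, Phi t = p.
Proof.
have T0 : exists t, Phi t = 0 by exists 0; rewrite linear0.
have TZD k q r : (exists t, Phi t = q) -> (exists t, Phi t = r) ->
    exists t, Phi t = k *: q + r.
  by move=> [t <-] [t' <-]; exists (k *: t + t'); rewrite linearP.
apply: (@K_generated (Subspace T0 TZD)) => [k l nu q ln lq|q [t <-]|q [t <-]] /=.
- case: (eqVneq q 0) => [->|q0]; first by exists 0; rewrite linear0.
  have mq := proj2 (MultP tau_N k l nu q) lq.
  have sp : spectrum c tau k l nu by exists q => //; case: mq.
  pose i : idx := exist _ (Ordinal (ln : (l < n.+1)%N), k, nu) (introT (asboolP _) sp).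
  have qi : q \in subspace_pred (idx_Mult i) by apply/asboolP.
  pose m : Mi i := exist _ q qi.
  by exists (summand m (wi i)); rewrite PhiE; have [_ -> _] := phiP m.
- by have [t' E] := Phi_act t (u21_partW (oddFp c)); exists t'.
- by have [t' E] := Phi_act t (u21_partW (oddGp c)); exists t'.
Qed.

Lemma Phi_bij : bijective Phi.
Proof.
have [g gE] := choice Phi_surj.
exists g => [t|p]; last exact: gE.
by apply/eqP; rewrite -subr_eq0; apply/eqP/Phi_ker; rewrite linearB /= gE subrr.
Qed.

End Phi.

Lemma decomposition : exists Phi : {linear T -> K}, joint_decomposition Phi.
Proof.
have [Phi PhiE] := Phi_exists; exists Phi; split.
- exact: Phi_bij.
- by move=> i r p rC; exact: centraliser_Mult.
- by move=> i m w X gX; rewrite !PhiE phi_act.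
- by move=> i m m' w r rC m'E; rewrite !PhiE; exact: phi_centraliser.
Qed.

End Decomposition.

Theorem corollary5p9 (R : realType) (n : nat) (D : reflection_setting R n)
    (c : rs_gT D -> R[i]) (tau : group_rep R (rs_gT D)) (N : R[i])
    (star : cherednik c -> cherednik c)
    (beta : standard c tau -> standard c tau -> R[i])
    (L : R[i] -> R[i] -> R[i] -> u21_rep c) :
  conj_invariant c ->
  (forall s, s \in rs_refl D -> c s \is Num.real) ->
  irreducible_rep tau ->
  (forall v, \sum_(s in rs_refl D) c s *: gr_act tau s v = N *: v) ->
  is_star star ->
  contravariant_form star beta ->
  unitarisable beta ->
  let lambda (i : decomposition_index c tau) : R[i] := (idx_k i)%:R + n%:R - N in
  let gamma (i : decomposition_index c tau) : R[i] := (idx_l i)%:R - n%:R / 2 in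
  let Li i := L (lambda i) (idx_nu i) (gamma i) in
  (forall i, irreducible_lowest_weight (Li i) (lambda i) (idx_nu i) (gamma i)) ->
  exists Phi : {linear decomposition_sum Li -> Kmod c tau},
    joint_decomposition Phi.
Proof.
move=> _ _ _ tau_N star_ok beta_ok h_pos lambda gamma Li Li_low.
exact: (@decomposition _ _ _ _ _ _ tau_N _ _ star_ok beta_ok h_pos Li Li_low).
Qed.
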